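(* Consider the spatially distributed setting with hierarchical priors described in the context, and suppose that the Assumption stated in the context holds. Let $f_0$ be a bounded function and assume that there exist measurable sets of functions $B_{n,m}^{(k)}$ such that for all local hierarchical priors $\Pi^{g,(k)}$, $k=1,\ldots,m$, and $\varepsilon_n\to 0$ such that $(n/m^2)\varepsilon_n^2\to\infty$, it holds that, for some $c,C>0$, $$\Pi^{g,(k)}\bigl(f:f\notin B_{n,m}^{(k)}\bigr)\le e^{-4(n/m)\varepsilon_n^2},$$ $$\Pi^{g,(k)}\bigl(f:\|f-f_0\|_{\infty,k}\le\varepsilon_n\bigr)\ge e^{-(n/m)\varepsilon_n^2},$$ $$\log N\bigl(c\varepsilon_n,B_{n,m}^{(k)},\|\cdot\|_{\infty,k}\bigr)\le C(n/m)\varepsilon_n^2.$$ Then the aggregated hierarchical posterior $\Pi_{n,m}^{g}(\cdot|\mathbf{Y})$ contracts around the truth with rate $\varepsilon_n$, i.e. $$\mathbb{E}_0\,\Pi_{n,m}^{g}\bigl(f: d_n(f,f_0)\ge M_n\varepsilon_n\,|\,\mathbf{Y}\bigr)\to 0,$$ for arbitrary $M_n\to\infty$. In the distributed nonparametric regression model or the distributed logistic regression (classification) model, the condition $(n/m^2)\varepsilon_n^2\to\infty$ may be relaxed to $m=o(n\varepsilon_n^2/\log n)$.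
   Context: Data. For each $n$ we observe independent pairs $(x_1,Y_1),\ldots,(x_n,Y_n)$, where the design points $x_i\in\mathcal{D}$ are fixed and the $Y_i$ are random; $\mathbf{Y}=(Y_1,\ldots,Y_n)$. Given a function $f:\mathcal{D}\to\mathbb{R}$, $Y_i$ has density $p_{f,i}$ with respect to a dominating measure $\mu_i$. The true function is $f_0$, and $\mathbb{E}_0$ denotes expectation under $f_0$. The two special models are: (i) nonparametric regression, $Y_i=f(x_i)+Z_i$ with $Z_i$ i.i.d. $\mathcal{N}(0,\sigma^2)$; (ii) logistic regression (classification), $Y_i\in\{0,1\}$ with $\Pr(Y_i=1|x_i)=\psi(f(x_i))$, $\psi(x)=1/(1+e^{-x})$. Distribution of the data. The design space $\mathcal{D}$ is partitioned into subregions $\mathcal{D}^{(1)},\ldots,\mathcal{D}^{(m)}$ ($m=m_n$ may depend on $n$), each containing $n/m$ of the design points. Machine $k$ receives $\mathbf{Y}^{(k)}=\{Y_i: x_i\in\mathcal{D}^{(k)}\}$. Priors and posteriors. For $\tau>0$ let $\Pi^{\tau,(k)}$ be the Gaussian process prior with scale $\tau$ used in machine $k$, i.e. the law of $t\mapsto G^{(k)}_{\tau t}$ for a given centered Gaussian process $G^{(k)}$ (identically distributed and independent across machines). Let $g$ be a Lebesgue density on $(0,\infty)$ (possibly depending on $n,m$). The hierarchical prior in machine $k$ is $\Pi^{g,(k)}(\cdot)=\int\Pi^{\tau,(k)}(\cdot)g(\tau)\,d\tau$, and $\Pi^{g,(k)}(\cdot|\mathbf{Y}^{(k)})$ is the corresponding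 posterior based on $\mathbf{Y}^{(k)}$. The aggregated posterior $\Pi^g_{n,m}(\cdot|\mathbf{Y})$ is the law of $f(x)=\sum_{k=1}^m 1_{\mathcal{D}^{(k)}}(x)f^{(k)}(x)$, where $f^{(k)}\sim\Pi^{g,(k)}(\cdot|\mathbf{Y}^{(k)})$ independently across $k$. Notation. $\|f\|_{\infty,k}=\sup_{x\in\mathcal{D}^{(k)}}|f(x)|$. $N(\varepsilon,B,\|\cdot\|)$ is the minimal number of $\|\cdot\|$-balls of radius $\varepsilon$ needed to cover $B$. $d_n(f,g)^2=\frac1n\sum_{i=1}^n h_i(f,g)^2$ with $h_i(f,g)^2=\int(\sqrt{p_{f,i}}-\sqrt{p_{g,i}})^2\,d\mu_i$. Assumption. For all bounded functions $f,g$, all $k$ and all $i$ with $x_i\in\mathcal{D}^{(k)}$, $$\max\{h_i(f,g)^2,K(p_{f,i},p_{g,i}),V(p_{f,i},p_{g,i})\}\lesssim\|f-g\|_{\infty,k}^2,$$ where $K(p,q)=\int\log(p/q)\,p\,d\mu_i$, $V(p,q)=\int(\log(p/q))^2p\,d\mu_i$, and $\lesssim$ means inequality up to a universal multiplicative constant.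
   Formalization: Added as the claim fails for a large constant in the Assumption: K(p_{f0,i},p_{f,i}) ≤ κ‖f−f0‖²_{∞,k} with κ<3 in the general model, 6σ²>1 in regression (nothing in logistic); prior draws are a.s. bounded, with the measurability needed for priors and posteriors. *)

(* Defs.v *)
From HB Require Import structures.
From mathcomp Require Export all_boot all_order all_algebra.
From mathcomp Require Export all_classical all_reals all_analysis.
From mathcomp Require Export measurable_realfun.
Export Order.TTheory GRing.Theory Num.Theory.
Export numFieldNormedType.Exports.

Set Implicit Arguments.
Unset Strict Implicit.
Unset Printing Implicit Defensive.

Global Open Scope classical_set_scope.
Global Open Scope ring_scope.

Section sup_norm_and_covering.
Context {R : realType} {X : Type}.

(* The sup-(semi)norm over A. It is extended-real valued so that it is +oo,
   and not a junk real, for a function that is unbounded on A. *)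
Definition supnorm (A : set X) (f : X -> R) : \bar R :=
  ereal_sup [set `|f x|%:E | x in A].

(* Closed balls with arbitrary centres; +oo when no finite cover exists. *)
Definition covering_number (r : R) (B : set (X -> R))
    (nrm : (X -> R) -> \bar R) : \bar R :=
  ereal_inf [set (size s)%:R%:E | s in
    [set s : seq (X -> R) |
       forall f, B f -> exists2 h, h \in s & (nrm (f \- h)%R <= r%:E)%E]].

End sup_norm_and_covering.

Section divergences.
Context {R : realType} d {T : measurableType d} (mu : set T -> \bar R).
Implicit Types p q : T -> R.

Definition hellinger2 p q : \bar R :=
  (\int[mu]_y ((Num.sqrt (p y) - Num.sqrt (q y)) ^+ 2)%:E)%E.

(* log(a / b) with log(a / 0) = +oo. Below it is always multiplied by a, and
   +oo * 0 = 0 in \bar R, which is the convention 0 log(0 / b) = 0. *)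
Definition log_ratio (a b : R) : \bar R :=
  if b == 0 then +oo%E else (ln (a / b))%:E.

Definition KL p q : \bar R :=
  (\int[mu]_y (log_ratio (p y) (q y) * (p y)%:E))%E.

Definition KV p q : \bar R :=
  (\int[mu]_y (log_ratio (p y) (q y) ^+ 2 * (p y)%:E))%E.

End divergences.

(* The product of nu_0, ..., nu_(m-1), as the iterated integral of an
   indicator function. *)
Definition ord_cons {F : Type} m (f : F) (v : 'I_m -> F) : 'I_m.+1 -> F :=
  fun i => if unlift ord0 i is Some j then v j else f.

Fixpoint product_prob {R : realType} d {F : measurableType d} (m : nat) :
    ('I_m -> set F -> \bar R) -> set ('I_m -> F) -> \bar R :=
  match m return ('I_m -> set F -> \bar R) -> set ('I_m -> F) -> \bar R with
  | 0 => fun _ A => if `[< exists v, A v >] then 1%E else 0%E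
  | m'.+1 => fun nu A =>
      (\int[nu ord0]_f
         product_prob (fun k => nu (lift ord0 k))
                      [set v | A (ord_cons f v)])%E
  end.

(* The n observations are made at point n i, i < n; the design space is cut
   into regions region n k, k < machines n (machines n is the m_n of the
   asymptotics). *)
Record design (X : Type) := Design {
  machines : nat -> nat ;
  point : forall n, 'I_n -> X ;
  region : forall n, 'I_(machines n) -> set X }.
Arguments point {X} s n i : rename.
Arguments region {X} s n k : rename.

(* Each region holds n / m design points; in particular m divides n. *)
Definition balanced {X : Type} (s : design X) := forall n, (0 < n)%N ->
  partition setT (region s n) setT /\
  forall k : 'I_(machines s n),
    (#|[pred i : 'I_n | point s n i \in region s n k]| * machines s n)%N = n.

Definition local_size (R : realType) {X : Type} (s : design X) n : R :=
  n%:R / (machines s n)%:R.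

Section random_elements.
Context {R : realType} d {Omega : measurableType d} (P : probability Omega R).

Definition independent_family n d' {T : measurableType d'}
    (Y : 'I_n -> Omega -> T) :=
  (forall i, measurable_fun setT (Y i)) /\
  forall A : 'I_n -> set T, (forall i, measurable (A i)) ->
    P [set w | forall i, A i (Y i w)] = (\prod_i P (Y i @^-1` A i))%E.

(* normal_prob 0 0 is not a Dirac mass in the library. *)
Definition centered_normal (s : R) (A : set R) : \bar R :=
  if s == 0 then \d_(0%R : R) A else normal_prob 0 s A.

Section processes.
Context {E : Type} (T : set E).
Implicit Types G : E -> {RV P >-> R}.

Definition centered_gaussian_process G :=
  forall q (t : 'I_q -> E) (a : 'I_q -> R), (forall j, T (t j)) ->
    exists s, forall A, measurable A ->
      P [set w | A (\sum_j a j * G (t j) w)] = centered_normal s A.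

Definition same_law G G' :=
  forall q (t : 'I_q -> E) (A : 'I_q -> set R),
    (forall j, T (t j)) -> (forall j, measurable (A j)) ->
    P [set w | forall j, A j (G (t j) w)] =
    P [set w | forall j, A j (G' (t j) w)].

Definition process_events G : set (set Omega) :=
  <<s [set G t @^-1` A | t in T & A in measurable] >>.

Definition independent_processes (G : nat -> E -> {RV P >-> R}) :=
  forall q (A : 'I_q -> set Omega), (forall k : 'I_q, process_events (G k) (A k)) ->
    P [set w | forall k, A k w] = (\prod_k P (A k))%E.

Definition iid_centered_gaussian (G : nat -> E -> {RV P >-> R}) :=
  [/\ forall k, centered_gaussian_process (G k),
      forall k l, same_law (G k) (G l) & independent_processes G].

End processes.
End random_elements.

(* Functions on D carry the sigma-algebra generated by S. As S is arbitrary
   this is an arbitrary sigma-algebra; it is left open because the cylinder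
   sigma-algebra is in general too small to contain sup-norm balls. *)
Definition functions_on {R : realType} {X : Type} (S : set (set (X -> R))) :=
  g_sigma_algebraType S.

Section priors.
Context {R : realType} {E : lmodType R} {D : set E}.
Variable S : set (set (D -> R)).
Context d {Omega : measurableType d} (P : probability Omega R).
Local Notation F := (functions_on S).
Implicit Type G : E -> {RV P >-> R}.

Definition dilates : set E :=
  [set s | exists2 tau : R, 0 < tau & exists t : D, s = tau *: val t].

Definition rescaled_path G (tau : R) (w : Omega) : F :=
  fun t : D => G (tau *: val t) w.

Definition scale_prior G (tau : R) : set F -> \bar R :=
  pushforward P (rescaled_path G tau).

Definition hierarchical_prior G (g : R -> R) (A : set F) : \bar R :=
  (\int[lebesgue_measure]_(tau in `]0%R, +oo[)
     (scale_prior G tau A * (g tau)%:E))%E.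

Definition scale_density (g : R -> R) :=
  [/\ measurable_fun (`]0, +oo[ : set R) g, forall tau, 0 < tau -> 0 <= g tau &
      (\int[lebesgue_measure]_(tau in `]0%R, +oo[) (g tau)%:E = 1)%E].

(* The rescaled process is, for each tau, a random bounded function, and its
   law is a Markov kernel in tau, so that its mixture over tau makes sense. *)
Definition scalable_process G :=
  [/\ forall tau, 0 < tau -> measurable_fun setT (rescaled_path G tau),
      forall tau, 0 < tau -> scale_prior G tau [set f | bounded_fun f] = 1%E &
      forall A : set F, measurable A ->
        measurable_fun (`]0, +oo[ : set R) (scale_prior G ^~ A : R -> \bar R)].

(* What must be measurable for the hypotheses and Bayes' formula to make
   sense. *)
Definition adequate_sigma_algebra (s : design D) (f0 : D -> R) (eps : R^nat) :=
  [/\ forall t : D, measurable_fun setT (fun f : F => f t),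
      measurable ([set f | bounded_fun f] : set F) &
      forall n (k : 'I_(machines s n)), (0 < n)%N ->
        measurable ([set f | (supnorm (region s n k) (f \- f0)%R <= (eps n)%:E)%E]
                    : set F)].

(* c, C and eps are those of the three conditions on the local priors:
   remaining mass, prior mass and entropy. *)
Definition prior_conditions (s : design D)
    (prior : forall n, 'I_(machines s n) -> set F -> \bar R)
    (B : forall n, 'I_(machines s n) -> set F)
    (f0 : D -> R) (eps : R^nat) (c C : R) :=
  forall n (k : 'I_(machines s n)), (0 < n)%N ->
    let N := local_size R s n in
    let norm_k := supnorm (region s n k) in
    [/\ measurable (B n k),
        (prior n k (~` B n k) <= (expR (- (4 * N * eps n ^+ 2)))%:E)%E,
        (prior n k [set f | norm_k (f \- f0)%R <= (eps n)%:E] >=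
           (expR (- (N * eps n ^+ 2)))%:E)%E &
        (lne (covering_number (c * eps n) (B n k) norm_k) <=
           (C * N * eps n ^+ 2)%:E)%E].

End priors.
Arguments scale_prior {R E D} S {d Omega P} G tau _ : rename.
Arguments hierarchical_prior {R E D} S {d Omega P} G g A : rename.

Definition machine_prior {R : realType} {E : lmodType R} {D : set E}
    (S : set (set (D -> R))) d {Omega : measurableType d}
    {P : probability Omega R} (s : design D) (G : nat -> E -> {RV P >-> R})
    (g : nat -> R -> R) n (k : 'I_(machines s n)) : set (functions_on S) -> \bar R :=
  hierarchical_prior S (G k) (g n).
Arguments machine_prior {R E D} S {d Omega P} s G g n k _ : rename.

Section posteriors.
Context {R : realType} {E : lmodType R} {D : set E}.
Variables (S : set (set (D -> R))) (s : design D).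
Local Notation F := (functions_on S).
Variable prior : forall n, 'I_(machines s n) -> set F -> \bar R.
Context d {T : measurableType d}.
(* p n i f is the density of Y_i under f *)
Variable p : forall n, 'I_n -> F -> T -> R.

Definition local_likelihood n (k : 'I_(machines s n)) (y : 'I_n -> T)
    (f : F) : R :=
  \prod_(i < n | point s n i \in region s n k) p i f (y i).

(* Where the normalizing integral is 0 or +oo, a null event in the model,
   this is 0. *)
Definition local_posterior n (k : 'I_(machines s n)) (y : 'I_n -> T)
    (A : set F) : \bar R :=
  (fine (\int[prior k]_(f in A) (local_likelihood k y f)%:E)%E /
   fine (\int[prior k]_f (local_likelihood k y f)%:E)%E)%:E.

Definition aggregate n (v : 'I_(machines s n) -> F) : F :=
  fun t : D => \sum_k \1_(region s n k) t * v k t.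

Definition aggregated_posterior n (y : 'I_n -> T) (A : set F) : \bar R :=
  product_prob (fun k => local_posterior k y) [set v | A (aggregate v)].

Variable mu : forall n, 'I_n -> set T -> \bar R.

Definition d_n n (f g : F) : R :=
  Num.sqrt (n%:R^-1 * \sum_(i < n) fine (hellinger2 (mu i) (p i f) (p i g))).

Definition contracts d' {W : measurableType d'} (P0 : probability W R)
    (Y : forall n, 'I_n -> W -> T) (f0 : F) (eps : R^nat) :=
  forall M : R^nat, M @ \oo --> +oo ->
    (\int[P0]_w aggregated_posterior (fun i => Y n i w)
        [set f | (M n * eps n <= d_n n f f0)%R])%E @[n --> \oo] --> 0%E.

(* p n i f is a probability density with respect to mu n i. *)
Definition dominated_model :=
  forall n (i : 'I_n),
    [/\ sigma_finite setT (mu i),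
        measurable_fun setT (fun z : F * T => p i z.1 z.2),
        forall f y, 0 <= p i f y &
        forall f, (\int[mu i]_y (p i f y)%:E = 1)%E].

Definition smooth_model := exists2 L : R, 0 < L &
  forall f g : F, bounded_fun f -> bounded_fun g ->
  forall n (k : 'I_(machines s n)) (i : 'I_n), region s n k (point s n i) ->
    (maxe (hellinger2 (mu i) (p i f) (p i g))
       (maxe (KL (mu i) (p i f) (p i g)) (KV (mu i) (p i f) (p i g)))
     <= L%:E * supnorm (region s n k) (f \- g)%R ^+ 2)%E.

(* The exponents 1 and 4 in prior_conditions presuppose a normalization of the
   log-likelihood: the evidence is only known to exceed
   exp(-(1 + kappa + delta) N eps^2), for any delta > 0, and this beats the
   remaining mass exp(-4 N eps^2) when kappa < 3. Contraction can fail for a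
   large kappa. *)
Definition kl_calibrated (f0 : F) := exists2 kappa : R, kappa < 3 &
  forall f : F, bounded_fun f ->
  forall n (k : 'I_(machines s n)) (i : 'I_n), region s n k (point s n i) ->
    (KL (mu i) (p i f0) (p i f)
     <= kappa%:E * supnorm (region s n k) (f \- f0)%R ^+ 2)%E.

End posteriors.

Section special_models.
Context {R : realType} {X : Type} (s : design X).

Definition regression_density (sigma : R) n (i : 'I_n) (f : X -> R) : R -> R :=
  normal_pdf (f (point s n i)) sigma.

Definition logistic (x : R) : R := (1 + expR (- x))^-1.

Definition logistic_density n (i : 'I_n) (f : X -> R) (y : bool) : R :=
  if y then logistic (f (point s n i)) else 1 - logistic (f (point s n i)).

(* (n / m^2) eps^2 -> oo *)
Definition strong_rate (eps : R^nat) :=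
  n%:R / (machines s n)%:R ^+ 2 * eps n ^+ 2 @[n --> \oo] --> +oo.

(* m = o(n eps^2 / log n) *)
Definition weak_rate (eps : R^nat) :=
  (fun n => (machines s n)%:R : R) =o_\oo
  (fun n => n%:R * eps n ^+ 2 / ln n%:R).

End special_models.

(* Main.v *)
From HB Require Import structures.
Require Import Defs.
From mathcomp Require Import ring lra.

Set Implicit Arguments.
Unset Strict Implicit.
Unset Printing Implicit Defensive.

(** A product measure charges a union of cylinders by at most the sum of the
    marginal masses, so it suffices that the posterior of each machine charges
    the functions that are Hellinger-far from the truth on its own region with
    expected mass o(1/m).  On one machine, with N = n/m observations, no tests
    are needed: the posterior mass of a small Hellinger ball V around a far
    centre is at most its square root, that is, the square root of the integral
    over V of the likelihood ratio divided by the one of the evidence.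
    Conditionally on the previous observations, the expected square root of the
    integral over V picks up, at each observation, the Hellinger affinity between
    the true density and a mixture of the densities of V, and by convexity this
    mixture is as close to the centre as the elements of V.  The expectation is
    thus exponentially small in N M^2 eps^2, which beats the entropy.
    By Fubini and Markov, the evidence exceeds exp(-(t + 1) N eps^2) / 2, with
    t < 3, outside an event of probability 2 eta as soon as, for every f in the
    sup-norm ball, the likelihood ratio of f is below exp(-t N eps^2) with
    probability at most eta.  In general Chebyshev's inequality gives
    eta = O(1 / (N eps^2)), and m eta -> 0 is the strong rate condition; in the
    two special models Chernoff's bound gives an eta exponentially small in
    N eps^2, and the weak rate condition suffices. *)

(** Write [x = N eps^2]. The square root halves the cost of the evidence: a Hellinger ball pays
    [expR ((t + 1) / 2 * x)] against a gain [expR (- M^2 / 8 * x)], so a large [M] absorbs any [t].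
    The complement of the sieve gains nothing from [M]: its prior mass [expR (- 4 * x)] is divided
    by the whole evidence, and [t < 3] is what makes [4 - (t + 1)] positive. Two obstacles shape the
    formalization. The observations are maps on an abstract probability space, with independence
    stated on boxes; conditioning on the past is done by giving that space the sigma-algebra of the
    past observations and applying Tonelli's theorem to its product with the range of the next one.
    The aggregated posterior, an iterated integral of the indicator of an arbitrary set, is not
    known to be measurable in the data; monotonicity of the integral of nonnegative functions is
    always available, and additivity is applied to measurable majorants only. *)

Section lower_integral.
Context d (T : measurableType d) (R : realType) (mu : {measure set T -> \bar R}).
Local Open Scope ereal_scope.
Import HBNNSimple.

(* No measurability: the integral of a nonnegative function is a supremum over
   the simple functions below it. *)
Lemma ge0_le_lower_integral (D : set T) (f g : T -> \bar R) :
  (forall x, D x -> 0 <= f x) -> (forall x, D x -> f x <= g x) ->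
  \int[mu]_(x in D) f x <= \int[mu]_(x in D) g x.
Proof.
move=> f0 fg; have g0 x : D x -> 0 <= g x.
  by move=> Dx; exact: le_trans (f0 _ Dx) (fg _ Dx).
rewrite !ge0_integralE//; apply: ge_ereal_sup => _ [h hf <-].
apply: ereal_sup_ubound; exists h => // x; apply: (le_trans (hf x)).
by rewrite /patch; case: ifPn => // /set_mem /fg.
Qed.

End lower_integral.

(** * Integration against a measure with a density *)

Section density.
Context d (T : measurableType d) (R : realType).
Variables mu nu : {measure set T -> \bar R}.
Variable g : T -> R.
Hypotheses (mg : measurable_fun setT g) (g0 : forall x, 0 <= g x).
Hypothesis nuE : forall A, measurable A -> nu A = (\int[mu]_(x in A) (g x)%:E)%E.
Local Open Scope ereal_scope.
Import HBNNSimple.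

(** Both sides are limits along simple functions increasing to [f]; on a level set of such a
    function the identity is [nuE]. *)
Lemma ge0_integral_density (f : T -> \bar R) :
  measurable_fun setT f -> (forall x, 0 <= f x) ->
  \int[nu]_x f x = \int[mu]_x (f x * (g x)%:E).
Proof.
move=> mf f0.
have mgE : measurable_fun setT (EFin \o g) by exact/measurable_EFinP.
pose h := nnsfun_approx measurableT mf.
have cvgh x : (h n x)%:E @[n --> \oo] --> f x.
  by apply: cvg_nnsfun_approx => // y _; exact: f0.
have ndh x : {homo (fun n => (h n x)%:E) : a b / (a <= b)%N >-> a <= b}.
  by move=> a b ab; rewrite lee_fin; exact/lefP/nd_nnsfun_approx.
have mh n : measurable_fun setT (fun x => (h n x)%:E) by exact/measurable_EFinP.
have -> : \int[nu]_x f x = limn (fun n => \int[nu]_x (h n x)%:E).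
  rewrite -monotone_convergence//; last by move=> n x _; rewrite lee_fin.
  by apply: eq_integral => x _; apply/esym/cvg_lim.
have -> : \int[mu]_x (f x * (g x)%:E) =
    limn (fun n => \int[mu]_x ((h n x)%:E * (g x)%:E)).
  rewrite -monotone_convergence//.
  - apply: eq_integral => x _; apply/esym/cvg_lim => //.
    by apply: cvgeZr => //; exact: cvgh.
  - by move=> n; exact: emeasurable_funM.
  - by move=> n x _; rewrite mule_ge0 ?lee_fin.
  - by move=> x _ a b ab; rewrite lee_wpmul2r ?lee_fin//; exact: ndh.
congr (limn _); apply/funext => n.
transitivity (\int[nu]_x
   (\sum_(y \in range (h n)) (y * \1_(h n @^-1` [set y]) x)%:E)).
  by apply: eq_integral => t _; rewrite /= fimfunE -fsumEFin.
have mi r : measurable_fun setT (fun x => (r * \1_(h n @^-1` [set r]) x)%:E).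
  by apply: (measurable_comp measurableT) => //; exact: measurable_funM.
rewrite ge0_integral_fsum//=; last by move=> y x _; exact: nnfun_muleindic_ge0.
transitivity (\int[mu]_x (\sum_(y \in range (h n))
    (y * \1_(h n @^-1` [set y]) x)%:E * (g x)%:E)); last first.
  apply: eq_integral => x _; rewrite -ge0_mule_fsuml; last first.
    by move=> y; exact: nnfun_muleindic_ge0.
  by rewrite fsumEFin // -(fimfunE _ x).
rewrite ge0_integral_fsum//; last 2 first.
- by move=> y; apply: emeasurable_funM => //; exact: mi.
- move=> y x _; apply: mule_ge0; last by rewrite lee_fin.
  exact: nnfun_muleindic_ge0.
apply: eq_fsbigr => r; rewrite inE => -[t _ <-].
under eq_integral do rewrite EFinM.
rewrite integralZl_indic_nnsfun// integral_indic// setIT nuE//.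
under [RHS]eq_integral do rewrite EFinM -muleA.
have mhi : measurable_fun setT (fun x => (\1_(h n @^-1` [set h n t]) x)%:E * (g x)%:E).
  by apply: emeasurable_funM => //; apply/measurable_EFinP; exact: measurable_indic.
rewrite ge0_integralZl//.
- rewrite integral_mkcond; congr (_ * _); apply: eq_integral => x _.
  by rewrite patchE indicE; case: ifPn; rewrite ?mul1e ?mul0e.
- by move=> x _; apply: mule_ge0; rewrite lee_fin.
- by rewrite lee_fin.
Qed.

End density.

(** * Integration of independent observations *)

Section independence.
Context {R : realType} d {W : measurableType d} (P : probability W R).
Context d' {T : measurableType d'} {n : nat} (Y : 'I_n -> W -> T).
Hypothesis indepY : independent_family P Y.

(* past s is W with the sigma-algebra generated by the Y i, i in s. *)
Definition past_events (s : seq 'I_n) : set (set W) :=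
  [set X | exists A : 'I_n -> set T, [/\ forall i, measurable (A i),
     forall i, i \notin s -> A i = setT & X = [set w | forall i, A i (Y i w)]]].

Definition past (s : seq 'I_n) := g_sigma_algebraType (past_events s).

Let mY i : measurable_fun setT (Y i). Proof. by case: indepY. Qed.

Let measurable_box (A : 'I_n -> set T) : (forall i, measurable (A i)) ->
  measurable [set w | forall i, A i (Y i w)].
Proof.
move=> mA; rewrite (_ : [set w | _] = \bigcap_(i in [set: 'I_n]) (Y i @^-1` A i)).
  apply: fin_bigcap_measurable; first exact: finite_finset.
  by move=> i _; rewrite -[X in measurable X]setTI; exact: mY.
by apply/seteqP; split=> [w h i _|w h i]; [exact: h|exact: h].
Qed.

Let past_eventsT s : past_events s setT.
Proof.
exists (fun=> setT); split => //.
by apply/seteqP; split.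
Qed.

Let past_eventsS s : past_events s `<=` measurable.
Proof. by move=> _ [A [mA _ ->]]; exact: measurable_box. Qed.

Lemma past_measurable s (A : set (past s)) :
  measurable A -> measurable (A : set W).
Proof.
by apply: smallest_sub; [exact: sigma_algebra_measurable|exact: past_eventsS].
Qed.

Lemma measurable_past s i : i \in s ->
  measurable_fun setT (Y i : past s -> T).
Proof.
move=> si _ A mA; rewrite setTI; apply: sub_sigma_algebra.
exists (fun j => if j == i then A else setT); split.
- by move=> j; case: ifP.
- by move=> j; case: eqP => // ->; rewrite si.
- apply/seteqP; split=> w /=; first by move=> Aw j; case: eqP => // ->.
  by move=> /(_ i); rewrite eqxx.
Qed.

(** With [B] fixed, both sides are finite measures in [X]. They agree on the boxes, a pi-system
    generating the sigma-algebra of the past, hence everywhere on it. *)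
Lemma past_indep s j (X : set W) (B : set T) :
  j \notin s -> measurable (X : set (past s)) -> measurable B ->
  P (X `&` Y j @^-1` B) = (P X * P (Y j @^-1` B))%E.
Proof.
move=> js mX mB.
have mYB : measurable (Y j @^-1` B).
  by rewrite -[X in measurable X]setTI; exact: mY.
have PB0 : 0 <= fine (P (Y j @^-1` B)) by rewrite fine_ge0.
have PBE : P (Y j @^-1` B) = (fine (P (Y j @^-1` B)))%:E.
  by rewrite fineK// fin_num_measure.
rewrite muleC PBE.
have := @g_sigma_algebra_measure_unique _ R _ (past_events s) (@past_eventsS s)
  (fun=> setT) (fun=> past_eventsT s) _ (mrestr P mYB)
  (mscale (NngNum PB0) P) _ _ _ X mX.
rewrite /mrestr /mscale /=; apply.
- by apply/seteqP; split => // w _; exists 0%N.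
- move=> _ _ [A [mA As ->]] [A' [mA' As' ->]].
  exists (fun i => A i `&` A' i); split.
  + by move=> i; exact: measurableI.
  + by move=> i si; rewrite As// As'// setTI.
  + apply/seteqP; split=> w /=; first by move=> [h h'] i; split.
    by move=> h; split=> i; have [] := h i.
- move=> _ [A [mA As ->]].
  (* Since [j \notin s], the [j]-th side of the box is the whole space and [B] can take its
     place. *)
  pose A' := fun i => if i == j then B else A i.
  have mA' i : measurable (A' i) by rewrite /A'; case: ifP.
  rewrite /mrestr; transitivity (P [set w | forall i, A' i (Y i w)]).
    congr (P _); apply/seteqP; split=> w /=.
      by move=> [h hB] i; rewrite /A'; case: eqP => // ->.
    move=> h; split; last by have := h j; rewrite /A' eqxx.
    move=> i; have := h i; rewrite /A'; case: eqP => // -> _.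
    by rewrite As.
  case: indepY => _ indep; rewrite /mscale/= !indep//.
  rewrite (bigD1 j)//= [in RHS](bigD1 j)//= As// preimage_setT probability_setT.
  rewrite mul1e /A' eqxx PBE; congr (_ * _)%E.
  by apply: eq_bigr => i /negbTE ->.
- by move=> _; rewrite /mrestr setTI -ge0_fin_numE// fin_num_measure.
Qed.

(** Independence makes the law of the pair formed by the past and [Y j] a product measure, so that
    Tonelli's theorem plays the part of a conditional expectation given the past. *)
Lemma integral_past s j (f : past s * T -> \bar R) :
  j \notin s -> measurable_fun setT f -> (forall z, 0 <= f z)%E ->
  (\int[P]_w f (w : past s, Y j w) =
   \int[P]_w \int[pushforward P (Y j)]_y f (w : past s, y))%E.
Proof.
move=> js mf f0.
pose id' : W -> past s := id.
have mid : measurable_fun setT id'.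
  by move=> _ A /past_measurable mA; rewrite setTI.
pose I : {mfun W >-> past s} := HB.pack id' (isMeasurableFun.Build _ _ _ _ _ mid).
pose Yj : {mfun W >-> T} := HB.pack (Y j) (isMeasurableFun.Build _ _ _ _ _ (mY j)).
have mIY : measurable_fun setT (fun w => (id' w, Y j w)).
  exact: measurable_fun_pair.
pose IY : {mfun W >-> (past s * T)%type} :=
  HB.pack (fun w => (id' w, Y j w)) (isMeasurableFun.Build _ _ _ _ _ mIY).
rewrite -[LHS](@ge0_integral_distribution _ _ _ _ _ P IY f)//.
rewrite (eq_measure_integral (distribution P I \x distribution P Yj)%E); last first.
  move=> A mA _; apply/esym/product_measure_unique => // B C mB mC.
  rewrite /distribution /pushforward /= -(past_indep js)//; congr (P _).
rewrite fubini_tonelli1//.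
rewrite (@ge0_integral_distribution _ _ _ _ _ P I (fubini_F (distribution P Yj) f))//.
- exact: measurable_fun_fubini_tonelli_F.
- by move=> y; apply: integral_ge0.
Qed.

End independence.

(** * Measurability of quotients, comparison sets and partial integrals *)

Section measurability.
Context {R : realType} d {T : measurableType d}.

Lemma measurable_sqrt : measurable_fun setT (@Num.sqrt R).
Proof. by apply: continuous_measurable_fun; exact: sqrt_continuous. Qed.

(** On nonnegative reals the inverse is the power of exponent -1, the value 0 at 0 included, and
    powers are measurable. *)
Lemma measurable_fun_div_ge0 (f g : T -> R) :
  measurable_fun setT f -> measurable_fun setT g -> (forall x, 0 <= g x) ->
  measurable_fun setT (fun x => f x / g x).
Proof.
move=> mf mg g0; apply: measurable_funM => //.
rewrite (_ : (fun x => (g x)^-1) = (fun r => r `^ (-1)) \o g).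
  by apply: measurableT_comp => //; exact: measurable_powR.
by apply/funext => x /=; rewrite powR_inv1.
Qed.

End measurability.

Section measurable_sets.
Context {R : realType} d {T : measurableType d}.

Lemma measurable_set_ltr (f g : T -> R) :
  measurable_fun setT f -> measurable_fun setT g -> measurable [set x | f x < g x].
Proof.
move=> mf mg; have := measurable_fun_ltr mf mg.
move=> /(_ measurableT [set true]) /(_ Logic.I); rewrite setTI.
by congr (measurable _); apply/seteqP; split => x /=.
Qed.

Lemma measurable_set_ler (f g : T -> R) :
  measurable_fun setT f -> measurable_fun setT g -> measurable [set x | f x <= g x].
Proof.
move=> mf mg; have := measurable_fun_ler mf mg.
move=> /(_ measurableT [set true]) /(_ Logic.I); rewrite setTI.
by congr (measurable _); apply/seteqP; split => x /=.
Qed.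

Lemma measurable_set_lte (f g : T -> \bar R) :
  measurable_fun setT f -> measurable_fun setT g ->
  measurable [set x | (f x < g x)%E].
Proof.
move=> mf mg; have := measurable_fun_lte mf mg.
move=> /(_ measurableT [set true]) /(_ Logic.I); rewrite setTI.
by congr (measurable _); apply/seteqP; split => x /=.
Qed.

End measurable_sets.

Section partial_integral.
Context {R : realType} d1 {T1 : measurableType d1} d2 {T2 : measurableType d2}.
Variable m2 : {sigma_finite_measure set T2 -> \bar R}.
Variable f : T1 -> T2 -> R.
Hypothesis mf : measurable_fun setT (fun z : T1 * T2 => f z.1 z.2).
Hypothesis f0 : forall x y, 0 <= f x y.

Lemma measurable_partial_integral :
  measurable_fun setT (fun x => \int[m2]_y (f x y)%:E)%E.
Proof.
apply: (@measurable_fun_fubini_tonelli_F _ _ _ _ _ m2 (fun z => (f z.1 z.2)%:E)).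
  exact/measurable_EFinP.
by move=> z; rewrite lee_fin.
Qed.

Lemma measurable_fine_partial_integral :
  measurable_fun setT (fun x => fine (\int[m2]_y (f x y)%:E)%E).
Proof.
apply: (measurableT_comp (@fine_measurable R setT measurableT)).
exact: measurable_partial_integral.
Qed.

Lemma partial_integral_ge0 x : (0 <= \int[m2]_y (f x y)%:E)%E.
Proof. by apply: integral_ge0 => y _; rewrite lee_fin. Qed.

End partial_integral.

(** * Moments of products and sums of independent observations *)

Section independent_densities.
Context {R : realType} d {W : measurableType d} (P : probability W R).
Context d' {T : measurableType d'} {n : nat} (Y : 'I_n -> W -> T).
Hypothesis indepY : independent_family P Y.
Variables (mu : 'I_n -> {sigma_finite_measure set T -> \bar R}) (q : 'I_n -> T -> R).
Hypotheses (mq : forall i, measurable_fun setT (q i)) (q0 : forall i y, 0 <= q i y).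
Hypothesis lawY : forall i A, measurable A ->
  P (Y i @^-1` A) = (\int[mu i]_(y in A) (q i y)%:E)%E.

Let mY i : measurable_fun setT (Y i). Proof. by case: indepY. Qed.

Local Open Scope ereal_scope.

Lemma integral_past_density s j (f : past Y s * T -> \bar R) :
  j \notin s -> measurable_fun setT f -> (forall z, 0 <= f z) ->
  \int[P]_w f (w : past Y s, Y j w) =
  \int[P]_w \int[mu j]_y (f (w : past Y s, y) * (q j y)%:E).
Proof.
move=> js mf f0; rewrite integral_past//; apply: eq_integral => w _.
pose Yj : {mfun W >-> T} := HB.pack (Y j) (isMeasurableFun.Build _ _ _ _ _ (mY j)).
rewrite (@ge0_integral_density _ _ _ (mu j) (distribution P Yj) (q j))//.
- by move=> A mA; exact: lawY.
- by apply: measurableT_comp => //; exact: measurable_fun_pair2.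
Qed.

(** The head of the list is integrated out first, with the tail as its past, and leaves the factor
    [c j]. Likelihood ratios (with [c = 1]) and exponential moments are both bounded in this way. *)
Lemma integral_prod_le (s : seq 'I_n) (phi : 'I_n -> T -> R) (c : 'I_n -> R) :
  uniq s -> (forall i, measurable_fun setT (phi i)) ->
  (forall i y, 0 <= phi i y)%R -> (forall i, 0 <= c i)%R ->
  (forall i, i \in s -> \int[mu i]_y (phi i y * q i y)%:E <= (c i)%:E) ->
  \int[P]_w (\prod_(i <- s) phi i (Y i w))%:E <= (\prod_(i <- s) c i)%:E.
Proof.
move=> + mphi phi0 c0; elim: s => [_ _|j s IH /= /andP[js us] hs].
  under eq_integral do rewrite big_nil.
  by rewrite big_nil integral_cst//= mul1e probability_le1.
have mpast : measurable_fun setT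
    (fun w : past Y s => \prod_(i <- s) phi i (Y i w))%R.
  apply: measurable_prod => i si; apply: measurableT_comp => //.
  exact: measurable_past.
have mW : measurable_fun setT (fun w : W => \prod_(i <- s) phi i (Y i w))%R.
  by apply: measurable_prod => i si; apply: measurableT_comp.
have prod0 w : (0 <= \prod_(i <- s) phi i (Y i w))%R.
  by apply: prodr_ge0 => i _; exact: phi0.
under eq_integral do rewrite big_cons.
pose f := fun z : past Y s * T =>
  ((phi j z.2 * \prod_(i <- s) phi i (Y i z.1))%:E : \bar R).
rewrite -[leLHS]/(\int[P]_w f (w : past Y s, Y j w)) integral_past_density//; first last.
- by move=> z; rewrite lee_fin mulr_ge0.
- apply/measurable_EFinP; apply: measurable_funM.
    exact: measurableT_comp.
  exact: (measurableT_comp mpast).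
have inner w : \int[mu j]_y (f (w : past Y s, y) * (q j y)%:E) <=
    (c j)%:E * (\prod_(i <- s) phi i (Y i w))%:E.
  rewrite /f /=; under eq_integral do rewrite -EFinM mulrAC EFinM.
  rewrite ge0_integralZr//.
  - by rewrite lee_wpmul2r ?lee_fin// hs// mem_head.
  - by apply/measurable_EFinP; exact: measurable_funM.
  - by move=> y _; rewrite lee_fin mulr_ge0.
  - by rewrite lee_fin.
apply: (@le_trans _ _ (\int[P]_w ((c j)%:E * (\prod_(i <- s) phi i (Y i w))%:E))).
  apply: ge0_le_lower_integral => // w _; apply: integral_ge0 => y _.
  by rewrite mule_ge0 ?lee_fin// mulr_ge0.
rewrite ge0_integralZl//; first last.
- by rewrite lee_fin.
- by move=> w _; rewrite lee_fin.
- exact/measurable_EFinP.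
rewrite big_cons EFinM lee_wpmul2l ?lee_fin// IH// => i si.
by apply: hs; rewrite inE si orbT.
Qed.

(** The hypothesis, required for every shift [a], expresses that [X i] is centred with variance at
    most [v i] without mentioning its mean. In the induction the shift is the sum over the past. *)
Lemma integral_sum_sqr_le (s : seq 'I_n) (X : 'I_n -> T -> R) (v : 'I_n -> R) :
  uniq s -> (forall i, measurable_fun setT (X i)) ->
  (forall i a, i \in s ->
    \int[mu i]_y ((X i y + a) ^+ 2 * q i y)%:E <= (a ^+ 2 + v i)%:E) ->
  \int[P]_w ((\sum_(i <- s) X i (Y i w)) ^+ 2)%:E <= (\sum_(i <- s) v i)%:E.
Proof.
move=> + mX; elim: s => [_ _|j s IH /= /andP[js us] hs].
  under eq_integral do rewrite big_nil expr0n/=.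
  by rewrite big_nil integral0.
have mpast : measurable_fun setT
    (fun w : past Y s => \sum_(i <- s) X i (Y i w))%R.
  (* Measurability is asked of the term at every index, but on [past Y s] only the indices in [s]
     have it; the other terms are replaced by 0. *)
  rewrite (_ : (fun _ => _) = fun w : past Y s => (\sum_(i <- s)
     (if i \in s then X i (Y i w) else 0)))%R; last first.
    by apply/funext => w; rewrite -big_mkcond [LHS]big_seq.
  apply: measurable_sum => i; case: (boolP (i \in s)) => si //.
  by apply: measurableT_comp => //; exact: measurable_past.
have mW : measurable_fun setT (fun w : W => \sum_(i <- s) X i (Y i w))%R.
  by apply: measurable_sum => i; apply: measurableT_comp.
under eq_integral do rewrite big_cons.
pose f := fun z : past Y s * T =>
  (((X j z.2 + \sum_(i <- s) X i (Y i z.1)) ^+ 2)%:E : \bar R).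
rewrite -[leLHS]/(\int[P]_w f (w : past Y s, Y j w)) integral_past_density//; first last.
- by move=> z; rewrite lee_fin sqr_ge0.
- apply/measurable_EFinP; apply: measurable_funX; apply: measurable_funD.
    exact: measurableT_comp.
  exact: (measurableT_comp mpast).
have vj0 : (0 <= v j)%R.
  have := hs j 0%R (mem_head _ _); rewrite expr0n/= add0r -lee_fin.
  by apply: le_trans; apply: integral_ge0 => y _; rewrite lee_fin mulr_ge0 ?sqr_ge0.
apply: (@le_trans _ _ (\int[P]_w (((\sum_(i <- s) X i (Y i w)) ^+ 2)%:E + (v j)%:E))).
  apply: ge0_le_lower_integral => // w _.
    by apply: integral_ge0 => y _; rewrite mule_ge0 ?lee_fin// sqr_ge0.
  rewrite -EFinD /f /=; under eq_integral do rewrite -EFinM.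
  exact: (hs j (\sum_(i <- s) X i (Y i w))%R (mem_head _ _)).
rewrite ge0_integralD//; first last.
- by apply/measurable_EFinP; exact: measurable_funX.
- by move=> w _; rewrite lee_fin sqr_ge0.
rewrite integral_cst//= probability_setT mule1 big_cons EFinD [leLHS]addeC leeD2l//.
by apply: IH => // i a si; apply: hs; rewrite inE si orbT.
Qed.

End independent_densities.

(** * Hellinger affinity to a mixture *)

Section hellinger_affinity.
Context {R : realType} d {F : measurableType d} d' {T : measurableType d'}.
Variables (Pi : {sigma_finite_measure set F -> \bar R})
  (mu : {sigma_finite_measure set T -> \bar R}).
Variable p : F -> T -> R.
Hypotheses (mp : measurable_fun setT (fun z : F * T => p z.1 z.2))
  (p0 : forall f y, 0 <= p f y)
  (p1 : forall f, (\int[mu]_y (p f y)%:E = 1)%E).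
Variables (g : F -> R) (G : R).
Hypotheses (mg : measurable_fun setT g) (g0 : forall f, 0 <= g f)
  (gG : (\int[Pi]_f (g f)%:E = G%:E)%E).

Let mpT : measurable_fun setT (fun z : T * F => p z.2 z.1).
Proof.
rewrite (_ : (fun _ => _) = (fun z : F * T => p z.1 z.2) \o (fun z : T * F => (z.2, z.1)))//.
by apply: measurableT_comp => //; exact: measurable_fun_pair.
Qed.

Let mpf f : measurable_fun setT (p f).
Proof. exact: (measurableT_comp mp (pair1_measurable f)). Qed.

Let mpy y : measurable_fun setT (p ^~ y).
Proof. exact: (measurableT_comp mp (pair2_measurable y)). Qed.

Let mix y := (\int[Pi]_f (p f y * g f)%:E)%E.

Let mixT : measurable_fun setT (fun z : T * F => p z.2 z.1 * g z.2).
Proof. by apply: measurable_funM => //; exact: measurableT_comp. Qed.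

Let pg0 y f : 0 <= p f y * g f. Proof. exact: mulr_ge0. Qed.

Lemma measurable_fine_mixture : measurable_fun setT (fun y => fine (mix y)).
Proof. by apply: (@measurable_fine_partial_integral _ _ _ _ _ Pi (fun y f => p f y * g f)). Qed.

Let G0 : 0 <= G.
Proof. by rewrite -lee_fin -gG; apply: integral_ge0 => f _; rewrite lee_fin. Qed.

Let integral_mix : (\int[mu]_y mix y = G%:E)%E.
Proof.
rewrite /mix (@fubini_tonelli _ _ _ _ _ mu Pi (fun z => (p z.2 z.1 * g z.2)%:E))//=.
- rewrite -gG; apply: eq_integral => f _; under eq_integral do rewrite EFinM.
  rewrite ge0_integralZr//= ?p1 ?mul1e ?lee_fin//.
  + exact/measurable_EFinP.
  + by move=> y _; rewrite lee_fin.
- exact/measurable_EFinP.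
- by move=> z; rewrite lee_fin.
Qed.

Let fine_mix_le y : ((fine (mix y))%:E <= mix y)%E.
Proof.
have : (0 <= mix y)%E by apply: integral_ge0 => f _; rewrite lee_fin.
by case: (mix y).
Qed.

Lemma integral_fine_mixture_le : (\int[mu]_y (fine (mix y))%:E <= G%:E)%E.
Proof.
rewrite -integral_mix; apply: ge0_le_lower_integral => [y _|y _]; last exact: fine_mix_le.
by rewrite lee_fin fine_ge0//; apply: integral_ge0 => f _; rewrite lee_fin.
Qed.

Variable q : T -> R.
Hypotheses (mq : measurable_fun setT q) (q0 : forall y, 0 <= q y).

Let spread y := (\int[Pi]_f ((Num.sqrt (p f y) - Num.sqrt (q y)) ^+ 2 * g f)%:E)%E.

Let mspreadT : measurable_fun setT
  (fun z : T * F => (Num.sqrt (p z.2 z.1) - Num.sqrt (q z.1)) ^+ 2 * g z.2).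
Proof.
apply: measurable_funM; last exact: measurableT_comp.
apply: measurable_funX; apply: measurable_funB.
  by apply: (measurableT_comp measurable_sqrt).
by apply: (measurableT_comp measurable_sqrt); exact: measurableT_comp.
Qed.

Let mspread y : measurable_fun setT
  (fun f => (Num.sqrt (p f y) - Num.sqrt (q y)) ^+ 2 * g f).
Proof. exact: (measurableT_comp mspreadT (pair1_measurable y)). Qed.

Let spread_ge0 y f : 0 <= (Num.sqrt (p f y) - Num.sqrt (q y)) ^+ 2 * g f.
Proof. by rewrite mulr_ge0// sqr_ge0. Qed.

Let integral_gZ k : 0 <= k -> (\int[Pi]_f (k * g f)%:E = (k * G)%:E)%E.
Proof.
move=> k0; under eq_integral do rewrite EFinM.
rewrite ge0_integralZl//= ?gG// ?lee_fin//.
- exact/measurable_EFinP.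
- by move=> f _; rewrite lee_fin.
Qed.

(** Cauchy-Schwarz in the form of the arithmetic-geometric inequality: [N] is the mixture, [s] the
    root of [q], and [eta] is free. The best value is [Num.sqrt (N / G)]; when [N = 0] this is 0,
    and it is approached by small [eta]. *)
Let sqrt_gap (N s h : R) : 0 < G -> 0 <= N -> 0 <= s ->
  (forall eta, 0 < eta -> N + s ^+ 2 * G <= h + s * (N / eta + eta * G)) ->
  G * (Num.sqrt (N / G) - s) ^+ 2 <= h.
Proof.
move=> Gp N0 s0 H; have [N_eq0|NN0] := eqVneq N 0.
  rewrite N_eq0 mul0r sqrtr0 sub0r sqrrN mulrC.
  apply/ler_addgt0Pr => e e0.
  have sG : 0 < s * G + 1 by rewrite ltr_wpDl// mulr_ge0// ltW.
  have /H : 0 < e / (s * G + 1) by rewrite divr_gt0.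
  rewrite N_eq0 mul0r !add0r => /le_trans; apply; rewrite lerD2l.
  rewrite mulrCA mulrAC ler_pdivrMr// ler_wpM2l ?(ltW e0)//.
  by rewrite lerDl.
set c := Num.sqrt _.
have Np : 0 < N by rewrite lt_neqAle eq_sym NN0.
have c2 : c ^+ 2 = N / G by rewrite sqr_sqrtr// divr_ge0// ltW.
have c0 : 0 < c by rewrite sqrtr_gt0 divr_gt0.
have NE : N = c ^+ 2 * G by rewrite c2 divfK// gt_eqF.
have := H _ c0; rewrite [in X in X -> _]NE.
rewrite (_ : c ^+ 2 * G / c = c * G); last by field; rewrite gt_eqF.
lra.
Qed.

(** Pointwise convexity of [(Num.sqrt u - s) ^+ 2] in [u]: the mean over the weights dominates the
    value at the mean. The inequality becomes linear in the integrands once [2 * s * r] is bounded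
    by [s / eta * r ^+ 2 + s * eta], with [r] the root of [p f y]. *)
Let spread_ge y : 0 < G ->
  ((G * (Num.sqrt (fine (mix y) / G) - Num.sqrt (q y)) ^+ 2)%:E <= spread y)%E.
Proof.
move=> Gp.
set s := Num.sqrt (q y).
have s0 : 0 <= s by exact: sqrtr_ge0.
have sp0 : (0 <= spread y)%E by apply: integral_ge0 => f _; rewrite lee_fin.
have m0 : (0 <= mix y)%E by apply: integral_ge0 => f _; rewrite lee_fin.
have mpgy : measurable_fun setT (fun f => (p f y * g f)%:E).
  by apply/measurable_EFinP; exact: measurable_funM.
case spE : (spread y) sp0 => [h| |] // _; last by rewrite leey.
have mspy : measurable_fun setT
    (fun f => ((Num.sqrt (p f y) - s) ^+ 2 * g f)%:E).
  exact/measurable_EFinP.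
have spE0 f : (0 <= ((Num.sqrt (p f y) - s) ^+ 2 * g f)%:E)%E by rewrite lee_fin.
have pgE0 f : (0 <= (p f y * g f)%:E)%E by rewrite lee_fin.
case mE : (mix y) m0 => [N| |] // N0; last first.
  (* An infinite mixture would contradict the finiteness of the spread, since
     [r ^+ 2 <= 2 * (r - s) ^+ 2 + 2 * s ^+ 2]. *)
  suff : (+oo <= (2 * h + 2 * s ^+ 2 * G)%:E)%E by rewrite leNgt ltry.
  rewrite -mE EFinD EFinM -spE -integral_gZ; last by rewrite mulr_ge0// sqr_ge0.
  rewrite /spread -ge0_integralZl_EFin//.
  rewrite -ge0_integralD//.
  - apply: ge0_le_lower_integral => f _; first by rewrite lee_fin.
    rewrite -EFinM -EFinD lee_fin mulrA -mulrDl ler_wpM2r//.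
    set r := Num.sqrt (p f y).
    have -> : p f y = r ^+ 2 by rewrite sqr_sqrtr.
    have := sqr_ge0 (r - 2 * s).
    rewrite -/s; nra.
  - by move=> f _; rewrite -EFinM lee_fin mulr_ge0.
  - exact: emeasurable_funM.
  - by move=> f _; rewrite lee_fin !mulr_ge0 ?sqr_ge0.
  - by apply/measurable_EFinP; exact: measurable_funM.
rewrite lee_fin /=; apply: sqrt_gap => // eta eta0.
have -> : (h + s * (N / eta + eta * G) = h + (s / eta) * N + s * eta * G)%R by ring.
rewrite -lee_fin !EFinD [in leRHS]EFinM -spE -mE -[in leRHS]ge0_integralZl_EFin//;
  last by rewrite divr_ge0// ltW.
rewrite -integral_gZ ?sqr_ge0// -integral_gZ; last by rewrite mulr_ge0// ltW.
rewrite /mix /spread -!ge0_integralD//.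
- apply: ge0_le_lower_integral => f _.
    by rewrite -EFinD lee_fin addr_ge0// mulr_ge0// sqr_ge0.
  rewrite -!EFinM -!EFinD lee_fin mulrA -!mulrDl ler_wpM2r//.
  set r := Num.sqrt (p f y).
  have -> : p f y = r ^+ 2 by rewrite sqr_sqrtr.
  have : 0 <= s * (r - eta) ^+ 2 / eta.
    by rewrite divr_ge0 ?(ltW eta0)// mulr_ge0// sqr_ge0.
  have -> : s * (r - eta) ^+ 2 / eta = s / eta * r ^+ 2 + s * eta - 2 * s * r.
    by field; rewrite gt_eqF.
  rewrite -/s; lra.
- move=> f _; apply: adde_ge0; first exact: spE0.
  by apply: mule_ge0; rewrite lee_fin// divr_ge0// ltW.
- by apply: emeasurable_funD => //; exact: emeasurable_funM.
- by move=> f _; rewrite lee_fin mulr_ge0// mulr_ge0// ltW.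
- by apply/measurable_EFinP; exact: measurable_funM.
- by move=> f _; apply: mule_ge0; rewrite lee_fin// divr_ge0// ltW.
- exact: emeasurable_funM.
- by move=> f _; rewrite lee_fin mulr_ge0// sqr_ge0.
- by apply/measurable_EFinP; exact: measurable_funM.
Qed.

Variable a : R.
Hypothesis qa : forall f, g f != 0 -> (hellinger2 mu (p f) q <= a%:E)%E.

Let integral_spread : (\int[mu]_y spread y <= (a * G)%:E)%E.
Proof.
rewrite /spread (@fubini_tonelli _ _ _ _ _ mu Pi (fun z =>
  ((Num.sqrt (p z.2 z.1) - Num.sqrt (q z.1)) ^+ 2 * g z.2)%:E))//=; last 2 first.
- exact/measurable_EFinP.
- by move=> z; rewrite lee_fin.
have a0 f : g f != 0 -> 0 <= a.
  move=> /qa; rewrite -lee_fin; apply: le_trans.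
  by apply: integral_ge0 => y _; rewrite lee_fin sqr_ge0.
(* If every weight vanishes, nothing forces [a] to be nonnegative, but both sides are 0. *)
have [Ga|] := pselect (exists f, g f != 0); last first.
  move=> /forallNP gz; have {}gz f : g f = 0 by apply/eqP; have /negP/negPn := gz f.
  rewrite -(_ : 0%E = (a * G)%:E); last first.
    suff -> : G = 0 by rewrite mulr0.
    by apply: EFin_inj; rewrite -gG integral0_eq// => f _; rewrite gz.
  rewrite le_eqVlt integral0_eq ?eqxx// => f _.
  by rewrite integral0_eq// => y _; rewrite gz mulr0.
have {}a0 : 0 <= a by case: Ga => f /a0.
rewrite -integral_gZ//; apply: ge0_le_lower_integral => f _.
  by apply: integral_ge0 => y _; rewrite lee_fin.
under eq_integral do rewrite EFinM.
rewrite ge0_integralZr//.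
- rewrite EFinM; have [->|gf] := eqVneq (g f) 0; first by rewrite !mule0.
  by rewrite lee_wpmul2r ?lee_fin//; exact: qa.
- apply/measurable_EFinP; apply: measurable_funX; apply: measurable_funB.
    exact: (measurableT_comp measurable_sqrt).
  exact: (measurableT_comp measurable_sqrt).
- by move=> y _; rewrite lee_fin sqr_ge0.
- by rewrite lee_fin.
Qed.

Variables (q' : T -> R) (b : R).
Hypotheses (mq' : measurable_fun setT q') (q'0 : forall y, 0 <= q' y)
  (q'1 : (\int[mu]_y (q' y)%:E = 1)%E) (b_le : (b%:E <= hellinger2 mu q' q)%E).

(* The mixture of p with weights g is as close to q as each component, since
   the Hellinger distance is convex, so it is as far from q' as q is, up to the
   triangle inequality. *)
Lemma hellinger_affinity_mixture_le :
  (\int[mu]_y (Num.sqrt (q' y) * Num.sqrt (fine (mix y)))%:E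
   <= (expR (a / 2 - b / 4) * Num.sqrt G)%:E)%E.
Proof.
have fm0 y : 0 <= fine (mix y).
  by rewrite fine_ge0//; apply: integral_ge0 => f _; rewrite lee_fin.
have mfm := measurable_fine_mixture.
have msq : measurable_fun setT (fun y => Num.sqrt (q' y)).
  exact: (measurableT_comp measurable_sqrt).
have msq1 : measurable_fun setT (fun y => Num.sqrt (q y)).
  exact: (measurableT_comp measurable_sqrt).
have [G_eq0|Gn0] := eqVneq G 0.
  rewrite [in leRHS]G_eq0 sqrtr0 mulr0.
  (* Here the mixture cannot be normalized. As it has mass 0 and [q'] has mass 1, the affinity is
     bounded by [e] times the latter plus [1 / e] times the former. *)
  apply/lee_addgt0Pr => e e0; rewrite add0e.
  apply: (@le_trans _ _ (\int[mu]_y (e%:E * (q' y)%:E + e^-1%:E * (fine (mix y))%:E))%E).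
    apply: ge0_le_lower_integral => y _; first by rewrite lee_fin mulr_ge0 ?sqrtr_ge0.
    rewrite -!EFinM -EFinD lee_fin.
    set u := Num.sqrt (q' y); set v := Num.sqrt _.
    have -> : q' y = u ^+ 2 by rewrite sqr_sqrtr.
    have -> : fine (mix y) = v ^+ 2 by rewrite sqr_sqrtr.
    have u0 : 0 <= u by exact: sqrtr_ge0. have v0 : 0 <= v by exact: sqrtr_ge0.
    have : 0 <= (e * u - v) ^+ 2 / e + u * v.
      apply: addr_ge0; last exact: mulr_ge0.
      by apply: divr_ge0; [exact: sqr_ge0|exact: ltW].
    have -> : (e * u - v) ^+ 2 / e = e * u ^+ 2 + e^-1 * v ^+ 2 - 2 * u * v.
      by field; rewrite gt_eqF.
    lra.
  have Iq' : (\int[mu]_y (e%:E * (q' y)%:E) = e%:E)%E.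
    rewrite ge0_integralZl_EFin ?(ltW e0) ?q'1 ?mule1//.
      by move=> y _; rewrite lee_fin.
    exact/measurable_EFinP.
  have Im : (\int[mu]_y (e^-1%:E * (fine (mix y))%:E) <= 0)%E.
    rewrite ge0_integralZl_EFin ?invr_ge0 ?(ltW e0)//; first last.
    - exact/measurable_EFinP.
    - by move=> y _; rewrite lee_fin.
    have := integral_fine_mixture_le; rewrite G_eq0 => h.
    by rewrite -[leRHS](mule0 e^-1%:E) lee_wpmul2l// lee_fin invr_ge0 ltW.
  rewrite ge0_integralD//.
  - by rewrite Iq' -[leRHS]adde0 leeD2l.
  - by move=> y _; rewrite -EFinM lee_fin mulr_ge0// ltW.
  - by apply: emeasurable_funM => //; exact/measurable_EFinP.
  - by move=> y _; rewrite -EFinM lee_fin mulr_ge0// invr_ge0 ltW.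
  - by apply: emeasurable_funM => //; exact/measurable_EFinP.
have Gp : 0 < G by rewrite lt_neqAle eq_sym Gn0.
pose c y := Num.sqrt (fine (mix y) / G).
have mc : measurable_fun setT c.
  by apply: (measurableT_comp measurable_sqrt); exact: measurable_funM.
have c0 y : 0 <= c y by exact: sqrtr_ge0.
have c2 y : c y ^+ 2 = fine (mix y) / G.
  by rewrite sqr_sqrtr// divr_ge0.
have cE y : Num.sqrt (fine (mix y)) = Num.sqrt G * c y.
  by rewrite /c -sqrtrM// mulrCA divff// mulr1.
under eq_integral do rewrite cE mulrCA EFinM.
rewrite ge0_integralZl_EFin ?sqrtr_ge0//; first last.
- by apply/measurable_EFinP; exact: measurable_funM.
- by move=> y _; rewrite lee_fin mulr_ge0 ?sqrtr_ge0.
rewrite [leRHS]EFinM [leRHS]muleC lee_wpmul2l ?lee_fin ?sqrtr_ge0//.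
set A := (\int[mu]_y _)%E.
have A0 : (0 <= A)%E by apply: integral_ge0 => y _; rewrite lee_fin mulr_ge0 ?sqrtr_ge0.
have mgap : measurable_fun setT (fun y => (c y - Num.sqrt (q y)) ^+ 2).
  by apply: measurable_funX; exact: measurable_funB.
have gap_a : (\int[mu]_y ((c y - Num.sqrt (q y)) ^+ 2)%:E <= a%:E)%E.
  rewrite -(@lee_pmul2l _ G%:E)//.
  rewrite -ge0_integralZl_EFin ?(ltW Gp)//; first last.
  - exact/measurable_EFinP.
  - by move=> y _; rewrite lee_fin sqr_ge0.
  rewrite -EFinM [(G * a)%R]mulrC; apply: le_trans integral_spread.
  apply: ge0_le_lower_integral => y _.
    by rewrite -EFinM lee_fin mulr_ge0// sqr_ge0.
  by rewrite -EFinM; exact: spread_ge.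
have mhel : measurable_fun setT
    (fun y => (Num.sqrt (q' y) - Num.sqrt (q y)) ^+ 2).
  by apply: measurable_funX; exact: measurable_funB.
(* With [u] and [v] the roots of [q'] and [q], this integrates [(u - v) ^+ 2 <= 2 * (u - c) ^+ 2 + 2
   * (c - v) ^+ 2], where expanding the first square on the right makes the affinity appear. It
   yields [A <= 1 + a / 2 - b / 4]. *)
have key : (4%:E * A + hellinger2 mu q' q <= (4 + 2 * a)%:E)%E.
  rewrite /A -ge0_integralZl_EFin//; last 2 first.
  - by move=> y _; rewrite lee_fin mulr_ge0 ?sqrtr_ge0.
  - by apply/measurable_EFinP; exact: measurable_funM.
  rewrite /hellinger2 -ge0_integralD//; first last.
  - exact/measurable_EFinP.
  - by move=> y _; rewrite lee_fin sqr_ge0.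
  - by apply: emeasurable_funM => //; apply/measurable_EFinP; exact: measurable_funM.
  - by move=> y _; rewrite -EFinM lee_fin !mulr_ge0 ?sqrtr_ge0.
  apply: (@le_trans _ _ (\int[mu]_y (2%:E * (q' y)%:E +
     ((2 / G)%:E * (fine (mix y))%:E + 2%:E * ((c y - Num.sqrt (q y)) ^+ 2)%:E)))%E).
    apply: ge0_le_lower_integral => y _.
      by rewrite -EFinM -EFinD lee_fin addr_ge0// ?sqr_ge0// !mulr_ge0 ?sqrtr_ge0.
    rewrite -!EFinM -!EFinD lee_fin.
    have -> : 2 / G * fine (mix y) = 2 * c y ^+ 2 by rewrite c2; ring.
    set u := Num.sqrt (q' y); have -> : q' y = u ^+ 2 by rewrite sqr_sqrtr.
    have := sqr_ge0 (u - c y - (c y - Num.sqrt (q y))); nra.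
  have m1 : measurable_fun setT (fun y => (2%:E * (q' y)%:E)%E).
    by apply: emeasurable_funM => //; exact/measurable_EFinP.
  have m2 : measurable_fun setT (fun y => ((2 / G)%:E * (fine (mix y))%:E)%E).
    by apply: emeasurable_funM => //; exact/measurable_EFinP.
  have m3 : measurable_fun setT
      (fun y => (2%:E * ((c y - Num.sqrt (q y)) ^+ 2)%:E)%E).
    by apply: emeasurable_funM => //; exact/measurable_EFinP.
  have n1 y : (0 <= 2%:E * (q' y)%:E)%E by rewrite -EFinM lee_fin mulr_ge0.
  have n2 y : (0 <= (2 / G)%:E * (fine (mix y))%:E)%E.
    by rewrite -EFinM lee_fin mulr_ge0// divr_ge0// ltW.
  have n3 y : (0 <= 2%:E * ((c y - Num.sqrt (q y)) ^+ 2)%:E)%E.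
    by rewrite -EFinM lee_fin mulr_ge0// sqr_ge0.
  rewrite ge0_integralD//; last 2 first.
  - by move=> y _; rewrite adde_ge0.
  - exact: emeasurable_funD.
  rewrite ge0_integralD// !ge0_integralZl_EFin ?divr_ge0 ?(ltW Gp)//; first last.
  all: try by move=> y _; rewrite lee_fin ?sqr_ge0.
  all: try by apply/measurable_EFinP.
  rewrite q'1 mule1.
  have -> : ((4 + 2 * a)%:E = 2%:E + ((2 / G)%:E * G%:E + 2%:E * a%:E))%E.
    by rewrite -!EFinM -!EFinD divfK//; congr (_%:E); ring.
  rewrite leeD2l// leeD//; last by rewrite lee_wpmul2l.
  by rewrite lee_wpmul2l ?lee_fin ?divr_ge0 ?(ltW Gp)//; exact: integral_fine_mixture_le.
have : (4%:E * A + b%:E <= (4 + 2 * a)%:E)%E by apply: le_trans key; rewrite leeD2l.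
move: A0; move: A {key} => [A| |] // A0; last by rewrite gt0_muley ?lte_fin.
rewrite -EFinM -EFinD !lee_fin => h.
apply: (@le_trans _ _ (1 + (a / 2 - b / 4))); last exact: expR_ge1Dx.
lra.
Qed.

End hellinger_affinity.

(** * Likelihood ratios and their integrals over the prior *)

Section likelihood_ratio.
Context {R : realType} d {W : measurableType d} (P : probability W R).
Context d' {T : measurableType d'} {n : nat} (Y : 'I_n -> W -> T).
Context d'' {F : measurableType d''} (Pi : probability F R).
Variables (mu : 'I_n -> {sigma_finite_measure set T -> \bar R})
  (p : 'I_n -> F -> T -> R) (f0 : F).
Hypothesis indepY : independent_family P Y.
Hypotheses (mp : forall i, measurable_fun setT (fun z : F * T => p i z.1 z.2))
  (p0 : forall i f y, 0 <= p i f y)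
  (p1 : forall i f, (\int[mu i]_y (p i f y)%:E = 1)%E).
Hypothesis lawY : forall i A, measurable A ->
  P (Y i @^-1` A) = (\int[mu i]_(y in A) (p i f0 y)%:E)%E.

Let mY i : measurable_fun setT (Y i). Proof. by case: indepY. Qed.

Let mpf i f : measurable_fun setT (p i f).
Proof. exact: (measurableT_comp (mp i) (pair1_measurable f)). Qed.

(** It is 0 wherever the true density vanishes, a set that the observations almost surely avoid. *)
Definition ratio i f y := p i f y / p i f0 y.

Definition lik_ratio (s : seq 'I_n) (f : F) (w : W) :=
  \prod_(i <- s) ratio i f (Y i w).

Lemma ratio_ge0 i f y : 0 <= ratio i f y.
Proof. by rewrite /ratio divr_ge0. Qed.

Lemma lik_ratio_ge0 s f w : 0 <= lik_ratio s f w.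
Proof. by apply: prodr_ge0 => i _; exact: ratio_ge0. Qed.

Lemma measurable_ratio i : measurable_fun setT (fun z : F * T => ratio i z.1 z.2).
Proof.
apply: measurable_fun_div_ge0 => //.
by apply: (measurableT_comp (mpf i f0)).
Qed.

Lemma measurable_ratio_snd i f : measurable_fun setT (ratio i f).
Proof. exact: (measurableT_comp (measurable_ratio i) (pair1_measurable f)). Qed.

Lemma measurable_lik_ratio s :
  measurable_fun setT (fun z : W * F => lik_ratio s z.2 z.1).
Proof.
apply: measurable_prod => i si.
apply: (measurableT_comp (measurable_ratio i) (g := fun z : W * F => (z.2, Y i z.1))).
by apply: measurable_fun_pair => //; exact: measurableT_comp.
Qed.

Lemma measurable_lik_ratio_past s :
  measurable_fun setT (fun z : past Y s * F => lik_ratio s z.2 z.1).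
Proof.
apply: measurable_prod => i si.
apply: (measurableT_comp (measurable_ratio i) (g := fun z : past Y s * F => (z.2, Y i z.1))).
apply: measurable_fun_pair => //; apply: measurableT_comp => //.
exact: measurable_past.
Qed.

Local Open Scope ereal_scope.

(** Only an inequality, because [p i f] may charge the set where [p i f0] vanishes. *)
Lemma integral_ratio_le1 i f : \int[mu i]_y (ratio i f y * p i f0 y)%:E <= 1.
Proof.
rewrite -(p1 i f); apply: ge0_le_lower_integral => y _.
  by rewrite lee_fin mulr_ge0// ratio_ge0.
rewrite lee_fin /ratio; have [->|q0] := eqVneq (p i f0 y) 0%R.
  by rewrite mulr0.
by rewrite divfK.
Qed.

Lemma integral_lik_ratio_le1 s f : uniq s -> \int[P]_w (lik_ratio s f w)%:E <= 1.
Proof.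
move=> us.
have := @integral_prod_le _ _ _ P _ _ _ Y indepY mu (fun i => p i f0)
  (fun i => mpf i f0) (fun i => p0 i f0) lawY s (fun i => ratio i f)
  (fun _ => 1%R) us.
rewrite big1// => -> //.
- by move=> i; exact: measurable_ratio_snd.
- by move=> i y; exact: ratio_ge0.
- by move=> i _; exact: integral_ratio_le1.
Qed.

Definition weighted_lr s (g : F -> R) w := \int[Pi]_f (g f * lik_ratio s f w)%:E.

Section weights.
Variable g : F -> R.
Hypotheses (mg : measurable_fun setT g) (g0 : forall f, (0 <= g f)%R).

Lemma weighted_lr_ge0 s w : 0 <= weighted_lr s g w.
Proof. by apply: integral_ge0 => f _; rewrite lee_fin mulr_ge0 ?lik_ratio_ge0. Qed.

Lemma measurable_weighted_lr s : measurable_fun setT (weighted_lr s g).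
Proof.
apply: (@measurable_partial_integral _ _ _ _ _ Pi (fun w f => g f * lik_ratio s f w)%R).
  apply: measurable_funM; first exact: measurableT_comp.
  exact: measurable_lik_ratio.
by move=> w f; rewrite mulr_ge0 ?lik_ratio_ge0.
Qed.

Lemma integral_weighted_lr_le s : uniq s ->
  \int[P]_w weighted_lr s g w <= \int[Pi]_f (g f)%:E.
Proof.
move=> us; rewrite /weighted_lr.
rewrite (@fubini_tonelli _ _ _ _ _ P Pi (fun z => (g z.2 * lik_ratio s z.2 z.1)%:E))//=.
- apply: ge0_le_lower_integral => f _.
    by apply: integral_ge0 => w _; rewrite lee_fin mulr_ge0 ?lik_ratio_ge0.
  under eq_integral do rewrite EFinM.
  rewrite ge0_integralZl_EFin//.
  + by rewrite -[leRHS]mule1 lee_wpmul2l ?lee_fin// integral_lik_ratio_le1.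
  + by move=> w _; rewrite lee_fin lik_ratio_ge0.
  + apply/measurable_EFinP; apply: (measurableT_comp (@measurable_lik_ratio s)
      (g := fun w => (w, f))).
    exact: pair2_measurable.
- apply/measurable_EFinP; apply: measurable_funM; first exact: measurableT_comp.
  exact: measurable_lik_ratio.
- by move=> z; rewrite lee_fin mulr_ge0 ?lik_ratio_ge0.
Qed.

Variables (G a : R) (f1 : F) (b : 'I_n -> R).
Hypothesis gG : \int[Pi]_f (g f)%:E = G%:E.

(** The mixture met at each step has weights [g] times the likelihood ratio of the past. Their mass
    is [weighted_lr s g w], whose root is the integrand of the induction hypothesis. *)
Lemma integral_sqrt_weighted_lr_le s : uniq s ->
  (forall f i, g f != 0%R -> i \in s -> hellinger2 (mu i) (p i f) (p i f1) <= a%:E) ->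
  (forall i, i \in s -> (b i)%:E <= hellinger2 (mu i) (p i f0) (p i f1)) ->
  \int[P]_w (Num.sqrt (fine (weighted_lr s g w)))%:E
  <= (expR (\sum_(i <- s) (a / 2 - b i / 4)) * Num.sqrt G)%:E.
Proof.
elim: s => [_ _ _|j s IH /= /andP[js us] ha hb].
  rewrite big_nil expR0 mul1r.
  under eq_integral => w _.
    rewrite /weighted_lr; under eq_integral do rewrite /lik_ratio big_nil mulr1.
    rewrite gG /=; over.
  by rewrite integral_cst//= probability_setT mule1.
have {}IH := IH us (fun f i gf si => ha f i gf (@mem_behead _ (j :: s) i si))
  (fun i si => hb i (@mem_behead _ (j :: s) i si)).
pose h (z : past Y s * T) (f : F) :=
  (g f * (ratio j f z.2 * lik_ratio s f z.1))%R.
have h0 z f : (0 <= h z f)%R.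
  by rewrite /h mulr_ge0// mulr_ge0 ?ratio_ge0 ?lik_ratio_ge0.
have mh : measurable_fun setT (fun z : (past Y s * T) * F => h z.1 z.2).
  apply: measurable_funM; first exact: measurableT_comp.
  apply: measurable_funM.
    apply: (measurableT_comp (measurable_ratio j)
      (g := fun z : (past Y s * T) * F => (z.2, z.1.2))).
    by apply: measurable_fun_pair => //; exact: measurableT_comp.
  apply: (measurableT_comp (@measurable_lik_ratio_past s)
    (g := fun z : (past Y s * T) * F => (z.1.1, z.2))).
  by apply: measurable_fun_pair => //; exact: measurableT_comp.
pose Psi (z : past Y s * T) : \bar R :=
  (Num.sqrt (fine (\int[Pi]_f (h z f)%:E)))%:E.
have mPsi : measurable_fun setT Psi.
  apply/measurable_EFinP; apply: (measurableT_comp measurable_sqrt).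
  exact: measurable_fine_partial_integral.
have -> : \int[P]_w (Num.sqrt (fine (weighted_lr (j :: s) g w)))%:E =
    \int[P]_w Psi (w : past Y s, Y j w).
  apply: eq_integral => w _; rewrite /Psi /weighted_lr /h.
  by under eq_integral do rewrite /lik_ratio big_cons.
rewrite (integral_past_density indepY (fun i => mpf i f0) (fun i => p0 i f0) lawY)//;
  last by move=> z; rewrite lee_fin sqrtr_ge0.
set rho := expR (a / 2 - b j / 4).
have msqw : measurable_fun setT (fun w => (Num.sqrt (fine (weighted_lr s g w)))%:E).
  apply/measurable_EFinP; apply: (measurableT_comp measurable_sqrt).
  apply: (measurableT_comp (@fine_measurable R setT measurableT)).
  exact: measurable_weighted_lr.
apply: (@le_trans _ _ (\int[P]_w (rho%:E * (Num.sqrt (fine (weighted_lr s g w)))%:E))).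
  apply: ae_ge0_le_integral => //.
  - by move=> w _; apply: integral_ge0 => y _; rewrite mule_ge0 ?lee_fin ?sqrtr_ge0.
  - have : measurable_fun setT (fun w : past Y s => \int[mu j]_y (Psi (w, y) * (p j f0 y)%:E)).
      apply: (@measurable_fun_fubini_tonelli_F _ _ _ _ _ (mu j)
        (fun z : past Y s * T => Psi z * (p j f0 z.2)%:E)).
        apply: emeasurable_funM => //; apply/measurable_EFinP.
        exact: measurableT_comp.
      by move=> z; rewrite mule_ge0 ?lee_fin ?sqrtr_ge0.
    move=> mI _ A mA; rewrite setTI.
    by have := mI measurableT A mA; rewrite setTI => /(past_measurable indepY).
  - by move=> w _; rewrite -EFinM lee_fin mulr_ge0 ?sqrtr_ge0// expR_ge0.
  - exact: emeasurable_funM.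
  (* Where [weighted_lr] is infinite, its fine value is not the mass of the weights. Being
     integrable, it is finite for almost every [w]. *)
  have iw : P.-integrable setT (weighted_lr s g).
    apply/integrableP; split; first exact: measurable_weighted_lr.
    under eq_integral do rewrite gee0_abs ?weighted_lr_ge0//.
    by apply: (le_lt_trans (integral_weighted_lr_le us)); rewrite gG ltry.
  have := integrable_ae measurableT iw; apply: filterS => w /(_ I) fw _.
  have mlw : measurable_fun setT (fun f => lik_ratio s f w).
    apply: (measurableT_comp (@measurable_lik_ratio s) (g := fun f => (w, f))).
    exact: pair1_measurable.
  have := @hellinger_affinity_mixture_le _ _ F _ T Pi (mu j) (p j) (mp j)
    (p0 j) (p1 j) (fun f => g f * lik_ratio s f w)%R (fine (weighted_lr s g w)) _ _ _
    (p j f1) (mpf j f1) a _ (p j f0) (b j) (mpf j f0) (p0 j f0) (p1 j f0) _.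
  rewrite -EFinM => H.
  apply: le_trans (H _ _ _ _ _) => //; last 5 first.
  - exact: measurable_funM.
  - by move=> f; rewrite mulr_ge0 ?lik_ratio_ge0.
  - by rewrite fineK.
  - move=> f gf; apply: ha; last exact: mem_head.
    by apply: contraNneq gf => ->; rewrite mul0r.
  - by apply: hb; exact: mem_head.
  (* With [q] the true density and [m] the mixture, [Num.sqrt (m / q) * q = Num.sqrt q * Num.sqrt
     m]. This also holds for [q = 0], and for an infinite [m], whose fine value is 0. *)
  rewrite le_eqVlt; apply/orP; left; apply/eqP.
  apply: eq_integral => y _; rewrite /Psi -EFinM /=; congr (_%:E).
  have [q_eq0|q_neq0] := eqVneq (p j f0 y) 0%R.
    by rewrite q_eq0 sqrtr0 mulr0 mul0r.
  have qp : (0 < p j f0 y)%R by rewrite lt_neqAle eq_sym q_neq0 p0.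
  under eq_integral => f _.
    rewrite (_ : h _ _ = (p j f0 y)^-1 * (p j f y * (g f * lik_ratio s f w)))%R; last first.
      by rewrite /h /ratio/=; ring.
    rewrite EFinM; over.
  rewrite ge0_integralZl_EFin ?invr_ge0//; last 2 first.
  - by move=> f _; rewrite lee_fin !mulr_ge0 ?lik_ratio_ge0.
  - apply/measurable_EFinP; apply: measurable_funM; last exact: measurable_funM.
    exact: (measurableT_comp (mp j) (pair2_measurable y)).
  set X := integral _ _ _.
  have : 0 <= X by apply: integral_ge0 => f _; rewrite lee_fin !mulr_ge0 ?lik_ratio_ge0.
  case: X => [x| |] // x0; last by rewrite gt0_muley ?lte_fin ?invr_gt0//= sqrtr0 mulr0 mul0r.
  rewrite /= sqrtrM ?invr_ge0// sqrtrV// mulrAC; congr (_ * _)%R.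
  by rewrite -[X in (_ * X)%R](sqr_sqrtr (ltW qp)) expr2 mulKf// gt_eqF// sqrtr_gt0.
rewrite ge0_integralZl_EFin ?expR_ge0//.
rewrite big_cons expRD -mulrA EFinM lee_wpmul2l// lee_fin expR_ge0//.
Qed.

End weights.

End likelihood_ratio.

(** * Posterior contraction on one machine *)

Section normalized_measure.
Context {R : realType} d {F : measurableType d} (Pi : {measure set F -> \bar R}).
Variable L : F -> R.
Hypotheses (mL : measurable_fun setT L) (L0 : forall f, 0 <= L f).
Local Open Scope ereal_scope.

Lemma ge0_integral_bigcup_cvg (A : (set F)^nat) :
  (forall n, measurable (A n)) -> trivIset setT A ->
  \sum_(0 <= i < n) \int[Pi]_(f in A i) (L f)%:E @[n --> \oo] -->
  \int[Pi]_(f in \bigcup_i A i) (L f)%:E.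
Proof.
move=> mA tA; rewrite ge0_integral_bigcup//; last 2 first.
- by apply/measurable_EFinP; exact: measurable_funTS.
- by move=> f _; rewrite lee_fin.
apply: is_cvg_ereal_nneg_natsum_cond => n _ _.
by apply: integral_ge0 => f _; rewrite lee_fin.
Qed.

Definition normalized (A : set F) : \bar R :=
  (fine (\int[Pi]_(f in A) (L f)%:E) / fine (\int[Pi]_f (L f)%:E))%:E.

Let int_ge0 A : 0 <= \int[Pi]_(f in A) (L f)%:E.
Proof. by apply: integral_ge0 => f _; rewrite lee_fin. Qed.

Let int_le A : \int[Pi]_(f in A) (L f)%:E <= \int[Pi]_f (L f)%:E.
Proof.
rewrite integral_mkcond; apply: ge0_le_lower_integral => f _.
  by rewrite patchE; case: ifP => // _; rewrite lee_fin.
by rewrite patchE; case: ifP => // _; rewrite lee_fin.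
Qed.

Let normalized0 : normalized set0 = 0.
Proof. by rewrite /normalized integral_set0/= mul0r. Qed.

Let normalized_ge0 A : 0 <= normalized A.
Proof. by rewrite lee_fin divr_ge0// fine_ge0. Qed.

Let normalizedE z A : \int[Pi]_f (L f)%:E = z%:E ->
  normalized A = z^-1%:E * \int[Pi]_(f in A) (L f)%:E.
Proof.
move=> zE; rewrite /normalized zE /=; have := int_le A; have := int_ge0 A.
case: (\int[Pi]_(f in A) _) => [x| |] //=; first by rewrite mulrC.
by move=> _; rewrite zE leNgt ltry.
Qed.

Let normalized_sigma_additive : semi_sigma_additive normalized.
Proof.
move=> A mA tA mUA.
case zE : (\int[Pi]_f (L f)%:E) => [z| |].
- rewrite (normalizedE _ zE) [X in X @ \oo --> _](_ : _ = fun n =>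
    z^-1%:E * \sum_(0 <= i < n) \int[Pi]_(f in A i) (L f)%:E); last first.
    apply/funext => n; rewrite ge0_sume_distrr//; apply: eq_bigr => i _.
    exact: normalizedE.
  by apply: cvgeZl => //; exact: ge0_integral_bigcup_cvg.
- rewrite /normalized zE /= invr0 mulr0.
  by under eq_fun do under eq_bigr do rewrite mulr0; under eq_fun do rewrite big1//; exact: cvg_cst.
- by have := int_ge0 setT; rewrite zE.
Qed.

(** The total mass is 1 unless the normalizing integral is 0 or [+oo]; its fine value is then 0 and
    the result is the zero measure, whence the inequality. *)
Lemma normalized_measureP :
  exists2 nu : {measure set F -> \bar R}, nu = normalized :> (set F -> \bar R) &
    nu setT <= 1.
Proof.
pose nu : {measure set F -> \bar R} := HB.pack normalized (isMeasure.Build _ _ _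
  normalized normalized0 normalized_ge0 normalized_sigma_additive).
exists nu => //=.
rewrite /normalized; have [->|z0] := eqVneq (fine (\int[Pi]_f (L f)%:E)) 0%R.
  by rewrite mul0r lee_fin.
by rewrite divff.
Qed.

End normalized_measure.

Section posterior.
Context {R : realType} d {W : measurableType d} (P : probability W R).
Context d' {T : measurableType d'} {n : nat} (Y : 'I_n -> W -> T).
Context d'' {F : measurableType d''} (Pi : probability F R).
Variables (mu : 'I_n -> {sigma_finite_measure set T -> \bar R})
  (p : 'I_n -> F -> T -> R) (f0 : F).
Hypothesis indepY : independent_family P Y.
Hypotheses (mp : forall i, measurable_fun setT (fun z : F * T => p i z.1 z.2))
  (p0 : forall i f y, 0 <= p i f y)
  (p1 : forall i f, (\int[mu i]_y (p i f y)%:E = 1)%E).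
Hypothesis lawY : forall i A, measurable A ->
  P (Y i @^-1` A) = (\int[mu i]_(y in A) (p i f0 y)%:E)%E.

Let mY i : measurable_fun setT (Y i). Proof. by case: indepY. Qed.

Let mpf i f : measurable_fun setT (p i f).
Proof. exact: (measurableT_comp (mp i) (pair1_measurable f)). Qed.

Local Notation lik_ratio := (lik_ratio Y p f0).
Local Notation weighted_lr := (weighted_lr Y Pi p f0).

Let mlrw s w : measurable_fun setT (fun f => lik_ratio s f w).
Proof.
exact: (measurableT_comp (measurable_lik_ratio f0 indepY mp p0 s)
  (pair1_measurable w)).
Qed.

Let mlrf s f : measurable_fun setT (fun w => lik_ratio s f w).
Proof.
exact: (measurableT_comp (measurable_lik_ratio f0 indepY mp p0 s)
  (pair2_measurable f)).
Qed.

Let lr0 s f w : 0 <= lik_ratio s f w. Proof. exact: lik_ratio_ge0. Qed.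

Local Open Scope ereal_scope.

(** When the evidence is below [tau * mass / 2], the likelihood ratio is below [tau] on at least
    half of [U], in prior mass. The expected mass of that part of [U] is at most [eta] times the
    prior mass of [U]. *)
Lemma evidence_tail s (U : set F) (tau eta mass : R) : measurable U ->
  (0 < tau)%R -> (0 < mass)%R -> mass%:E <= Pi U ->
  (forall f, U f -> P [set w | (lik_ratio s f w < tau)%R] <= eta%:E) ->
  P [set w | weighted_lr s (cst 1%R) w < (tau * mass / 2)%:E] <= (2 * eta)%:E.
Proof.
move=> mU tau0 mass0 massU tail.
pose low (w : W) (f : F) : R := (\1_U f * \1_[set z | lik_ratio s z.2 z.1 < tau] (w, f))%R.
have mS : measurable [set z : W * F | (lik_ratio s z.2 z.1 < tau)%R].
  exact: (measurable_set_ltr (measurable_lik_ratio f0 indepY mp p0 s)).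
have mlow : measurable_fun setT (fun z : W * F => low z.1 z.2).
  apply: measurable_funM.
    apply: (measurableT_comp (g := snd)) => //; exact: measurable_indic.
  rewrite (_ : (fun _ => _) = \1_[set z : W * F | (lik_ratio s z.2 z.1 < tau)%R]).
    exact: measurable_indic.
  by apply/funext => -[].
have low0 w f : (0 <= low w f)%R by rewrite /low mulr_ge0.
set bad := [set w | _ < _].
have mb : measurable_fun setT (fun w => \int[Pi]_f (low w f)%:E).
  exact: measurable_partial_integral.
have mwl : measurable_fun setT (weighted_lr s (cst 1%R)).
  by apply: (measurable_weighted_lr Pi f0 indepY mp p0 _ (fun _ => ler01)).
have mbad : measurable bad.
  exact: (measurable_set_lte mwl).
have PiU_fin : Pi U = (fine (Pi U))%:E by rewrite fineK// fin_num_measure.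
set u := fine (Pi U) in PiU_fin.
have u0 : (0 < u)%R by apply: lt_le_trans mass0 _; rewrite -lee_fin -PiU_fin.
have Eb : \int[P]_w \int[Pi]_f (low w f)%:E <= (eta * u)%:E.
  rewrite (@fubini_tonelli _ _ _ _ _ P Pi (fun z => (low z.1 z.2)%:E))//=; last 2 first.
  - exact/measurable_EFinP.
  - by move=> z; rewrite lee_fin.
  apply: (@le_trans _ _ (\int[Pi]_f (eta%:E * (\1_U f)%:E))).
    apply: ge0_le_lower_integral => f _.
      by apply: integral_ge0 => w _; rewrite lee_fin.
    rewrite /low; under eq_integral do rewrite EFinM.
    have mSf : measurable [set w | (lik_ratio s f w < tau)%R].
      exact: (measurable_set_ltr (mlrf s f)).
    rewrite ge0_integralZl_EFin//; last first.
      apply/measurable_EFinP.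
      apply: (measurableT_comp _ (pair2_measurable f)); exact: measurable_indic.
    rewrite (eq_integral (EFin \o \1_[set w | (lik_ratio s f w < tau)%R]))//.
    rewrite integral_indic// setIT muleC !indicE.
    by case: (boolP (f \in U)) => [/set_mem/tail|_]; rewrite ?mule1 ?mule0.
  (* The tail bound forces this as soon as [U] has a point, and it does because its mass is
     positive. *)
  have eta0 : (0 <= eta)%R.
    have [[f Uf]|] := pselect (exists f, U f).
      by rewrite -lee_fin; apply: le_trans (tail _ Uf).
    move=> /forallNP Un; suff : Pi U = 0 by rewrite PiU_fin => -[] /eqP; rewrite gt_eqF.
    by rewrite (_ : U = set0) ?measure0//; apply/seteqP; split => // f /Un.
  rewrite ge0_integralZl_EFin//.
  + by rewrite integral_indic// setIT [X in _ * X]PiU_fin.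
  + by apply/measurable_EFinP; exact: measurable_indic.
have h w : bad w -> (u / 2)%:E <= \int[Pi]_f (low w f)%:E.
  rewrite /bad /= => bw.
  (* Integral of a pointwise bound: on [U], either the likelihood ratio is at least [tau] or [low]
     is 1. *)
  have key : (tau * u)%:E <= weighted_lr s (cst 1%R) w + tau%:E * \int[Pi]_f (low w f)%:E.
    rewrite EFinM -PiU_fin -[U in Pi U]setIT -integral_indic//.
    have mloww : measurable_fun setT (low w).
      exact: (measurableT_comp mlow (pair1_measurable w)).
    rewrite -!ge0_integralZl_EFin ?(ltW tau0)//; first last.
    - exact/measurable_EFinP.
    - exact/measurable_EFinP.
    - by move=> f _; rewrite lee_fin.
    rewrite /weighted_lr -ge0_integralD//; first last.
    - by apply: emeasurable_funM => //; exact/measurable_EFinP.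
    - by move=> f _; rewrite mule_ge0// lee_fin// ltW.
    - apply/measurable_EFinP; exact: measurable_funM.
    - by move=> f _; rewrite lee_fin mul1r.
    apply: ge0_le_lower_integral => f _; first by rewrite mule_ge0// lee_fin// ltW.
    rewrite -!EFinM -EFinD lee_fin mul1r /low !indicE.
    case: (f \in U); rewrite ?mulr1 ?mulr0 ?mul1r ?mul0r ?mulr0 ?addr0//.
    rewrite /=; case: (ltP (lik_ratio s f w) tau) => ht.
      by rewrite mem_set//= mulr1 lerDr.
    by rewrite (le_trans ht)// lerDl mulr_ge0// ltW.
  have : 0 <= \int[Pi]_f (low w f)%:E by apply: integral_ge0 => f _; rewrite lee_fin.
  move: key bw; have := weighted_lr_ge0 Y Pi f0 p0 (g := cst 1%R) (fun _ => ler01) s w.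
  case: (weighted_lr _ _ w) => [x| |] //.
  case: (\int[Pi]_f _) => [y| |] // x0; last by move=> _ _ _; rewrite leey.
  rewrite -EFinM -EFinD !lee_fin lte_fin => h1 h2 y0.
  have massu : (mass <= u)%R by rewrite -lee_fin -PiU_fin.
  rewrite -(ler_pM2l tau0).
  have : (tau * mass <= tau * u)%R by rewrite ler_pM2l.
  lra.
have : (u / 2)%:E * P bad <= (eta * u)%:E.
  apply: le_trans Eb; rewrite -[bad]setIT -integral_indic//.
  rewrite -ge0_integralZl_EFin ?divr_ge0 ?(ltW u0)//; last first.
    by apply/measurable_EFinP; exact: measurable_indic.
  apply: ge0_le_lower_integral => w _.
    by rewrite -EFinM lee_fin mulr_ge0 ?divr_ge0// ltW.
  rewrite indicE; case: (boolP (w \in bad)) => [/set_mem/h|_]; rewrite ?mule1 ?mule0//.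
  by apply: integral_ge0 => f _; rewrite lee_fin.
have -> : P bad = (fine (P bad))%:E by rewrite fineK// fin_num_measure.
rewrite -EFinM !lee_fin => h'; rewrite -(ler_pM2l u0).
lra.
Qed.

End posterior.

Lemma hellinger2_ge0 {R : realType} d {T : measurableType d}
    (mu : {measure set T -> \bar R}) (p q : T -> R) : (0 <= hellinger2 mu p q)%E.
Proof. by apply: integral_ge0 => y _; rewrite lee_fin sqr_ge0. Qed.

Lemma measure_le_sum {R : realType} d {F : measurableType d}
    (nu : {measure set F -> \bar R}) (I : eqType) (cs : seq I) (V : I -> set F)
    (A B : set F) :
  measurable A -> measurable B -> (forall c, measurable (V c)) ->
  (forall f, A f -> B f \/ exists2 c, c \in cs & V c f) ->
  (nu A <= nu B + \sum_(c <- cs) nu (V c))%E.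
Proof.
move=> mA + mV; elim: cs B => [|c cs IH] B mB AB.
  rewrite big_nil adde0; apply: le_measure; rewrite ?inE//.
  by move=> f /AB[//|[]].
rewrite big_cons addeA; apply: (@le_trans _ _ (nu (B `|` V c) + \sum_(c0 <- cs) nu (V c0))%E).
  apply: IH; first exact: measurableU.
  move=> f /AB[|[c']]; first by left; left.
  rewrite inE => /predU1P[->|cs']; first by left; right.
  by right; exists c'.
by rewrite leeD2r//; exact: measureU2.
Qed.

Section posterior_contraction.
Context {R : realType} d {W : measurableType d} (P : probability W R).
Context d' {T : measurableType d'} {n : nat} (Y : 'I_n -> W -> T).
Context d'' {F : measurableType d''} (Pi : probability F R).
Variables (mu : 'I_n -> {sigma_finite_measure set T -> \bar R})
  (p : 'I_n -> F -> T -> R) (f0 : F).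
Hypothesis indepY : independent_family P Y.
Hypotheses (mp : forall i, measurable_fun setT (fun z : F * T => p i z.1 z.2))
  (p0 : forall i f y, 0 <= p i f y)
  (p1 : forall i f, (\int[mu i]_y (p i f y)%:E = 1)%E).
Hypothesis lawY : forall i A, measurable A ->
  P (Y i @^-1` A) = (\int[mu i]_(y in A) (p i f0 y)%:E)%E.

Let mY i : measurable_fun setT (Y i). Proof. by case: indepY. Qed.

Let mpf i f : measurable_fun setT (p i f).
Proof. exact: (measurableT_comp (mp i) (pair1_measurable f)). Qed.

Local Notation lr := (lik_ratio Y p f0).
Local Notation weighted_lr := (weighted_lr Y Pi p f0).

Let mlrw s w : measurable_fun setT (fun f => lr s f w).
Proof.
exact: (measurableT_comp (measurable_lik_ratio f0 indepY mp p0 s)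
  (pair1_measurable w)).
Qed.

Let lr0 s f w : 0 <= lr s f w. Proof. exact: lik_ratio_ge0. Qed.

Local Open Scope ereal_scope.

(* Sup-norm balls are only assumed measurable around the truth, so the sieve is
   covered by Hellinger balls. *)
Definition close_to (s : seq 'I_n) (a : R) (c : F) : set F :=
  [set f | forall i, i \in s -> hellinger2 (mu i) (p i f) (p i c) <= a%:E].

Lemma measurable_hellinger2 i (c : F) :
  measurable_fun setT (fun f => hellinger2 (mu i) (p i f) (p i c)).
Proof.
apply: (@measurable_partial_integral _ _ _ _ _ (mu i) (fun f y =>
  (Num.sqrt (p i f y) - Num.sqrt (p i c y)) ^+ 2)%R).
  apply: measurable_funX; apply: measurable_funB.
    exact: (measurableT_comp measurable_sqrt).
  apply: (measurableT_comp measurable_sqrt).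
  exact: (measurableT_comp (mpf i c)).
by move=> f y; rewrite sqr_ge0.
Qed.

Lemma measurable_close_to s a c : measurable (close_to s a c).
Proof.
rewrite (_ : close_to s a c = \bigcap_(i in [set` s])
  [set f | hellinger2 (mu i) (p i f) (p i c) <= a%:E]); last first.
  by apply/seteqP; split => f h i; exact: h.
apply: fin_bigcap_measurable; first exact: finite_seq.
move=> i _; rewrite -[X in measurable X]setTI.
apply: emeasurable_fun_infty_c => //.
exact: measurable_hellinger2.
Qed.

Definition lik (s : seq 'I_n) (f : F) (w : W) : R := \prod_(i <- s) p i f (Y i w).

Lemma measurable_lik s w : measurable_fun setT (fun f => lik s f w).
Proof.
by apply: measurable_prod => i _; exact: (measurableT_comp (mp i) (pair2_measurable _)).
Qed.

Lemma lik_ge0 s f w : (0 <= lik s f w)%R.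
Proof. by apply: prodr_ge0 => i _. Qed.

(** Almost surely, likelihoods may thus be divided by that of the truth, which cancels in Bayes'
    formula. *)
Lemma lik_null s : P [set w | lik s f0 w = 0%R] = 0.
Proof.
have mq i : measurable [set y | p i f0 y = 0%R].
  by have := mpf i f0 measurableT (measurable_set1 0%R); rewrite setTI.
have mz i : measurable (Y i @^-1` [set y | p i f0 y = 0%R]).
  by rewrite -[X in measurable X]setTI; exact: mY.
have ml : measurable [set w | lik s f0 w = 0%R].
  rewrite -[X in measurable X]setTI.
  have : measurable_fun setT (fun w => lik s f0 w).
    by apply: measurable_prod => i _; exact: (measurableT_comp (mpf i f0)).
  by move=> /(_ measurableT [set 0%R]); apply; exact: measurable_set1.
have := @measure_le_sum _ _ _ P _ s
  (fun i => Y i @^-1` [set y | p i f0 y = 0%R]) _ set0 ml measurable0 mz.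
rewrite measure0 add0e big1; last first.
  move=> i _; rewrite [LHS](lawY _ (mq i)).
  by rewrite integral0_eq// => y /= ->.
move=> H; apply/eqP; rewrite eq_le measure_ge0 andbT; apply: H => w /eqP.
by rewrite /lik prodf_seq_eq0 => /hasP[i si /= /eqP pi_eq0]; right; exists i.
Qed.

Lemma lik_ratioE s f w : lik s f0 w != 0%R ->
  lik s f w = (lik s f0 w * lr s f w)%R.
Proof.
rewrite /lik /lik_ratio -big_split/= prodf_seq_neq0 => /allP h.
rewrite big_seq [RHS]big_seq; apply: eq_bigr => i /h /= pi_neq0.
by rewrite /ratio mulrC divfK.
Qed.

Lemma integral_lik s (A : set F) w : measurable A -> lik s f0 w != 0%R ->
  \int[Pi]_(f in A) (lik s f w)%:E = (lik s f0 w)%:E * weighted_lr s \1_A w.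
Proof.
move=> mA l0; rewrite integral_mkcond -ge0_integralZl_EFin ?lik_ge0//; first last.
- apply/measurable_EFinP; apply: measurable_funM => //; exact: measurable_indic.
- by move=> f _; rewrite lee_fin mulr_ge0.
apply: eq_integral => f _; rewrite patchE indicE.
case: ifP => _; last by rewrite mul0r mule0.
by rewrite mul1r lik_ratioE// EFinM.
Qed.

Variables (s : seq 'I_n) (A Bc U : set F) (cs : seq F).
Variables (a beta tau eta mass rest : R).
Hypotheses (us : uniq s) (mA : measurable A) (mBc : measurable Bc) (mU : measurable U).
Hypothesis cover : forall f, A f -> Bc f \/ exists2 c, c \in cs & close_to s a c f.
Hypothesis separated : forall c, c \in cs ->
  (beta <= \sum_(i <- s) fine (hellinger2 (mu i) (p i f0) (p i c)))%R.
Hypothesis PiBc : Pi Bc <= rest%:E.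
Hypotheses (tau0 : (0 < tau)%R) (mass0 : (0 < mass)%R) (massU : mass%:E <= Pi U).
Hypothesis tail : forall f, U f -> P [set w | (lr s f w < tau)%R] <= eta%:E.

Let delta := (tau * mass / 2)%R.

Let delta0 : (0 < delta)%R. Proof. by rewrite /delta divr_gt0// mulr_gt0. Qed.

Let indic_neq0 (V : set F) f : (\1_V f : R) != 0%R -> V f.
Proof. by rewrite indicE; case: (boolP (f \in V)) => [/set_mem//|_]; rewrite eqxx. Qed.

Let bad := [set w | weighted_lr s (cst 1%R) w < delta%:E].

(* The posterior mass of a piece of the cover is at most 1, hence at most its
   square root. *)
Let majorant w : \bar R := (\1_[set w | lik s f0 w = 0%R] w)%:E + (\1_bad w)%:E +
  (\sum_(c <- cs) (Num.sqrt (delta^-1))%:E *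
     (Num.sqrt (fine (weighted_lr s \1_(close_to s a c) w)))%:E +
  delta^-1%:E * weighted_lr s \1_Bc w).

Let mwlr (g : F -> R) : measurable_fun setT g -> (forall f, (0 <= g f)%R) ->
  measurable_fun setT (weighted_lr s g).
Proof. by move=> mg g0; apply: (measurable_weighted_lr Pi f0 indepY mp p0 mg g0). Qed.

Let wlr_ge0 (g : F -> R) w : (forall f, (0 <= g f)%R) -> 0 <= weighted_lr s g w.
Proof. by move=> g0; exact: weighted_lr_ge0. Qed.

Let mbad : measurable bad.
Proof.
have mwl : measurable_fun setT (weighted_lr s (cst 1%R)) by exact: mwlr.
exact: (measurable_set_lte mwl).
Qed.

Let mnull : measurable [set w | lik s f0 w = 0%R].
Proof.
rewrite -[X in measurable X]setTI.
have : measurable_fun setT (fun w => lik s f0 w).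
  by apply: measurable_prod => i _; exact: (measurableT_comp (mpf i f0)).
by move=> /(_ measurableT [set 0%R]); apply; exact: measurable_set1.
Qed.

Let mterm c : measurable_fun setT (fun w => (Num.sqrt (delta^-1))%:E *
     (Num.sqrt (fine (weighted_lr s \1_(close_to s a c) w)))%:E).
Proof.
apply: emeasurable_funM => //; apply/measurable_EFinP.
apply: (measurableT_comp measurable_sqrt).
apply: (measurableT_comp (@fine_measurable R setT measurableT)).
by apply: mwlr => //; apply: measurable_indic; exact: measurable_close_to.
Qed.

Let term0 c w : 0 <= (Num.sqrt (delta^-1))%:E *
     (Num.sqrt (fine (weighted_lr s \1_(close_to s a c) w)))%:E.
Proof. by rewrite -EFinM lee_fin mulr_ge0 ?sqrtr_ge0. Qed.

Let mlast : measurable_fun setT (fun w => delta^-1%:E * weighted_lr s \1_Bc w).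
Proof. by apply: emeasurable_funM => //; apply: mwlr => //; exact: measurable_indic. Qed.

Let last0 w : 0 <= delta^-1%:E * weighted_lr s \1_Bc w.
Proof. by apply: mule_ge0; [rewrite lee_fin invr_ge0 ltW|exact: wlr_ge0]. Qed.

Let mmajorant : measurable_fun setT majorant.
Proof.
apply: emeasurable_funD.
  by apply: emeasurable_funD; apply/measurable_EFinP; exact: measurable_indic.
by apply: emeasurable_funD => //; exact: emeasurable_sum.
Qed.

Let majorant_ge0 w : 0 <= majorant w.
Proof. by rewrite !adde_ge0// ?lee_fin// sume_ge0. Qed.

(** The last term takes no square root: a likelihood ratio has mean at most 1, so [Bc] costs its
    prior mass divided by [delta]. For the Hellinger balls, the root of the prior mass is bounded by
    1. *)
Let integral_majorant : \int[P]_w majorant w <=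
  (2 * eta + ((size cs)%:R * (expR ((size s)%:R * a / 2 - beta / 4) / Num.sqrt delta)
    + rest / delta))%:E.
Proof.
rewrite ge0_integralD//; first last.
- by apply: emeasurable_funD => //; exact: emeasurable_sum.
- by move=> w _; rewrite adde_ge0// sume_ge0.
- by apply: emeasurable_funD; apply/measurable_EFinP; exact: measurable_indic.
- by move=> w _; rewrite adde_ge0// lee_fin.
rewrite ge0_integralD//; first last.
- by apply/measurable_EFinP; exact: measurable_indic.
- by apply/measurable_EFinP; exact: measurable_indic.
have -> : \int[P]_w (\1_[set w | lik s f0 w = 0%R] w)%:E = 0.
  by rewrite integral_indic// setIT; exact: lik_null.
rewrite add0e EFinD leeD//.
  rewrite integral_indic// setIT.
  exact: (evidence_tail indepY mp p0 mU tau0 mass0 massU tail).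
rewrite ge0_integralD//; first last.
- exact: emeasurable_sum.
- by move=> w _; rewrite sume_ge0.
rewrite EFinD leeD//; last first.
  rewrite ge0_integralZl_EFin; [|by []|by move=> w _; exact: wlr_ge0|
    by apply: mwlr => //; exact: measurable_indic|by rewrite invr_ge0 ltW].
  rewrite mulrC EFinM lee_wpmul2l ?lee_fin ?invr_ge0 ?(ltW delta0)//.
  apply: le_trans PiBc; rewrite -[Bc in leRHS]setIT -integral_indic//.
  apply: (integral_weighted_lr_le Pi indepY mp p0 p1 lawY) => //; exact: measurable_indic.
rewrite ge0_integral_sum//.
rewrite mulr_natl -iter_addr_0 -[size cs]count_predT -big_const_seq -sumEFin.
rewrite big_seq [leRHS]big_seq; apply: lee_sum => c ccs.
have msq : measurable_fun setT
    (fun w => (Num.sqrt (fine (weighted_lr s \1_(close_to s a c) w)))%:E).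
  apply/measurable_EFinP; apply: (measurableT_comp measurable_sqrt).
  apply: (measurableT_comp (@fine_measurable R setT measurableT)).
  by apply: mwlr => //; apply: measurable_indic; exact: measurable_close_to.
rewrite ge0_integralZl_EFin ?sqrtr_ge0//.
rewrite mulrC EFinM -sqrtrV ?(ltW delta0)// lee_wpmul2l ?lee_fin ?sqrtr_ge0//.
have mV := measurable_close_to s a c.
pose b i := fine (hellinger2 (mu i) (p i f0) (p i c)).
have iV : \int[Pi]_f (\1_(close_to s a c) f)%:E = (fine (Pi (close_to s a c)))%:E.
  by rewrite integral_indic// setIT fineK// fin_num_measure.
have := @integral_sqrt_weighted_lr_le _ _ _ P _ _ _ Y _ F Pi mu p f0 indepY mp p0 p1
  lawY \1_(close_to s a c) (measurable_indic mV) _ _ a c b iV s us.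
move=> H; apply: (le_trans (H _ _ _)) => //.
- by move=> f i /indic_neq0 Vf si; exact: Vf.
- move=> i si; rewrite /b; have := hellinger2_ge0 (mu i) (p i f0) (p i c).
  by case: hellinger2 => //= *; rewrite leey.
rewrite lee_fin -[leRHS]mulr1; apply: ler_pM; rewrite ?expR_ge0 ?sqrtr_ge0//.
  rewrite ler_expR sumrB -!mulr_suml big_const_seq count_predT iter_addr_0.
  rewrite -[(a *+ _)%R]mulr_natl lerD2l lerN2 ler_pM2r//.
  exact: separated.
rewrite -sqrtr1 ler_sqrt// -lee_fin fineK ?fin_num_measure//.
exact: probability_le1.
Qed.

(** A measurable majorant is produced because the expectations are later added over the machines,
    and additivity of the integral requires measurable integrands. *)
Lemma normalized_le_majorant : exists2 H : W -> \bar R,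
  [/\ measurable_fun setT H, forall w, 0 <= H w &
      forall w, normalized Pi (fun f => lik s f w) A <= H w] &
  \int[P]_w H w <=
  (2 * eta + ((size cs)%:R * (expR ((size s)%:R * a / 2 - beta / 4) / Num.sqrt delta)
    + rest / delta))%:E.
Proof.
exists majorant => //; split => // w.
have [nu nuE nu1] := normalized_measureP Pi (measurable_lik s w) (fun f => lik_ge0 s f w).
have nuA1 X : measurable X -> normalized Pi (fun f => lik s f w) X <= 1.
  by move=> mX; rewrite -nuE; apply: le_trans nu1; apply: le_measure; rewrite ?inE.
have sum0 : 0 <= \sum_(c <- cs) (Num.sqrt (delta^-1))%:E *
     (Num.sqrt (fine (weighted_lr s \1_(close_to s a c) w)))%:E.
  by apply: sume_ge0.
have [l_eq0|l_neq0] := eqVneq (lik s f0 w) 0%R.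
  have l1 : \1_[set w | lik s f0 w = 0%R] w = 1%R :> R by rewrite indicE mem_set.
  apply: (le_trans (nuA1 A mA)); rewrite /majorant l1.
  by rewrite -addeA leeDl// !adde_ge0// lee_fin.
have [/= badw|nbad] := boolP (w \in bad).
  have b1 : \1_bad w = 1%R :> R by rewrite indicE badw.
  apply: (le_trans (nuA1 A mA)); rewrite /majorant b1.
  by rewrite addeAC leeDr// !adde_ge0// lee_fin.
have Dd : delta%:E <= weighted_lr s (cst 1%R) w.
  by move/negP : nbad; rewrite inE /bad /= => /negP; rewrite -leNgt.
apply: (@le_trans _ _ (\sum_(c <- cs) (Num.sqrt (delta^-1))%:E *
     (Num.sqrt (fine (weighted_lr s \1_(close_to s a c) w)))%:E +
  delta^-1%:E * weighted_lr s \1_Bc w)); last first.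
  by rewrite leeDr// adde_ge0// lee_fin.
have ZE : \int[Pi]_f (lik s f w)%:E = (lik s f0 w)%:E * weighted_lr s (cst 1%R) w.
  rewrite integral_lik//; congr (_ * _); apply: eq_integral => f _.
  by rewrite indicT.
have lp : (0 < lik s f0 w)%R by rewrite lt_neqAle eq_sym l_neq0 lik_ge0.
have normE X : measurable X -> normalized Pi (fun f => lik s f w) X =
    (fine (weighted_lr s \1_X w) / fine (weighted_lr s (cst 1%R) w))%:E.
  move=> mX; rewrite /normalized integral_lik// ZE; congr (_%:E).
  have : 0 <= weighted_lr s \1_X w by exact: wlr_ge0.
  have : 0 <= weighted_lr s (cst 1%R) w by exact: wlr_ge0.
  have fM x : 0 <= x -> fine ((lik s f0 w)%:E * x) = (lik s f0 w * fine x)%R.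
    by case: x => [x| |]//= _; rewrite gt0_muley ?lte_fin//= mulr0.
  move=> D0 X0; rewrite !fM// -mulf_div divff// mul1r//.
(* For an infinite evidence the normalized measure is 0 by convention. *)
have [Dinf|Dfin] := eqVneq (weighted_lr s (cst 1%R) w) +oo.
  by rewrite normE// Dinf /= invr0 mulr0 adde_ge0.
have Dpos : (delta <= fine (weighted_lr s (cst 1%R) w))%R.
  rewrite -lee_fin fineK// ge0_fin_numE ?wlr_ge0//.
  by rewrite lt_neqAle Dfin leey.
have D0 : (0 < fine (weighted_lr s (cst 1%R) w))%R by exact: lt_le_trans Dpos.
rewrite -nuE; apply: (le_trans (measure_le_sum nu mA mBc (measurable_close_to s a) cover)).
rewrite addeC leeD//.
  apply: lee_sum => c _; rewrite nuE.
  have mV := measurable_close_to s a c.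
  have := nuA1 _ mV; rewrite normE// -EFinM !lee_fin => t1.
  set N := fine (weighted_lr s \1_(close_to s a c) w) in t1 *.
  have N0 : (0 <= N)%R by apply: fine_ge0; exact: wlr_ge0.
  have t0 : (0 <= N / fine (weighted_lr s (cst 1%R) w))%R by rewrite divr_ge0// ltW.
  apply: (@le_trans _ _ (Num.sqrt (N / fine (weighted_lr s (cst 1%R) w)))).
    rewrite -[leLHS]ger0_norm// -sqrtr_sqr ler_sqrt//.
    by rewrite expr2 ler_piMl.
  rewrite -sqrtrM ?invr_ge0 ?(ltW delta0)// ler_sqrt ?mulr_ge0 ?invr_ge0 ?(ltW delta0)//.
  by rewrite mulrC ler_wpM2r// lef_pV2 ?posrE.
rewrite nuE normE//.
have : 0 <= weighted_lr s \1_Bc w by exact: wlr_ge0.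
case: (weighted_lr s \1_Bc w) => [x| |]// x0; last first.
  by rewrite gt0_muley ?leey// lte_fin invr_gt0.
by rewrite -EFinM lee_fin /= mulrC ler_wpM2r// lef_pV2 ?posrE.
Qed.

End posterior_contraction.

(** * Aggregation of the machines *)

Section product_probability.
Context {R : realType} d {F : measurableType d}.
Local Open Scope ereal_scope.

Lemma product_prob_ge0 m (nu : 'I_m -> {measure set F -> \bar R}) A :
  0 <= product_prob nu A.
Proof.
elim: m nu A => [|m IH] nu A /=; first by case: ifP.
by apply: integral_ge0 => f _; exact: IH.
Qed.

Lemma product_prob_le1 m (nu : 'I_m -> {measure set F -> \bar R}) A :
  (forall k, nu k setT <= 1) -> product_prob nu A <= 1.
Proof.
elim: m nu A => [|m IH] nu A nu1 /=; first by case: ifP; rewrite ?lee01.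
apply: (le_trans _ (nu1 ord0)); rewrite -[leRHS]mul1e -integral_cst//.
apply: ge0_le_lower_integral => f _; first exact: product_prob_ge0.
by apply: IH => k; exact: nu1.
Qed.

(** Induction on the number of factors: a draw [f] in [B ord0] is charged at most 1, and for any
    other [f] the section of [A] is covered by the remaining cylinders. [A] may be non-measurable,
    so only monotonicity of the integral is applied to it. *)
Lemma product_prob_le_sum m (nu : 'I_m -> {measure set F -> \bar R})
    (A : set ('I_m -> F)) (B : 'I_m -> set F) :
  (forall k, nu k setT <= 1) -> (forall k, measurable (B k)) ->
  (forall v, A v -> exists k, B k (v k)) ->
  product_prob nu A <= \sum_k nu k (B k).
Proof.
elim: m nu A B => [|m IH] nu A B nu1 mB AB /=.
  by rewrite big_ord0; case: ifPn => // /asboolP[v /AB[[]]].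
rewrite big_ord_recl; set S := \sum_(i < m) _.
have S0 : 0 <= S by apply: sume_ge0.
apply: (@le_trans _ _ (\int[nu ord0]_f ((\1_(B ord0) f)%:E + S))).
  apply: ge0_le_lower_integral => f _; first exact: product_prob_ge0.
  rewrite indicE; case: (boolP (f \in B ord0)) => [_|Bf].
    by apply: (@le_trans _ _ 1); [apply: product_prob_le1 => k; exact: nu1|rewrite leeDl].
  rewrite add0e; apply: IH => // v /= /AB[k].
  rewrite /ord_cons; case: (unliftP ord0 k) => [j ->|->]; first by exists j.
  by rewrite -inE (negbTE Bf).
rewrite ge0_integralD//; last by apply/measurable_EFinP; exact: measurable_indic.
rewrite integral_indic// setIT leeD2l// integral_cst//.
by rewrite -[leRHS]mule1 lee_wpmul2l.
Qed.

End product_probability.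

(** * The hierarchical prior as a probability measure *)

Section hierarchical_prior.
Context {R : realType} {E : lmodType R} {D : set E} (S : set (set (D -> R))).
Context d {Omega : measurableType d} (P : probability Omega R).
Local Notation F := (functions_on S).
Variables (G : E -> {RV P >-> R}) (g : R -> R).
Hypotheses (scG : scalable_process S G) (sdg : scale_density g).
Local Open Scope ereal_scope.

Local Notation I := (`]0%R, +oo[%classic : set R).
Local Notation hier := (hierarchical_prior S G g).

Let mg : measurable_fun I (EFin \o g).
Proof. by apply/measurable_EFinP; case: sdg. Qed.

Let I_gt0 tau : I tau -> (0 < tau)%R.
Proof. by rewrite /= in_itv/= andbT. Qed.

Let g0 tau : I tau -> (0 <= g tau)%R.
Proof. by move=> /I_gt0; case: sdg => _ + _; apply. Qed.

Let mscale (A : set F) : measurable A ->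
  measurable_fun I (fun tau => scale_prior S G tau A * (g tau)%:E).
Proof.
by move=> mA; apply: emeasurable_funM => //; case: scG => _ _; apply.
Qed.

Let scale_measure tau : I tau ->
  exists mu : probability F R, mu = scale_prior S G tau :> (set F -> \bar R).
Proof.
move=> /I_gt0 tau0; case: scG => /(_ _ tau0) mpath _ _.
pose X : {mfun Omega >-> F} := HB.pack (rescaled_path S G tau : Omega -> F)
  (isMeasurableFun.Build _ _ _ _ (rescaled_path S G tau : Omega -> F) mpath).
by exists (distribution P X).
Qed.

Let scale_ge0 tau (A : set F) : 0 <= scale_prior S G tau A.
Proof. by rewrite /scale_prior /pushforward measure_ge0. Qed.

Let integrand_ge0 tau (A : set F) : I tau -> 0 <= scale_prior S G tau A * (g tau)%:E.
Proof. by move=> It; rewrite mule_ge0// lee_fin g0. Qed.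

Let hier0 : hier set0 = 0.
Proof.
by rewrite /hierarchical_prior integral0_eq// => tau _; rewrite /scale_prior /pushforward
  preimage_set0 measure0 mul0e.
Qed.

Let hier_ge0 A : 0 <= hier A.
Proof. by apply: integral_ge0 => tau; exact: integrand_ge0. Qed.

Let hier_sigma_additive : semi_sigma_additive hier.
Proof.
move=> A mA tA mUA.
have -> : hier (\bigcup_n A n) = \sum_(n <oo) hier (A n).
  rewrite /hierarchical_prior -integral_nneseries//; last 2 first.
  - by move=> n; exact: mscale.
  - by move=> n tau; exact: integrand_ge0.
  apply: eq_integral => tau; rewrite inE => It.
  have [mu <-] := scale_measure It.
  rewrite measure_semi_bigcup// muleC -nneseriesZl//.
  by apply: eq_eseriesr => n _; rewrite muleC.
apply: is_cvg_ereal_nneg_natsum_cond => n _ _.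
exact: hier_ge0.
Qed.

Let hierT : hier setT = 1.
Proof.
case: sdg => _ _ <-; apply: eq_integral => tau; rewrite inE => It.
by have [mu <-] := scale_measure It; rewrite probability_setT mul1e.
Qed.

(** Each scaled prior is the law of a random function, and countable additivity passes through the
    integral over the scale. *)
Lemma hierarchical_prior_probability :
  exists Pi : probability F R, Pi = hier :> (set F -> \bar R).
Proof.
pose m : {measure set F -> \bar R} := HB.pack hier
  (isMeasure.Build _ _ _ hier hier0 hier_ge0 hier_sigma_additive).
pose Pi : probability F R := HB.pack hier (Measure.class m)
  (Measure_isProbability.Build _ _ _ m hierT).
by exists Pi.
Qed.

(** The smoothness assumption speaks of bounded functions only; this lets the unbounded draws be
    discarded, from the prior and then from the posterior. *)
Lemma hierarchical_prior_unbounded : measurable ([set f | bounded_fun f] : set F) ->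
  hier (~` [set f | bounded_fun f]) = 0.
Proof.
move=> mb; rewrite /hierarchical_prior integral0_eq// => tau It.
have [mu muE] := scale_measure It; rewrite -muE probability_setC//.
have -> : mu [set f | bounded_fun f] = 1.
  by rewrite muE; case: scG => _ /(_ _ (I_gt0 It)).
by rewrite subee// mul0e.
Qed.

End hierarchical_prior.

(** * Sup-norm balls and entropy *)

Section supnorm.
Context {R : realType} {X : Type}.
Implicit Types (A : set X) (f : X -> R).

Lemma supnorm_leP A f (r : R) :
  (supnorm A f <= r%:E)%E <-> forall x, A x -> `|f x| <= r.
Proof.
split=> [h x Ax|h].
  by rewrite -lee_fin; apply: le_trans h; apply: ereal_sup_ubound; exists x.
by apply: ge_ereal_sup => _ [x Ax <-]; rewrite lee_fin h.
Qed.

(** Over an empty set the supremum is [-oo], whose square is [+oo]; hence the nonemptiness. *)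
Lemma mule_supnorm_sqr_le A f (L r : R) : A !=set0 -> 0 <= L ->
  (supnorm A f <= r%:E)%E -> (L%:E * supnorm A f ^+ 2 <= (L * r ^+ 2)%:E)%E.
Proof.
move=> [x Ax] L0; have : (`|f x|%:E <= supnorm A f)%E.
  by apply: ereal_sup_ubound; exists x.
case: (supnorm A f) => [v| |]//=; rewrite !lee_fin => fv vr.
rewrite -expr2 ler_wpM2l// ler_sqr ?nnegrE//.
  exact: le_trans fv.
by apply: le_trans vr; exact: le_trans fv.
Qed.

(** The factor 2 makes the bound on the infimum strict, so that some finite cover meets it. *)
Lemma covering_number_attained (r K : R) (B : set (X -> R))
    (nrm : (X -> R) -> \bar R) :
  (lne (covering_number r B nrm) <= K%:E)%E ->
  exists2 hs : seq (X -> R), (size hs)%:R <= 2 * expR K &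
    forall f, B f -> exists2 h, h \in hs & (nrm (f \- h)%R <= r%:E)%E.
Proof.
move=> lK; have c0 : (0 <= covering_number r B nrm)%E.
  by apply: le_ereal_inf_tmp => _ [hs _ <-]; rewrite lee_fin.
have : (covering_number r B nrm < (2 * expR K)%:E)%E.
  rewrite -(lneK (x := covering_number r B nrm)); last by rewrite in_itv/= c0 leey.
  apply: (@le_lt_trans _ _ (expeR K%:E)); first by rewrite lee_expeR.
  by rewrite /= lte_fin ltr_pMl ?expR_gt0// ltr1n.
move=> /ereal_inf_lt [_ [hs hsB <-]]; rewrite lte_fin => hsK.
by exists hs => //; exact: ltW.
Qed.

End supnorm.

Lemma hellinger2C {R : realType} d {T : measurableType d}
    (mu : set T -> \bar R) (p q : T -> R) : hellinger2 mu p q = hellinger2 mu q p.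
Proof.
by congr (integral _ _ _); apply/funext => y; rewrite -opprB sqrrN.
Qed.

(** * From a tail bound on likelihood ratios to contraction of the aggregated posterior *)

Section one_machine.
Context {R : realType} {E : lmodType R} {D : set E} (s : design D)
  (S : set (set (D -> R))).
Context dO {Omega : measurableType dO} (P : probability Omega R)
  (G : nat -> E -> {RV P >-> R}) (g : nat -> R -> R).
Context dW {W : measurableType dW} (P0 : probability W R).
Local Notation F := (functions_on S).
Variables (f0 : F) (eps : R^nat)
  (B : forall n, 'I_(machines s n) -> set F) (c C : R).
Hypotheses (sb : balanced s)
  (scG : forall k, scalable_process S (G k))
  (sdg : forall n, (0 < n)%N -> scale_density (g n))
  (eps0 : forall n, 0 < eps n)
  (adS : adequate_sigma_algebra S s f0 eps)
  (prc : prior_conditions (machine_prior S s G g) B f0 eps c C).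
Context d {T : measurableType d}.
Variables (mu : forall n, 'I_n -> {sigma_finite_measure set T -> \bar R})
  (p : forall n, 'I_n -> F -> T -> R) (Y : forall n, 'I_n -> W -> T).
Hypotheses
  (mp : forall n (i : 'I_n), measurable_fun setT (fun z : F * T => p i z.1 z.2))
  (p0 : forall n (i : 'I_n) f y, 0 <= p i f y)
  (p1 : forall n (i : 'I_n) f, (\int[mu i]_y (p i f y)%:E = 1)%E)
  (indepY : forall n, independent_family P0 (@Y n))
  (lawY : forall n (i : 'I_n) A, measurable A ->
    P0 (Y i @^-1` A) = (\int[mu i]_(y in A) (p i f0 y)%:E)%E).
Variable L : R.
Hypotheses (L0 : 0 < L)
  (smooth : forall f h : F, bounded_fun f -> bounded_fun h ->
     forall n (k : 'I_(machines s n)) (i : 'I_n), region s n k (point s n i) ->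
     (hellinger2 (mu i) (p i f) (p i h)
      <= L%:E * supnorm (region s n k) (f \- h)%R ^+ 2)%E).

Definition local_index n (k : 'I_(machines s n)) : seq 'I_n :=
  [seq i <- index_enum 'I_n | point s n i \in region s n k].

Lemma local_index_uniq n (k : 'I_(machines s n)) : uniq (local_index k).
Proof. by rewrite filter_uniq// index_enum_uniq. Qed.

Lemma mem_local_index n (k : 'I_(machines s n)) i :
  i \in local_index k -> region s n k (point s n i).
Proof. by rewrite mem_filter => /andP[/set_mem]. Qed.

Lemma machines_gt0 n : (0 < n)%N -> (0 < machines s n)%N.
Proof.
move=> n0; have [[sU _ _] _] := sb n0.
have : [set: D] (point s n (Ordinal n0)) by [].
by rewrite -sU => -[k _ _]; exact: leq_ltn_trans (ltn_ord k).
Qed.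

Lemma size_local_index n (k : 'I_(machines s n)) : (0 < n)%N ->
  (size (local_index k))%:R = local_size R s n.
Proof.
move=> n0; have [_ /(_ k) Hk] := sb n0.
have -> : size (local_index k) = #|[pred i : 'I_n | point s n i \in region s n k]|.
  by rewrite -sum1_card -sum1_size big_filter; apply: eq_bigl.
have h : (#|[pred i : 'I_n | point s n i \in region s n k]|)%:R *
  (machines s n)%:R = n%:R :> R by rewrite -natrM Hk.
rewrite /local_size -h mulfK// pnatr_eq0 -lt0n.
exact: machines_gt0.
Qed.

Let x n := local_size R s n * eps n ^+ 2.

Variables (t : R) (eta : R^nat).
Hypothesis (tail : forall n (k : 'I_(machines s n)) (f : F), (0 < n)%N ->
  bounded_fun f -> (supnorm (region s n k) (f \- f0)%R <= (eps n)%:E)%E ->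
  (P0 [set w | (lik_ratio (@Y n) (@p n) f0 (local_index k) f w < expR (- (t * x n)))%R]
   <= (eta n)%:E)%E).

(** The threshold is halved because a factor 2 is lost in a triangle inequality between squared
    distances, when the aggregate is replaced by the draw of machine [k]. *)
Definition far n (k : 'I_(machines s n)) (M : R) : set F :=
  [set f | x n * M ^+ 2 / 2 <=
    \sum_(i <- local_index k) fine (hellinger2 (mu i) (p i f) (p i f0))].

Lemma measurable_far n (k : 'I_(machines s n)) M : measurable (far k M).
Proof.
have mf : measurable_fun setT (fun f => \sum_(i <- local_index k)
    fine (hellinger2 (mu i) (p i f) (p i f0))).
  apply: measurable_sum => i.
  apply: (measurableT_comp (@fine_measurable R setT measurableT)).
  exact: (measurable_hellinger2 (@mu n) (mp (n:=n))).
exact: (measurable_set_ler _ mf).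
Qed.

Lemma local_posterior_normalized n (k : 'I_(machines s n)) (Pi : probability F R) w :
  Pi = machine_prior S s G g n k :> (set F -> \bar R) ->
  local_posterior (machine_prior S s G g) p k (fun i => Y i w) =
  normalized Pi (fun f => lik (@Y n) (@p n) (local_index k) f w).
Proof.
move=> PiE; apply/funext => A; rewrite /local_posterior -PiE /normalized.
have -> : (fun f => (local_likelihood p k (fun i => Y i w) f)%:E) =
    (fun f => (lik (@Y n) (@p n) (local_index k) f w)%:E).
  by apply/funext => f; rewrite /local_likelihood /lik big_filter.
by [].
Qed.

(** In multiples of [x n], the exponents are: entropy [C], radius of the Hellinger balls
    [2 * L * c ^+ 2], half power of the evidence [(t + 1) / 2], separation [- M ^+ 2 / 8]. The
    condition on [M] leaves at most -1. Outside the sieve, prior mass over evidence gives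
    [- 4 + (t + 1)]. *)
Lemma local_posterior_far_le n (k : 'I_(machines s n)) M : (0 < n)%N ->
  8 * (C + 2 * L * c ^+ 2 + (t + 1) / 2 + 1) <= M ^+ 2 ->
  exists2 H : W -> \bar R,
    [/\ measurable_fun setT H, forall w, (0 <= H w)%E &
        forall w, (local_posterior (machine_prior S s G g) p k (fun i => Y i w)
                    (far k M) <= H w)%E] &
    (\int[P0]_w H w <=
      (2 * eta n + (4 * expR (- x n) + 2 * expR (- ((3 - t) * x n))))%:E)%E.
Proof.
move=> n0 MC.
have [Pi PiE] := hierarchical_prior_probability (scG k) (sdg n0).
case: adS => mev mbdd mball.
have [mB PB PU ent] := prc k n0.
have m0 := machines_gt0 n0.
have N0 : 0 < local_size R s n.
  by rewrite /local_size divr_gt0 ?ltr0n.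
have x0 : 0 < x n by rewrite mulr_gt0// exprn_gt0.
have rne : region s n k !=set0.
  have : local_index k != [::].
    apply/eqP => li; have := size_local_index k n0; rewrite li /= => h.
    by move: N0; rewrite -h ltxx.
  by case li : (local_index k) => [//|i ?] _; exists (point s n i);
    apply: mem_local_index; rewrite li mem_head.
have [hs hsK hsB] := covering_number_attained ent.
pose A := far k M.
have mA : measurable A := measurable_far k M.
pose bd : set F := [set f | bounded_fun f].
(* The centres of the cover may be unbounded or close to f0: they are replaced
   by elements of the pieces that they represent. *)
pose good (h : D -> R) := exists f : F, [/\ A f, B k f, bd f &
  (supnorm (region s n k) ((f : D -> R) \- h)%R <= (c * eps n)%:E)%E].
pose centre (h : D -> R) : F := if pselect (good h) is left e then projT1 (cid e) else f0.
pose cs := [seq centre h | h <- hs & `[< good h >]].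
have csP f1 : f1 \in cs -> A f1.
  move=> /mapP[h]; rewrite mem_filter => /andP[/asboolP gh _] ->.
  by rewrite /centre; case: pselect => // e; case: (cid e) => /= f [].
(* Two elements of a piece are both within [c * eps n] of the centre of its ball, hence within
   [2 * c * eps n] of each other. *)
pose a := L * (2 * c * eps n) ^+ 2.
have cover f : A f -> (~` (B k `&` bd)) f \/
    exists2 f1, f1 \in cs & close_to (@mu n) (@p n) (local_index k) a f1 f.
  move=> Af; have [[Bf bf]|nB] := pselect ((B k `&` bd) f); last by left.
  right; have [h hhs fh] := hsB _ Bf.
  have gh : good h by exists f.
  exists (centre h).
    by apply/mapP; exists h => //; rewrite mem_filter hhs andbT; apply/asboolP.
  rewrite /centre; case: pselect => // e; case: (cid e) => /= f1 [Af1 Bf1 bf1 f1h] i si.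
  apply: (le_trans (smooth bf bf1 (mem_local_index si))).
  apply: mule_supnorm_sqr_le => //; first exact: ltW.
  apply/supnorm_leP => z rz.
  move/supnorm_leP : fh => /(_ z rz) /=; move/supnorm_leP : f1h => /(_ z rz) /= h1 h2.
  have -> : f z - f1 z = (f z - h z) - (f1 z - h z) by ring.
  by rewrite (le_trans (ler_normB _ _))//; lra.
have mBc : measurable (~` (B k `&` bd)) by apply: measurableC; exact: measurableI.
pose U : set F := [set f | (supnorm (region s n k) (f \- f0)%R <= (eps n)%:E)%E] `&` bd.
have mU : measurable U by apply: measurableI => //; exact: mball.
have Pbd : Pi (~` bd) = 0%E.
  by rewrite PiE; exact: (hierarchical_prior_unbounded _ (scG k)).
have PiBc : (Pi (~` (B k `&` bd)) <= (expR (- (4 * x n)))%:E)%E.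
  rewrite setCI; apply: (le_trans (measureU2 _ _ _)); [exact: measurableC|exact: measurableC|].
  have PBE : Pi (~` B k) = hierarchical_prior S (G k) (g n) (~` B k) by rewrite PiE.
  rewrite [X in (_ + X)%E]Pbd adde0 [leLHS]PBE /x mulrA.
  exact: PB.
have piU : ((expR (- x n))%:E <= Pi U)%E.
  apply: (@le_trans _ _ (Pi [set f | (supnorm (region s n k) (f \- f0)%R <= (eps n)%:E)%E])).
    by rewrite PiE; exact: PU.
  rewrite -[leRHS]adde0 -Pbd; apply: le_trans (measureU2 _ _ _) => //; last exact: measurableC.
  apply: le_measure; rewrite ?inE//.
  - exact: mball.
  - by apply: measurableU => //; exact: measurableC.
  - by move=> f Hf; have [bf|nbf] := pselect (bd f); [left|right].
have tailU f : U f -> (P0 [set w | (lik_ratio (@Y n) (@p n) f0 (local_index k) f w <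
    expR (- (t * x n)))%R] <= (eta n)%:E)%E.
  by move=> [Uf bf]; exact: tail.
have sep f1 : f1 \in cs -> x n * M ^+ 2 / 2 <=
    \sum_(i <- local_index k) fine (hellinger2 (mu i) (p i f0) (p i f1)).
  move=> /csP; rewrite /A /far /=; under eq_bigr do rewrite hellinger2C.
  by [].
have [H [mH H0 Hle] HI] := normalized_le_majorant (indepY n) (mp (n:=n)) (p0 (n:=n)) (p1 (n:=n))
  (lawY (n:=n)) (local_index_uniq k) mA mBc mU cover sep PiBc (expR_gt0 _) (expR_gt0 _) piU tailU.
exists H.
  by split => // w; rewrite (local_posterior_normalized w PiE); exact: Hle.
apply: (le_trans HI); rewrite lee_fin lerD2l.
rewrite size_local_index// -/(x n).
have scs : (size cs)%:R <= 2 * expR (C * x n).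
  apply: (@le_trans _ _ (size hs)%:R); last by rewrite /x mulrA.
  by rewrite ler_nat size_map size_filter count_size.
set delta := expR (- (t * x n)) * expR (- x n) / 2.
have dE : delta = expR (- ((t + 1) * x n)) / 2.
  by rewrite /delta -expRD; congr (expR _ / 2); ring.
have d0 : 0 < delta by rewrite dE divr_gt0 ?expR_gt0.
have dV : delta^-1 = 2 * expR ((t + 1) * x n).
  by rewrite dE invfM invrK expRN invrK mulrC.
apply: lerD; last first.
  rewrite dV mulrCA -expRD ler_pM2l// ler_expR.
  by rewrite le_eqVlt; apply/orP; left; apply/eqP; ring.
(* The root of 2 is rounded up to 2; together with the 2 of the covering bound it makes the constant
   4. *)
have sV : (Num.sqrt delta)^-1 <= 2 * expR ((t + 1) * x n / 2).
  rewrite -sqrtrV ?(ltW d0)// dV -[leRHS]ger0_norm ?mulr_ge0 ?expR_ge0//.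
  rewrite -sqrtr_sqr ler_sqrt ?mulr_ge0 ?expR_ge0 ?sqr_ge0//.
  rewrite exprMn (_ : expR ((t + 1) * x n / 2) ^+ 2 = expR ((t + 1) * x n)).
    by rewrite ler_pM2r ?expR_gt0//; lra.
  by rewrite -expRM_natl; congr expR; field.
apply: (@le_trans _ _ (2 * expR (C * x n) *
   (expR (local_size R s n * a / 2 - x n * M ^+ 2 / 2 / 4) * (2 * expR ((t + 1) * x n / 2))))).
  by apply: ler_pM => //; rewrite ?mulr_ge0 ?expR_ge0 ?invr_ge0 ?sqrtr_ge0// ler_wpM2l ?expR_ge0.
set e1 := C * x n; set e2 := _ - _; set e3 := _ / 2.
have -> : 2 * expR e1 * (expR e2 * (2 * expR e3)) = 4 * expR (e1 + (e2 + e3)).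
  by rewrite !expRD; ring.
rewrite ler_pM2l// ler_expR /e1 /e2 /e3.
have -> : local_size R s n * a / 2 = 2 * L * c ^+ 2 * x n by rewrite /a /x; field.
have -> : C * x n + (2 * L * c ^+ 2 * x n - x n * M ^+ 2 / 2 / 4 + (t + 1) * x n / 2) =
  - x n + ((C + 2 * L * c ^+ 2 + (t + 1) / 2 + 1) - M ^+ 2 / 8) * x n by field.
rewrite gerDl pmulr_lle0//; lra.
Qed.

Lemma bounded_fun_normP (f : D -> R) :
  bounded_fun f <-> exists M, forall z, `|f z| <= M.
Proof.
split=> [[M [_ HM]]|[M HM]].
  exists (M + 1) => z; apply: (HM (M + 1)) => //; by rewrite ltrDl.
exists M; split; first exact: num_real.
by move=> M' MM' z _ /=; exact: le_trans (HM z) (ltW MM').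
Qed.

Lemma bounded_aggregate n (v : 'I_(machines s n) -> F) :
  (forall k, bounded_fun (v k)) -> bounded_fun (aggregate v).
Proof.
move=> bv; pose M k := projT1 (cid ((bounded_fun_normP (v k)).1 (bv k))).
have MP k z : `|v k z| <= M k.
  by rewrite /M; case: (cid _) => /= N; exact.
apply/bounded_fun_normP; exists (\sum_k M k) => z.
rewrite /aggregate (le_trans (ler_norm_sum _ _ _))//; apply: ler_sum => k _.
rewrite normrM (le_trans _ (MP k z))// ler_piMl//.
by rewrite indicE; case: (_ \in _); rewrite ?normr1 ?normr0.
Qed.

Lemma aggregateE n (v : 'I_(machines s n) -> F) k z : (0 < n)%N ->
  region s n k z -> aggregate v z = v k z.
Proof.
move=> n0 rz; have [[_ tI _] _] := sb n0.
rewrite /aggregate (bigD1 k)//= indicE mem_set// mul1r big1 ?addr0// => j jk.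
rewrite indicE; case: (boolP (z \in _)) => [/set_mem rjz|_]; last by rewrite mul0r.
by move: jk; rewrite (tI j k)// ?eqxx//; exists z.
Qed.

Let mpf n (i : 'I_n) f : measurable_fun setT (p i f).
Proof. exact: (measurableT_comp (mp i) (pair1_measurable f)). Qed.

Let msub n (i : 'I_n) f h : measurable_fun setT
  (fun y => ((Num.sqrt (p i f y) - Num.sqrt (p i h y)) ^+ 2)%:E).
Proof.
apply/measurable_EFinP; apply: measurable_funX; apply: measurable_funB.
  exact: (measurableT_comp measurable_sqrt).
exact: (measurableT_comp measurable_sqrt).
Qed.

Lemma hellinger2_triangle n (i : 'I_n) f h e :
  (hellinger2 (mu i) (p i f) (p i e) <=
   2%:E * hellinger2 (mu i) (p i f) (p i h) + 2%:E * hellinger2 (mu i) (p i h) (p i e))%E.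
Proof.
have n2 f1 f2 y : (0 <= ((Num.sqrt (p i f1 y) - Num.sqrt (p i f2 y)) ^+ 2)%:E)%E.
  by rewrite lee_fin sqr_ge0.
rewrite /hellinger2 -!ge0_integralZl_EFin// -ge0_integralD//; first last.
- by apply: emeasurable_funM.
- by move=> y _; rewrite mule_ge0.
- by apply: emeasurable_funM.
- by move=> y _; rewrite mule_ge0.
apply: ge0_le_lower_integral => y _ //; rewrite -!EFinM -EFinD lee_fin.
set u := Num.sqrt _; set v := Num.sqrt _; set w := Num.sqrt _.
have := sqr_ge0 ((u - w) - (w - v)); nra.
Qed.

Lemma hellinger2_le2 n (i : 'I_n) f h : (hellinger2 (mu i) (p i f) (p i h) <= 2%:E)%E.
Proof.
have -> : (2%:E = \int[mu i]_y ((p i f y)%:E + (p i h y)%:E) :> \bar R)%E.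
  rewrite ge0_integralD//; try by move=> y _; rewrite lee_fin.
  - by rewrite !p1.
  - exact/measurable_EFinP.
  - exact/measurable_EFinP.
apply: ge0_le_lower_integral => y _; first by rewrite lee_fin sqr_ge0.
rewrite -EFinD lee_fin -{2}[p i f y]sqr_sqrtr// -{2}[p i h y]sqr_sqrtr//.
set u := Num.sqrt _; set v := Num.sqrt _.
have : 0 <= u * v by rewrite mulr_ge0 ?sqrtr_ge0.
nra.
Qed.

(** Squared Hellinger distances are at most 2, hence finite, so [fine] preserves the order. *)
Lemma fine_hellinger2_triangle n (i : 'I_n) f h e :
  hellinger2 (mu i) (p i f) (p i h) = 0%E ->
  fine (hellinger2 (mu i) (p i f) (p i e)) <=
  2 * fine (hellinger2 (mu i) (p i h) (p i e)).
Proof.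
move=> fh0; have := hellinger2_triangle i f h e; rewrite fh0 mule0 add0e.
have := hellinger2_le2 i f e; have := hellinger2_le2 i h e.
have := hellinger2_ge0 (mu i) (p i f) (p i e).
have := hellinger2_ge0 (mu i) (p i h) (p i e).
case: (hellinger2 _ (p i h) _) => [a| |]//; case: (hellinger2 _ (p i f) _) => [b| |]//.
Qed.

(** The density at a design point may depend on the whole function, but smoothness makes it local:
    bounded functions equal on a region have Hellinger distance 0 at its design points. On region
    [k] the aggregate is thus traded for [v k]. Boundedness is needed for this, whence the second
    alternative. *)
Lemma d_n_aggregate n (v : 'I_(machines s n) -> F) (M : R) : (0 < n)%N -> 0 < M ->
  M * eps n <= d_n p mu n (aggregate v) f0 ->
  exists k, (far k M `|` ~` [set f | bounded_fun f]) (v k).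
Proof.
move=> n0 M0 Md; apply: contrapT => /forallNP nk.
have bv k : bounded_fun (v k).
  by apply: contrapT => nb; apply: (nk k); right.
have nfar k : \sum_(i <- local_index k) fine (hellinger2 (mu i) (p i (v k)) (p i f0))
    < x n * M ^+ 2 / 2.
  by rewrite ltNge; apply/negP => h; apply: (nk k); left.
have bagg := bounded_aggregate bv.
have [[sU _ rne] _] := sb n0.
have hle k i : i \in local_index k ->
    fine (hellinger2 (mu i) (p i (aggregate v)) (p i f0)) <=
    2 * fine (hellinger2 (mu i) (p i (v k)) (p i f0)).
  move=> /mem_local_index ik; apply: fine_hellinger2_triangle.
  apply/eqP; rewrite eq_le hellinger2_ge0 andbT.
  apply: (le_trans (smooth bagg (bv k) ik)).
  have -> : (0 = (L * 0 ^+ 2)%:E :> \bar R)%E by rewrite expr0n mulr0.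
  apply: mule_supnorm_sqr_le; [exact: rne|exact: ltW|].
  by apply/supnorm_leP => z rz /=; rewrite (aggregateE _ n0 rz) subrr normr0.
have hge0 i f h : 0 <= fine (hellinger2 (mu i) (p i f) (p i h)).
  by apply: fine_ge0; exact: hellinger2_ge0.
have : \sum_(i < n) fine (hellinger2 (mu i) (p i (aggregate v)) (p i f0)) <
   n%:R * (M * eps n) ^+ 2.
  apply: (@le_lt_trans _ _ (\sum_(k < machines s n) \sum_(i <- local_index k)
     fine (hellinger2 (mu i) (p i (aggregate v)) (p i f0)))).
    under [leRHS]eq_bigr do rewrite big_filter big_mkcond.
    rewrite exchange_big/=; apply: ler_sum => i _.
    have : [set: D] (point s n i) by []. rewrite -sU => -[k _ ik].
    rewrite (bigD1 k)//= mem_set// lerDl sumr_ge0// => j _.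
    by case: ifP.
  have -> : n%:R * (M * eps n) ^+ 2 = \sum_(k < machines s n) (x n * M ^+ 2).
    rewrite big_const_ord iter_addr_0 -mulr_natl /x /local_size.
    by field; rewrite pnatr_eq0 -lt0n machines_gt0.
  have m0 := machines_gt0 n0.
  have lts (k : 'I_(machines s n)) : \sum_(i <- local_index k)
       fine (hellinger2 (mu i) (p i (aggregate v)) (p i f0))
     < x n * M ^+ 2.
    have h2 : \sum_(i <- local_index k) fine (hellinger2 (mu i) (p i (aggregate v)) (p i f0))
        <= 2 * \sum_(i <- local_index k) fine (hellinger2 (mu i) (p i (v k)) (p i f0)).
      by rewrite mulr_sumr big_seq [leRHS]big_seq; apply: ler_sum => i; exact: hle.
    by have := nfar k; lra.
  (* The inequality of the sums is strict because there is at least one machine. *)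
  rewrite (bigD1 (Ordinal m0))//= [ltRHS](bigD1 (Ordinal m0))//=.
  apply: ltr_leD; first exact: lts.
  by apply: ler_sum => k _; exact: ltW.
set Sg := \sum_(i < n) _ => SgM.
move: Md; rewrite leNgt => /negP; apply.
rewrite /d_n -/Sg -[ltRHS]ger0_norm ?mulr_ge0 ?(ltW M0) ?(ltW (eps0 n))//.
rewrite -sqrtr_sqr ltr_sqrt ?exprn_gt0 ?mulr_gt0//.
by rewrite mulrC ltr_pdivrMr ?ltr0n// mulrC.
Qed.

(** The unbounded functions enter the union bound, but they are null for each local posterior and
    drop out of the sum. *)
Lemma aggregated_posterior_le n M w : (0 < n)%N -> 0 < M ->
  (aggregated_posterior (machine_prior S s G g) p (fun i : 'I_n => Y i w)
     [set f | (M * eps n <= d_n p mu n f f0)%R] <=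
   \sum_(k < machines s n)
      local_posterior (machine_prior S s G g) p k (fun i => Y i w) (far k M))%E.
Proof.
move=> n0 M0; case: adS => _ mbdd _.
have /choice[nu nuP] : forall k : 'I_(machines s n), exists nu : {measure set F -> \bar R},
    [/\ nu = local_posterior (machine_prior S s G g) p k (fun i => Y i w) :> (set F -> \bar R),
     (nu setT <= 1)%E & nu (~` [set f | bounded_fun f]) = 0%E].
  move=> k; have [Pi PiE] := hierarchical_prior_probability (scG k) (sdg n0).
  have [nu nuE nu1] := normalized_measureP Pi
    (measurable_lik (@Y n) (mp (n:=n)) (local_index k) w)
    (fun f => lik_ge0 (@Y n) (p0 (n:=n)) (local_index k) f w).
  have Pb : Pi (~` [set f | bounded_fun f]) = 0%E.
    by rewrite PiE; exact: (hierarchical_prior_unbounded _ (scG k)).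
  exists nu; split => //; first by rewrite (local_posterior_normalized w PiE).
  rewrite nuE /normalized null_set_integral ?mul0r//.
  - by exact: measurableC.
  - apply/measurable_EFinP; apply: measurable_funTS.
    exact: (measurable_lik (@Y n) (mp (n:=n)) (local_index k) w).
rewrite /aggregated_posterior.
have -> : (fun k => local_posterior (machine_prior S s G g) p k (fun i : 'I_n => Y i w)) =
    (fun k => nu k : set F -> \bar R).
  by apply/funext => k; have [] := nuP k.
have mfb k : measurable (far k M `|` ~` [set f : F | bounded_fun f]).
  by apply: measurableU; [exact: measurable_far|exact: measurableC].
apply: (le_trans (@product_prob_le_sum _ _ _ _ nu _
  (fun k => far k M `|` ~` [set f : F | bounded_fun f]) _ _ _)) => //.
- by move=> k; have [] := nuP k.
- by move=> v /=; exact: d_n_aggregate.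
apply: lee_sum => k _; have [<- _ nub] := nuP k.
apply: (le_trans (measureU2 _ _ _)); [exact: measurable_far|exact: measurableC|].
by rewrite [X in (_ + X)%E]nub adde0.
Qed.

Hypotheses (t3 : t < 3)
  (m_eta : (machines s n)%:R * eta n @[n --> \oo] --> 0)
  (m_exp : forall a, 0 < a -> (machines s n)%:R * expR (- (a * x n)) @[n --> \oo] --> 0).

(** All that remains to be found for a given model is [tail]. The local bounds sum to multiples of
    [m * eta], [m * expR (- x)] and [m * expR (- (3 - t) * x)], which vanish by [m_eta] and
    [m_exp]. *)
Lemma contracts_of_tail : contracts (machine_prior S s G g) p mu P0 Y f0 eps.
Proof.
move=> M Moo.
pose b n := (machines s n)%:R *
  (2 * eta n + (4 * expR (- x n) + 2 * expR (- ((3 - t) * x n)))).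
have b0 : b n @[n --> \oo] --> 0.
  have -> : b = fun n => 2 * ((machines s n)%:R * eta n) +
     (4 * ((machines s n)%:R * expR (- (1 * x n))) +
      2 * ((machines s n)%:R * expR (- ((3 - t) * x n)))).
    by apply/funext => n; rewrite /b mul1r; ring.
  have -> : 0 = 2 * 0 + (4 * 0 + 2 * 0) :> R by rewrite !mulr0 !addr0.
  apply: cvgD; first exact: cvgMl_tmp.
  apply: cvgD; apply: cvgMl_tmp; apply: m_exp => //.
  by rewrite subr_gt0.
apply: (@squeeze_cvge _ _ _ _ (fun=> 0%E) _ (fun n => (b n)%:E)); last 2 first.
- exact: cvg_cst.
- by apply: cvg_EFin; [exact: nearW|exact: b0].
pose K := 8 * (C + 2 * L * c ^+ 2 + (t + 1) / 2 + 1).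
near=> n.
have n0 : (0 < n)%N by near: n; exists 1%N.
have M1 : Num.max 1 K <= M n by near: n; move/cvgryPge : Moo; exact.
have M0 : 0 < M n by apply: lt_le_trans M1; rewrite lt_max ltr01.
have MK : K <= M n ^+ 2.
  have : 1 <= M n by apply: le_trans M1; rewrite le_max lexx.
  have : K <= M n by apply: le_trans M1; rewrite le_max lexx orbT.
  nra.
have /choice[H HP] : forall k : 'I_(machines s n), exists H : W -> \bar R,
   [/\ measurable_fun setT H, forall w, (0 <= H w)%E,
       forall w, (local_posterior (machine_prior S s G g) p k (fun i => Y i w)
                    (far k (M n)) <= H w)%E &
    (\int[P0]_w H w <=
      (2 * eta n + (4 * expR (- x n) + 2 * expR (- ((3 - t) * x n))))%:E)%E].
  by move=> k; have [H [mH H0 HH] HI] := local_posterior_far_le k n0 MK; exists H.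
have agg0 w : (0 <= aggregated_posterior (machine_prior S s G g) p (fun i : 'I_n => Y i w)
     [set f | (M n * eps n <= d_n p mu n f f0)%R])%E.
  have /choice[nu nuP] : forall k : 'I_(machines s n), exists nu : {measure set F -> \bar R},
      nu = local_posterior (machine_prior S s G g) p k (fun i => Y i w) :> (set F -> \bar R).
    move=> k; have [Pi PiE] := hierarchical_prior_probability (scG k) (sdg n0).
    have [nu nuE nu1] := normalized_measureP Pi
      (measurable_lik (@Y n) (mp (n:=n)) (local_index k) w)
      (fun f => lik_ge0 (@Y n) (p0 (n:=n)) (local_index k) f w).
    by exists nu; rewrite (local_posterior_normalized w PiE).
  rewrite /aggregated_posterior.
  have -> : (fun k => local_posterior (machine_prior S s G g) p k (fun i : 'I_n => Y i w)) =
      (fun k => nu k : set F -> \bar R).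
    by apply/funext => k; have := nuP k.
  exact: product_prob_ge0.
rewrite integral_ge0//=.
apply: (@le_trans _ _ (\int[P0]_w \sum_(k < machines s n) H k w)%E).
  apply: ge0_le_lower_integral => w _ //.
  apply: (le_trans (aggregated_posterior_le w n0 M0)).
  by apply: lee_sum => k _; have [] := HP k.
rewrite ge0_integral_sum//; last 2 first.
- by move=> k; have [] := HP k.
- by move=> k w _; have [] := HP k.
have -> : (b n)%:E = (\sum_(k < machines s n)
   (2 * eta n + (4 * expR (- x n) + 2 * expR (- ((3 - t) * x n))))%:E)%E.
  by rewrite sumEFin big_const_ord iter_addr_0 /b [in LHS]mulr_natl.
by apply: lee_sum => k _; have [] := HP k.
Unshelve. all: by end_near. Qed.

End one_machine.

(** * The two conditions on the number of machines *)

Section rates.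
Context {R : realType} {X : Type} (s : design X) (eps : R^nat).
Hypotheses (eps0 : forall n, 0 < eps n)
  (m_gt0 : forall n, (0 < n)%N -> (0 < machines s n)%N)
  (m_le : forall n, (0 < n)%N -> (machines s n <= n)%N).

Local Notation x n := (local_size R s n * eps n ^+ 2).
Local Notation m n := ((machines s n)%:R : R).

Let m0 n : (0 < n)%N -> 0 < m n. Proof. by move=> n0; rewrite ltr0n m_gt0. Qed.

Let x0 n : (0 < n)%N -> 0 < x n.
Proof.
by move=> n0; rewrite mulr_gt0 ?exprn_gt0// /local_size divr_gt0 ?ltr0n// m_gt0.
Qed.

(** The strong rate says that the inverse ratio tends to infinity, as
    [n / m^2 * eps^2 = x n / m n]. *)
Lemma strong_rate_cvg_div : strong_rate s eps -> m n / x n @[n --> \oo] --> 0.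
Proof.
move=> sr; apply/cvgr0Pnorm_lt => e e0.
have e0' : 0 < e^-1 by rewrite invr_gt0.
near=> n.
have n0 : (0 < n)%N by near: n; exists 1%N.
rewrite ger0_norm ?divr_ge0 ?(ltW (x0 n0))//.
have : e^-1 + 1 <= n%:R / (machines s n)%:R ^+ 2 * eps n ^+ 2.
  by near: n; move/cvgryPge : sr; exact.
move=> h; have {h} : e^-1 < n%:R / (machines s n)%:R ^+ 2 * eps n ^+ 2.
  by apply: lt_le_trans h; rewrite ltrDl.
have -> : n%:R / (machines s n)%:R ^+ 2 * eps n ^+ 2 = x n / m n.
  by rewrite /local_size; field; rewrite gt_eqF// m0.
have xm0 : 0 < x n / m n by rewrite divr_gt0 ?x0 ?m0.
by rewrite -[ltRHS]invrK ltf_pV2 ?posrE ?invr_gt0// invf_div.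
Unshelve. all: by end_near. Qed.

(** The exponential is at most [1 / (a * x n)], which reduces the claim to the previous limit. *)
Lemma strong_rate_cvg_expR a : 0 < a -> strong_rate s eps ->
  m n * expR (- (a * x n)) @[n --> \oo] --> 0.
Proof.
move=> a0 /strong_rate_cvg_div mx.
apply: (@squeeze_cvgr _ _ _ _ (fun=> 0) (fun n => a^-1 * (m n / x n))); last 2 first.
- exact: cvg_cst.
- by rewrite -[X in _ --> X](mulr0 a^-1); apply: cvgMl_tmp.
near=> n.
have n0 : (0 < n)%N by near: n; exists 1%N.
rewrite mulr_ge0 ?expR_ge0//= [leRHS]mulrCA ler_pM2l ?m0//.
have ax : 0 < a * x n by rewrite mulr_gt0// x0.
rewrite -invfM expRN lef_pV2 ?posrE ?expR_gt0//.
by apply: le_trans (expR_ge1Dx _); rewrite lerDr.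
Unshelve. all: by end_near. Qed.

(** Eventually [m <= a / 2 * n * eps^2 / ln n], that is, [2 * ln n <= a * x n]. The exponential is
    then at most [1 / n^2], and [m <= n] leaves [1 / n]. *)
Lemma weak_rate_cvg_expR a : 0 < a -> weak_rate s eps ->
  m n * expR (- (a * x n)) @[n --> \oo] --> 0.
Proof.
move=> a0 /eqoP wr.
(* This is [1 / n] for positive [n], written so that its shift by one is the harmonic sequence. *)
apply: (@squeeze_cvgr _ _ _ _ (fun=> 0) (fun n => n.-1.+1%:R^-1)); last 2 first.
- exact: cvg_cst.
- have := @cvg_harmonic R; rewrite -(cvg_shiftS (fun n : nat => (n.-1.+1%:R : R)^-1)) .
  by [].
near=> n.
have n1 : (1 < n)%N by near: n; exists 2%N.
have n0 : (0 < n)%N by exact: ltnW.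
have -> : n.-1.+1 = n by rewrite prednK.
rewrite mulr_ge0 ?expR_ge0//=.
have nR : 1 < n%:R :> R by rewrite ltr1n.
have ln0 : 0 < ln (n%:R : R) by rewrite ln_gt0.
have : `|m n| <= a / 2 * `|n%:R * eps n ^+ 2 / ln n%:R|.
  by near: n; apply: wr; rewrite divr_gt0.
rewrite !ger0_norm//; last first.
  by rewrite divr_ge0 ?mulr_ge0 ?sqr_ge0// ltW.
rewrite [leRHS]mulrA ler_pdivlMr// [leRHS]mulrA => h.
have h2 : 2 * ln n%:R <= a * x n.
  have mm := m0 n0.
  have -> : a * x n = 2 * ((a / 2 * n%:R * eps n ^+ 2) / m n).
    by rewrite /local_size; field; rewrite gt_eqF.
  by rewrite ler_pM2l// ler_pdivlMr// [leLHS]mulrC.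
apply: (@le_trans _ _ (n%:R * expR (- (2 * ln n%:R)))).
  apply: ler_pM; rewrite ?expR_ge0//; first by rewrite ler_nat m_le.
  by rewrite ler_expR lerN2.
rewrite expRN expRM_natl lnK ?posrE ?ltr0n// expr2 invfM mulrA divff ?mul1r//.
by rewrite gt_eqF// ltr0n.
Unshelve. all: by end_near. Qed.

End rates.

(** * Lower tails of the likelihood ratio *)

Section log_ratio_moments.
Context {R : realType} d {T : measurableType d} (mu : {measure set T -> \bar R}).
Variables q r : T -> R.
Hypotheses (mq : measurable_fun setT q) (mr : measurable_fun setT r)
  (q0 : forall y, 0 <= q y) (r0 : forall y, 0 <= r y)
  (q1 : (\int[mu]_y (q y)%:E = 1)%E).
Variables (kb v : R).
Hypotheses (KLb : (KL mu q r <= kb%:E)%E) (KVv : (KV mu q r <= v%:E)%E).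

(** Unlike [log_ratio] it is finite everywhere: where a density vanishes its value is [ln 0 = 0]. *)
Definition llr y := ln (q y / r y).

Lemma measurable_llr : measurable_fun setT llr.
Proof.
by apply: (measurableT_comp (@measurable_ln R)); exact: measurable_fun_div_ge0.
Qed.

Local Open Scope ereal_scope.

Lemma integral_llr_sqr_le : \int[mu]_y (llr y ^+ 2 * q y)%:E <= v%:E.
Proof.
apply: le_trans KVv; apply: ge0_le_lower_integral => y _.
  by rewrite lee_fin mulr_ge0// sqr_ge0.
rewrite /log_ratio /llr; case: eqP => [->|_]; last by rewrite EFinM EFin_expe.
by rewrite invr0 mulr0 ln0// expr0n/= mul0r ?expe2 ?mulyy mule_ge0// lee_fin.
Qed.

(** Where [r] vanishes and [q] does not, the integrand of [KV] is infinite; as [KV] is finite, this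
    set has mass 0 under [q]. *)
Lemma density_null_eq0 : \int[mu]_y (\1_[set y | r y = 0%R] y * q y)%:E = 0.
Proof.
set I := integral _ _ _.
have I0 : 0 <= I by apply: integral_ge0 => y _; rewrite lee_fin mulr_ge0.
have mz : measurable [set y | r y = 0%R].
  by have := mr measurableT (measurable_set1 0%R); rewrite setTI.
have H k : (0 <= k)%R -> k%:E * I <= v%:E.
  move=> k0; apply: le_trans KVv; rewrite -ge0_integralZl_EFin//; first last.
  - by apply/measurable_EFinP; apply: measurable_funM => //; exact: measurable_indic.
  - by move=> y _; rewrite lee_fin mulr_ge0.
  apply: ge0_le_lower_integral => y _; first by rewrite mule_ge0// lee_fin// mulr_ge0.
  rewrite indicE; have [ry|/negP ry] := boolP (y \in _).
    move: ry; rewrite inE /= => ry.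
    rewrite /log_ratio ry eqxx ?expe2 ?mulyy mul1r.
    have [->|qn] := eqVneq (q y) 0%R; first by rewrite !mule0.
    have qp : (0 < q y)%R by rewrite lt_neqAle eq_sym qn q0.
    by rewrite gt0_mulye ?leey// lte_fin.
  rewrite mul0r mule0 mule_ge0 ?lee_fin//.
  by rewrite sqre_ge0.
apply/eqP; rewrite eq_le I0 andbT leNgt; apply/negP => Ip.
move: H I0 Ip; case: I => [x| |]// H x0 xp; last first.
  by have := H 1%R ler01; rewrite mul1e leNgt ltry.
rewrite lte_fin in xp.
have v0 : (0 <= v)%R by rewrite -lee_fin; have := H 0%R (lexx _); rewrite mul0e.
have := H ((v + 1) / x)%R; rewrite -EFinM divfK ?gt_eqF// lee_fin.
by move=> /(_ (divr_ge0 (addr_ge0 v0 ler01) (ltW xp))); lra.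
Qed.

Let illr2 : mu.-integrable setT (fun y => (llr y ^+ 2 * q y)%:E).
Proof.
apply/integrableP; split.
  apply/measurable_EFinP; apply: measurable_funM => //.
  by apply: measurable_funX; exact: measurable_llr.
rewrite (eq_integral (fun y => (llr y ^+ 2 * q y)%:E)); last first.
  by move=> y _; rewrite gee0_abs// lee_fin mulr_ge0// sqr_ge0.
by apply: le_lt_trans integral_llr_sqr_le _; rewrite ltry.
Qed.

Let iq : mu.-integrable setT (fun y => (q y)%:E).
Proof.
apply/integrableP; split; first exact/measurable_EFinP.
by under eq_integral do rewrite gee0_abs ?lee_fin//; rewrite q1 ltry.
Qed.

(** Domination by [|l| <= l ^+ 2 + 1]. *)
Let illr : mu.-integrable setT (fun y => (llr y * q y)%:E).
Proof.
apply: (@le_integrable _ _ _ mu _ measurableT _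
  (fun y => (llr y ^+ 2 * q y)%:E + (q y)%:E)).
- apply/measurable_EFinP; apply: measurable_funM => //; exact: measurable_llr.
- move=> y _; rewrite -EFinD !abse_EFin lee_fin.
  have h0 : (0 <= llr y ^+ 2 * q y + q y)%R.
    by apply: addr_ge0 => //; rewrite mulr_ge0// sqr_ge0.
  rewrite normrM (ger0_norm h0).
  rewrite (ger0_norm (q0 y)) -[X in (_ + X)%R]mul1r -mulrDl ler_wpM2r//.
  rewrite -[(llr y ^+ 2)%R]real_normK ?num_real//.
  by have := sqr_ge0 (`|llr y| - 1)%R; have := normr_ge0 (llr y); nra.
- exact: (integrableD measurableT illr2 iq).
Qed.

Definition llr_mean : R := fine (\int[mu]_y (llr y * q y)%:E).

Lemma llr_meanE : \int[mu]_y (llr y * q y)%:E = llr_mean%:E.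
Proof. by rewrite /llr_mean fineK//; exact: integrable_fin_num. Qed.

(** Positive and negative parts are compared separately: from [llr] to [log_ratio] the former can
    only grow, where [r] vanishes, and the latter are equal. *)
Lemma llr_mean_le : (llr_mean <= kb)%R.
Proof.
rewrite -lee_fin -llr_meanE; apply: le_trans KLb.
rewrite /KL integralE [leRHS]integralE leeB//.
  apply: ge0_le_lower_integral => y _; first exact: funepos_ge0.
  rewrite !funeposE /log_ratio /llr; case: eqP => [->|_]; last by rewrite -EFinM.
  rewrite invr0 mulr0 ln0// mul0r maxxx le_max lexx orbT//.
rewrite le_eqVlt; apply/orP; left; apply/eqP; apply: eq_integral => y _.
rewrite !funenegE /log_ratio /llr; case: eqP => [->|_]; last by rewrite -EFinM.
rewrite invr0 mulr0 ln0// mul0r oppe0 maxxx.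
by rewrite max_r// leeNl oppe0 mule_ge0// lee_fin.
Qed.

(** The variance is at most the second moment. The shift [a] gives the form under which second
    moments of independent sums are bounded. *)
Lemma integral_llr_shift_sqr_le (a : R) :
  \int[mu]_y (((llr y - llr_mean) + a) ^+ 2 * q y)%:E <= (a ^+ 2 + v)%:E.
Proof.
set e := llr_mean.
have -> : \int[mu]_y (((llr y - e) + a) ^+ 2 * q y)%:E =
  \int[mu]_y ((llr y ^+ 2 * q y)%:E + ((2 * (a - e))%:E * (llr y * q y)%:E +
    ((a - e) ^+ 2)%:E * (q y)%:E)).
  by apply: eq_integral => y _; rewrite -!EFinM -!EFinD; congr (_%:E); ring.
have i2 : mu.-integrable setT (fun y => (2 * (a - e))%:E * (llr y * q y)%:E).
  exact: integrableZl.
have i3 : mu.-integrable setT (fun y => ((a - e) ^+ 2)%:E * (q y)%:E).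
  exact: integrableZl.
rewrite integralD//; last exact: integrableD.
rewrite integralD// !integralZl// llr_meanE q1 -/e mule1 -EFinM -EFinD.
apply: (@le_trans _ _ (v%:E + (2 * (a - e) * e + (a - e) ^+ 2)%:E)).
  by rewrite leeD2r// integral_llr_sqr_le.
by rewrite -EFinD lee_fin; have := sqr_ge0 e; nra.
Qed.

End log_ratio_moments.

Lemma measurable_lik_ratio_lt {R : realType} d {W : measurableType d} d'
    {T : measurableType d'} {n : nat} (Y : 'I_n -> W -> T) d'' {F : measurableType d''}
    (p : 'I_n -> F -> T -> R) (f0 f : F) (s : seq 'I_n) (c : R) :
  (forall i, measurable_fun setT (Y i)) ->
  (forall i f, measurable_fun setT (p i f)) -> (forall i f y, 0 <= p i f y) ->
  measurable [set w | lik_ratio Y p f0 s f w < c].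
Proof.
move=> mY mp p0; have mr : measurable_fun setT (fun w => lik_ratio Y p f0 s f w).
  apply: measurable_prod => i _; rewrite /ratio.
  by apply: (measurable_fun_div_ge0 (T := W)) => //; exact: measurableT_comp.
exact: (measurable_set_ltr mr).
Qed.

Section chebyshev_tail.
Context {R : realType} d {W : measurableType d} (P : probability W R).
Context d' {T : measurableType d'} {n : nat} (Y : 'I_n -> W -> T).
Context d'' {F : measurableType d''}.
Variables (mu : 'I_n -> {sigma_finite_measure set T -> \bar R})
  (p : 'I_n -> F -> T -> R) (f0 f : F).
Hypothesis indepY : independent_family P Y.
Hypotheses (mp : forall i f, measurable_fun setT (p i f))
  (p0 : forall i f y, 0 <= p i f y)
  (p1 : forall i f, (\int[mu i]_y (p i f y)%:E = 1)%E).
Hypothesis lawY : forall i A, measurable A ->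
  P (Y i @^-1` A) = (\int[mu i]_(y in A) (p i f0 y)%:E)%E.
Local Open Scope ereal_scope.

Let mY i : measurable_fun setT (Y i). Proof. by case: indepY. Qed.

(** The log-likelihood ratio has mean at most [kb] per observation, so on the event the centred sum
    exceeds [u], while its second moment is at most [size s] times [v]. Where a density vanishes,
    the likelihood ratio is not the exponential of minus the sum of the [llr]; such observations
    have probability 0. *)
Lemma chebyshev_tail (s : seq 'I_n) (kb v u : R) : uniq s -> (0 < u)%R ->
  (forall i, i \in s -> KL (mu i) (p i f0) (p i f) <= kb%:E) ->
  (forall i, i \in s -> KV (mu i) (p i f0) (p i f) <= v%:E) ->
  P [set w | (lik_ratio Y p f0 s f w < expR (- ((size s)%:R * kb + u)))%R]
  <= ((size s)%:R * v / u ^+ 2)%:E.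
Proof.
move=> us u0 KLb KVv.
pose e i := llr_mean (mu i) (p i f0) (p i f).
pose X i y : R := if i \in s then (llr (p i f0) (p i f) y - e i)%R else 0%R.
have mX i : measurable_fun setT (X i).
  rewrite /X; case: (i \in s) => //.
  by apply: measurable_funB => //; exact: measurable_llr.
pose Z w : R := (\sum_(i <- s) X i (Y i w))%R.
have mZ : measurable_fun setT Z.
  by apply: measurable_sum => i; exact: measurableT_comp.
have EZ : \int[P]_w (Z w ^+ 2)%:E <= ((size s)%:R * v)%:E.
  have -> : ((size s)%:R * v = \sum_(i <- s) v)%R.
    by rewrite big_const_seq count_predT iter_addr_0 mulr_natl.
  apply: (integral_sum_sqr_le indepY (fun i => mp i f0) (fun i => p0 i f0) lawY us mX).
  move=> i a si; rewrite /X si.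
  exact: (integral_llr_shift_sqr_le (mp i f0) (mp i f) (p0 i f0) (p0 i f) (p1 i f0)
    (KVv i si)).
pose big := [set w | (u ^+ 2)%:E <= (Z w ^+ 2)%:E].
have mbig : measurable big.
  rewrite -[X in measurable X]setTI; apply: emeasurable_fun_c_infty => //.
  by apply/measurable_EFinP; exact: measurable_funX.
have Pbig : P big <= ((size s)%:R * v / u ^+ 2)%:E.
  have : (u ^+ 2)%:E * P big <= ((size s)%:R * v)%:E.
    apply: le_trans EZ; rewrite -[big]setIT -integral_indic//.
    rewrite -ge0_integralZl_EFin ?sqr_ge0//; last first.
      by apply/measurable_EFinP; exact: measurable_indic.
    apply: ge0_le_lower_integral => w _; first by rewrite -EFinM lee_fin mulr_ge0// sqr_ge0.
    rewrite indicE; case: (boolP (w \in big)) => [/set_mem h|_]; rewrite ?mule1 ?mule0//.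
    by rewrite lee_fin sqr_ge0.
  have -> : P big = (fine (P big))%:E by rewrite fineK// fin_num_measure.
  by rewrite -EFinM !lee_fin ler_pdivlMr ?exprn_gt0// mulrC.
pose zero i := [set y | p i f0 y = 0%R] `|` [set y | p i f y = 0%R].
have mzero i : measurable (zero i).
  have h f' : measurable [set y | p i f' y = 0%R].
    by have := mp i f' measurableT (measurable_set1 0%R); rewrite setTI.
  exact: measurableU.
have myz i : measurable (Y i @^-1` zero i).
  by rewrite -[X in measurable X]setTI; exact: mY.
have mlr : measurable [set w | (lik_ratio Y p f0 s f w < expR (- ((size s)%:R * kb + u)))%R].
  exact: measurable_lik_ratio_lt.
have null i : i \in s -> P (Y i @^-1` zero i) = 0.
  move=> si; rewrite lawY// /zero.
  apply/eqP; rewrite eq_le integral_ge0 ?andbT; last by move=> y _; rewrite lee_fin.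
  rewrite -[leRHS](density_null_eq0 (mp i f0) (mp i f) (p0 i f0) (KVv i si)).
  rewrite [leLHS]integral_mkcond.
  apply: ge0_le_lower_integral => y _.
    by rewrite patchE; case: ifP => // _; rewrite lee_fin.
  rewrite patchE; case: ifPn => [/set_mem[/= ->|/= ry]|_].
  - by rewrite mulr0.
  - by rewrite indicE mem_set// mul1r.
  - by rewrite lee_fin mulr_ge0.
pose zs i : set W := if i \in s then Y i @^-1` zero i else set0.
have mzs i : measurable (zs i) by rewrite /zs; case: ifP.
apply: (@le_trans _ _ (P big + \sum_(i <- s) P (zs i))); last first.
  rewrite big_seq big1 ?adde0// => i si.
  by rewrite /zs si null.
apply: (measure_le_sum P mlr mbig mzs) => w /= lw.
have [[i [si zi]]|nz] := pselect (exists i, i \in s /\ zero i (Y i w)).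
  by right; exists i => //; rewrite /zs si.
left; suff uZ : (u <= Z w)%R.
  by rewrite /big /= lee_fin ler_sqr ?nnegrE ?(ltW u0)// (le_trans (ltW u0)).
have pos i : i \in s -> (0 < p i f0 (Y i w) /\ 0 < p i f (Y i w))%R.
  move=> si; rewrite !lt_neqAle !p0 !andbT ![0%R == _]eq_sym.
  by split; apply/eqP => z; apply: nz; exists i; split => //; [left|right].
have lrE : (lik_ratio Y p f0 s f w =
    expR (- \sum_(i <- s) llr (p i f0) (p i f) (Y i w)))%R.
  rewrite -sumrN expR_sum /lik_ratio big_seq [RHS]big_seq; apply: eq_bigr => i si.
  have [q0 r0] := pos i si.
  rewrite /llr -lnV ?posrE ?divr_gt0// lnK ?posrE ?invr_gt0 ?divr_gt0//.
  by rewrite invf_div.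
move: lw; rewrite lrE ltr_expR ltrN2 => lw.
have eb : (\sum_(i <- s) e i <= (size s)%:R * kb)%R.
  have -> : ((size s)%:R * kb = \sum_(i <- s) kb)%R.
    by rewrite big_const_seq count_predT iter_addr_0 mulr_natl.
  rewrite big_seq [leRHS]big_seq; apply: ler_sum => i si.
  exact: (llr_mean_le (mp i f0) (mp i f) (p0 i f0) (p0 i f) (p1 i f0) (KLb i si) (KVv i si)).
have -> : (Z w = \sum_(i <- s) llr (p i f0) (p i f) (Y i w) - \sum_(i <- s) e i)%R.
  rewrite -sumrB /Z big_seq [RHS]big_seq; apply: eq_bigr => i si.
  by rewrite /X si.
lra.
Qed.

End chebyshev_tail.

Section chernoff_tail.
Context {R : realType} d {W : measurableType d} (P : probability W R).
Context d' {T : measurableType d'} {n : nat} (Y : 'I_n -> W -> T).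
Context d'' {F : measurableType d''}.
Variables (mu : 'I_n -> {sigma_finite_measure set T -> \bar R})
  (p : 'I_n -> F -> T -> R) (f0 f : F).
Hypothesis indepY : independent_family P Y.
Hypotheses (mp : forall i f, measurable_fun setT (p i f))
  (p0 : forall i f y, 0 <= p i f y).
Hypothesis lawY : forall i A, measurable A ->
  P (Y i @^-1` A) = (\int[mu i]_(y in A) (p i f0 y)%:E)%E.
Local Open Scope ereal_scope.

Let mY i : measurable_fun setT (Y i). Proof. by case: indepY. Qed.

(** Markov's inequality for the product of the [phi i]. These stand for a negative power of the
    density ratio: the power [- lam] in regression, the inverse in the logistic model. *)
Lemma chernoff_tail (s : seq 'I_n) (phi : 'I_n -> T -> R) (c tau K : R) :
  uniq s -> (0 < K)%R -> (0 <= c)%R ->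
  (forall i, measurable_fun setT (phi i)) -> (forall i y, 0 <= phi i y)%R ->
  (forall w, lik_ratio Y p f0 s f w < tau -> K <= \prod_(i <- s) phi i (Y i w))%R ->
  (forall i, i \in s -> \int[mu i]_y (phi i y * p i f0 y)%:E <= c%:E) ->
  P [set w | (lik_ratio Y p f0 s f w < tau)%R] <= (c ^+ size s / K)%:E.
Proof.
move=> us K0 c0 mphi phi0 hK hc; set bad := [set w | _].
have mbad : measurable bad by exact: measurable_lik_ratio_lt.
have H : K%:E * P bad <= (c ^+ size s)%:E.
  have -> : (c ^+ size s = \prod_(i <- s) c)%R.
    by rewrite big_const_seq count_predT -Monoid.iteropE.
  apply: le_trans (integral_prod_le indepY (fun i => mp i f0) (fun i => p0 i f0) lawY
    us mphi phi0 (fun=> c0) hc).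
  rewrite -[bad]setIT -integral_indic// -ge0_integralZl_EFin ?(ltW K0)//; last first.
    by apply/measurable_EFinP; exact: measurable_indic.
  apply: ge0_le_lower_integral => w _; first by rewrite -EFinM lee_fin mulr_ge0// ltW.
  rewrite indicE; case: (boolP (w \in bad)) => [/set_mem h|_].
    by rewrite mule1 lee_fin; exact: hK.
  by rewrite mule0 lee_fin prodr_ge0.
have PE : P bad = (fine (P bad))%:E by rewrite fineK// fin_num_measure.
by move: H; rewrite PE -EFinM !lee_fin ler_pdivlMr// mulrC.
Qed.

End chernoff_tail.

(** In [dominated_model] sigma-finiteness is a property, whereas Tonelli's theorem expects it as
    part of the measure. *)
Lemma sigma_finite_measureP {R : realType} d {T : measurableType d}
    (mu : {measure set T -> \bar R}) : sigma_finite setT mu ->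
  exists nu : {sigma_finite_measure set T -> \bar R}, nu = mu :> (set T -> \bar R).
Proof.
move=> sf.
pose H2 := isSFinite.Build _ _ _ (Measure.sort mu) (sfinite_measure_sigma_finite sf).
pose H3 := isSigmaFinite.Build _ _ _ (Measure.sort mu) sf.
pose nu := HB.pack_for {sigma_finite_measure set T -> \bar R} (Measure.sort mu) H2 H3.
by exists nu.
Qed.

(** * General models under the smoothness assumption *)

Section models.
Context {R : realType} {E : lmodType R} {D : set E} (s : design D)
  (S : set (set (D -> R))).
Context dO {Omega : measurableType dO} (P : probability Omega R)
  (G : nat -> E -> {RV P >-> R}) (g : nat -> R -> R).
Context dW {W : measurableType dW} (P0 : probability W R).
Local Notation F := (functions_on S).
Variables (f0 : F) (eps : R^nat)
  (B : forall n, 'I_(machines s n) -> set F) (c C : R).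
Hypotheses (sb : balanced s)
  (scG : forall k, scalable_process S (G k))
  (sdg : forall n, (0 < n)%N -> scale_density (g n))
  (f0b : bounded_fun f0)
  (eps0 : forall n, 0 < eps n)
  (adS : adequate_sigma_algebra S s f0 eps)
  (prc : prior_conditions (machine_prior S s G g) B f0 eps c C).

Let x n := local_size R s n * eps n ^+ 2.

Let m_gt0 n : (0 < n)%N -> (0 < machines s n)%N.
Proof. exact: machines_gt0. Qed.

Let m_le n : (0 < n)%N -> (machines s n <= n)%N.
Proof.
move=> n0; have [_ /(_ (Ordinal (m_gt0 n0))) h] := sb n0.
rewrite -[leqRHS]h leq_pmull// lt0n; apply/eqP => h0.
have n_eq0 : n = 0%N by rewrite -[LHS]h h0.
by have := n0; rewrite {1}n_eq0.
Qed.

Let region_neq0 n (k : 'I_(machines s n)) : (0 < n)%N -> region s n k !=set0.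
Proof. by move=> n0; have [[_ _ h] _] := sb n0; exact: h. Qed.

Let x0 n : (0 < n)%N -> 0 < x n.
Proof.
by move=> n0; rewrite mulr_gt0 ?exprn_gt0// /local_size divr_gt0 ?ltr0n// m_gt0.
Qed.

(** Chebyshev's inequality supplies the tail. Calibration bounds the mean of the log-likelihood
    ratio by [kap * x n], smoothness bounds the variance by [L * x n], and a deviation [delta * x n]
    then has probability at most [L / delta ^+ 2 / x n]. *)
Lemma contracts_smooth_model d (T : measurableType d)
    (mu : forall n, 'I_n -> {sigma_finite_measure set T -> \bar R})
    (p : forall n, 'I_n -> F -> T -> R) (Y : forall n, 'I_n -> W -> T) :
  dominated_model p mu -> smooth_model s p mu -> kl_calibrated s p mu f0 ->
  (forall n, independent_family P0 (Y n)) ->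
  (forall n (i : 'I_n) (A : set T), measurable A ->
     P0 (Y n i @^-1` A) = (\int[mu n i]_(y in A) (p n i f0 y)%:E)%E) ->
  strong_rate s eps ->
  contracts (machine_prior S s G g) p mu P0 Y f0 eps.
Proof.
move=> dm [L L0 sm] [kappa k3 cal] indepY lawY sr.
have mp n (i : 'I_n) : measurable_fun setT (fun z : F * T => p n i z.1 z.2).
  by case: (dm n i).
have p0 n (i : 'I_n) f y : 0 <= p n i f y by case: (dm n i) => _ _ + _; apply.
have p1 n (i : 'I_n) f : (\int[mu n i]_y (p n i f y)%:E = 1)%E.
  by case: (dm n i) => _ _ _; apply.
have mpf n (i : 'I_n) f : measurable_fun setT (p n i f).
  exact: (measurableT_comp (mp n i) (pair1_measurable f)).
(* A negative [kappa] is raised to 0, so that the bound is monotone in the sup-norm. *)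
pose kap := Num.max kappa 0.
have kap0 : 0 <= kap by rewrite le_max lexx orbT.
have kap3 : kap < 3 by rewrite gt_max k3 ltr0n.
(* Half of the room below 3: [t = kap + delta] is the midpoint of [kap] and 3. *)
pose delta := (3 - kap) / 2.
have delta0 : 0 < delta by rewrite divr_gt0// subr_gt0.
apply: (@contracts_of_tail _ _ _ s S _ _ P G g _ _ P0 f0 eps B c C sb scG sdg eps0 adS prc
  _ T mu p Y mp p0 p1 indepY lawY L L0 _ (kap + delta) (fun n => L / delta ^+ 2 / x n)).
- move=> f h bf bh n k i ik; apply: le_trans (sm f h bf bh n k i ik).
  by rewrite le_max lexx.
- move=> n k f n0 bf fU.
  have hU : forall z, region s n k z -> `|f z - f0 z| <= eps n.
    by move/supnorm_leP : fU.
  have -> : (kap + delta) * (local_size R s n * eps n ^+ 2) =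
     (size (local_index k))%:R * (kap * eps n ^+ 2) + delta * x n.
    by rewrite size_local_index// /x; ring.
  have -> : L / delta ^+ 2 / x n =
     (size (local_index k))%:R * (L * eps n ^+ 2) / (delta * x n) ^+ 2.
    rewrite size_local_index//.
    have -> : local_size R s n * (L * eps n ^+ 2) = L * x n by rewrite /x; ring.
    by field; rewrite !gt_eqF// x0.
  apply: (chebyshev_tail (indepY n) (mpf n) (p0 n) (p1 n) (lawY n)).
  + exact: local_index_uniq.
  + by rewrite mulr_gt0// x0.
  + move=> i /mem_local_index ik; apply: (le_trans (cal f bf n k i ik)).
    apply: (@le_trans _ _ (kap%:E * supnorm (region s n k) (f \- f0)%R ^+ 2)%E).
      by rewrite lee_wpmul2r// ?lee_fin ?le_max ?lexx// sqre_ge0.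
    by apply: mule_supnorm_sqr_le => //; exact: region_neq0.
  + move=> i /mem_local_index ik.
    apply: (@le_trans _ _ (L%:E * supnorm (region s n k) (f0 \- f)%R ^+ 2)%E).
      apply: le_trans (sm f0 f f0b bf n k i ik).
      by rewrite !le_max lexx !orbT.
    apply: mule_supnorm_sqr_le => //; [exact: region_neq0|exact: ltW|].
    by apply/supnorm_leP => z rz /=; rewrite distrC; exact: hU.
- by rewrite /delta; lra.
- have -> : (fun n => (machines s n)%:R * (L / delta ^+ 2 / x n)) =
      (fun n => L / delta ^+ 2 * ((machines s n)%:R / x n)).
    by apply/funext => n; ring.
  rewrite -[X in _ --> X](mulr0 (L / delta ^+ 2)); apply: cvgMl_tmp.
  exact: strong_rate_cvg_div.
- by move=> a a0; exact: strong_rate_cvg_expR.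
Qed.

Lemma contracts_general_model d (T : measurableType d)
    (mu : forall n, 'I_n -> {measure set T -> \bar R})
    (p : forall n, 'I_n -> F -> T -> R) (Y : forall n, 'I_n -> W -> T) :
  dominated_model p mu -> smooth_model s p mu -> kl_calibrated s p mu f0 ->
  (forall n, independent_family P0 (Y n)) ->
  (forall n (i : 'I_n) (A : set T), measurable A ->
     P0 (Y n i @^-1` A) = (\int[mu n i]_(y in A) (p n i f0 y)%:E)%E) ->
  strong_rate s eps ->
  contracts (machine_prior S s G g) p mu P0 Y f0 eps.
Proof.
move=> dm sm cal indepY lawY sr.
have sf n (i : 'I_n) : sigma_finite setT (mu n i) by case: (dm n i).
pose nu n (i : 'I_n) := projT1 (cid (sigma_finite_measureP (sf n i))).
have nuE n (i : 'I_n) : nu n i = mu n i :> (set T -> \bar R).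
  exact: projT2 (cid (sigma_finite_measureP (sf n i))).
(* The model and the contraction statement see the measures as set functions, so this equality
   transports them. *)
have E' : (fun n (i : 'I_n) => mu n i : set T -> \bar R) =
    (fun n (i : 'I_n) => nu n i : set T -> \bar R).
  by apply: functional_extensionality_dep => n; apply/funext => i; rewrite nuE.
rewrite E'; rewrite E' in dm sm cal.
by apply: contracts_smooth_model => // n i A mA; rewrite lawY// nuE.
Qed.

Lemma rate_cvg_expR a : 0 < a -> strong_rate s eps \/ weak_rate s eps ->
  (machines s n)%:R * expR (- (a * (local_size R s n * eps n ^+ 2))) @[n --> \oo] --> 0.
Proof.
by move=> a0 [h|h]; [exact: strong_rate_cvg_expR|exact: weak_rate_cvg_expR].
Qed.

End models.

Lemma le_mule_supnorm_sqr {R : realType} {X : Type} (A : set X) (f : X -> R) (L : R) z :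
  0 <= L -> A z -> ((L * f z ^+ 2)%:E <= L%:E * supnorm A f ^+ 2)%E.
Proof.
move=> L0 Az; have : (`|f z|%:E <= supnorm A f)%E.
  by apply: ereal_sup_ubound; exists z.
case: (supnorm A f) => [v| |]//.
- rewrite lee_fin => fv; rewrite -EFin_expe -EFinM lee_fin ler_wpM2l//.
  have v0 : 0 <= v by exact: le_trans fv.
  by rewrite -[leLHS]real_normK ?num_real// ler_sqr ?nnegrE.
- move=> _; have [->|Ln] := eqVneq L 0; first by rewrite mul0r mul0e.
  have Lp : 0 < L by rewrite lt_neqAle eq_sym Ln.
  by rewrite expe2 mulyy gt0_muley ?leey// lte_fin.
Qed.

(** The Lebesgue measure equals its image under a translation because the two agree on intervals;
    the rest is a change of variables. *)
Lemma integral_lebesgue_shift {R : realType} (a : R) (A : set R) (f : R -> \bar R) :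
  measurable A -> measurable_fun setT f -> (forall y, 0 <= f y)%E ->
  (\int[lebesgue_measure]_(y in A) f y =
   \int[lebesgue_measure]_(z in [set z | A (a + z)%R]) f (a + z)%R)%E.
Proof.
move=> mA mf f0; pose sh : measurableTypeR R -> measurableTypeR R := +%R a.
have msh : measurable_fun setT sh by exact: measurable_funD.
pose X := HB.pack_for {mfun measurableTypeR R >-> measurableTypeR R} sh
  (isMeasurableFun.Build _ _ _ _ _ msh).
have shE B : measurable B -> lebesgue_measure B = pushforward lebesgue_measure X B.
  move=> mB; apply: lebesgue_measure_unique => //= _ [[u v]] _ <-.
  rewrite /pushforward /=.
  have -> : sh @^-1` [set` Interval (BRight u) (BRight v)] =
      [set` Interval (BRight (u - a)) (BRight (v - a))].
    apply/seteqP; split => y /=; rewrite !in_itv /= /sh.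
      by rewrite ltrBlDl lerBrDl.
    by rewrite ltrBlDl lerBrDl.
  rewrite !lebesgue_measure_itv/= !lte_fin ltrD2r; case: ifP => // _.
  by rewrite -!EFinB; congr (_%:E); ring.
rewrite (_ : [set z | _] = sh @^-1` A)//.
rewrite -(ge0_integral_pushforward msh _ _ (f := f))//=; last exact: measurable_funS mf.
by apply: eq_measure_integral => //= B mB _; exact: shE.
Qed.

(* The display of the library's Lebesgue measure is not the default display of
   the real line, which is the one the observations carry. *)
Lemma lebesgue_measure_default_display (R : realType) :
  exists2 nu : {sigma_finite_measure set R -> \bar R},
    nu = lebesgue_measure :> (set R -> \bar R) &
    forall (A : set R) (f : R -> \bar R), measurable A -> measurable_fun setT f ->
      (forall y, 0 <= f y)%E ->
      (\int[nu]_(y in A) f y = \int[lebesgue_measure]_(y in A) f y)%E.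
Proof.
pose i : measurableTypeR R -> R := id.
have mi : measurable_fun setT i by move=> _ A mA; rewrite setTI.
pose mu : {measure set R -> \bar R} :=
  measure_function_pushforward__canonical__measure_function_Measure lebesgue_measure mi.
have [nu nuE] : exists nu : {sigma_finite_measure set R -> \bar R},
    nu = mu :> (set R -> \bar R).
  apply: sigma_finite_measureP.
  have [F FT Foo] := @sigma_finiteT _ _ _ (@lebesgue_measure R).
  by exists F.
exists nu => // A f mA mf f0; rewrite nuE.
rewrite (ge0_integral_pushforward mi lebesgue_measure mA)//.
exact: measurable_funTS.
Qed.

(** * Nonparametric regression *)

Section normal_densities.
Context {R : realType} (sigma : R).
Hypothesis sigma0 : 0 < sigma.
Local Notation phi m := (normal_pdf m sigma).
Local Notation mu := lebesgue_measure.

Let s0 : sigma != 0. Proof. by rewrite gt_eqF. Qed.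

Let phiE m y : phi m y = normal_peak sigma * expR (- (y - m) ^+ 2 / (2 * sigma ^+ 2)).
Proof. by rewrite normal_pdfE// /normal_fun -mulr_natl. Qed.

Let peak0 : 0 < normal_peak sigma. Proof. exact: normal_peak_gt0. Qed.

Lemma normal_pdf_ratio a b y :
  phi b y / phi a y = expR (((y - a) ^+ 2 - (y - b) ^+ 2) / (2 * sigma ^+ 2)).
Proof.
rewrite !phiE -mulf_div divff ?gt_eqF// mul1r -expRN -expRD; congr expR.
by field; rewrite s0.
Qed.

(** Exponential tilting, by completing the square: the power [- l] of the density ratio times the
    density is a multiple of another normal density. The multiple is the exponential moment of
    Chernoff's bound. *)
Lemma normal_pdf_tilt a b l y :
  expR (- l * (((y - a) ^+ 2 - (y - b) ^+ 2) / (2 * sigma ^+ 2))) * phi a y =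
  expR (l * (1 + l) * (a - b) ^+ 2 / (2 * sigma ^+ 2)) * phi ((1 + l) * a - l * b) y.
Proof.
rewrite !phiE mulrCA [RHS]mulrCA -!expRD; congr (_ * expR _).
by field; rewrite s0.
Qed.

(** The geometric mean of two normal densities is a multiple of the normal density centred at the
    midpoint, and the multiple is their Hellinger affinity. *)
Lemma sqrt_normal_pdfM a b y : Num.sqrt (phi a y) * Num.sqrt (phi b y) =
  expR (- (a - b) ^+ 2 / (8 * sigma ^+ 2)) * phi ((a + b) / 2) y.
Proof.
rewrite -sqrtrM ?normal_pdf_ge0//.
set r := RHS; have r0 : 0 <= r by rewrite mulr_ge0 ?expR_ge0 ?normal_pdf_ge0.
rewrite -[RHS]ger0_norm// -sqrtr_sqr; congr Num.sqrt.
rewrite /r !phiE; set k := normal_peak sigma.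
set ea := expR (- (y - a) ^+ 2 / _); set eb := expR (- (y - b) ^+ 2 / _).
set em := expR (- (y - (a + b) / 2) ^+ 2 / _); set ez := expR _.
have h : ea * eb = ez ^+ 2 * em ^+ 2.
  rewrite /ea /eb /em /ez -!expRM_natl -!expRD; congr expR.
  by field; rewrite s0.
by transitivity (k ^+ 2 * (ea * eb)); [ring|rewrite h; ring].
Qed.

(** The squared distance equals [2 - 2 * expR (- z)], which is at most [2 * z]. *)
Lemma hellinger2_normal_le a b :
  (hellinger2 mu (phi a) (phi b) <= ((4 * sigma ^+ 2)^-1 * (a - b) ^+ 2)%:E)%E.
Proof.
set z := (a - b) ^+ 2 / (8 * sigma ^+ 2).
have mphi m : measurable_fun setT (fun y => (phi m y)%:E).
  by apply/measurable_EFinP; exact: measurable_normal_pdf.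
have mh : measurable_fun setT (fun y => ((Num.sqrt (phi a y) - Num.sqrt (phi b y)) ^+ 2)%:E).
  apply/measurable_EFinP; apply: measurable_funX; apply: measurable_funB.
    by apply: (measurableT_comp measurable_sqrt); exact: measurable_normal_pdf.
  by apply: (measurableT_comp measurable_sqrt); exact: measurable_normal_pdf.
have key : (hellinger2 mu (phi a) (phi b) + (2 * expR (- z))%:E = 2%:E)%E.
  have -> : ((2 * expR (- z))%:E =
      \int[mu]_y ((2 * expR (- z))%:E * (phi ((a + b) / 2) y)%:E) :> \bar R)%E.
    rewrite ge0_integralZl_EFin ?mulr_ge0 ?expR_ge0//.
    - by rewrite integral_normal_pdf mule1.
    - by move=> y _; rewrite lee_fin normal_pdf_ge0.
    - exact: mphi.
  rewrite /hellinger2 -ge0_integralD//; first last.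
  - by apply: emeasurable_funM; [exact: measurable_cst|exact: mphi].
  - by move=> y _; rewrite -EFinM lee_fin !mulr_ge0 ?expR_ge0 ?normal_pdf_ge0.
  - by move=> y _; rewrite lee_fin sqr_ge0.
  have -> : (2%:E = \int[mu]_y ((phi a y)%:E + (phi b y)%:E) :> \bar R)%E.
    rewrite ge0_integralD//; try by move=> y _; rewrite lee_fin normal_pdf_ge0.
    - by rewrite !integral_normal_pdf.
    - exact: mphi.
    - exact: mphi.
  apply: eq_integral => y _; rewrite -EFinM -!EFinD; congr (_%:E).
  rewrite -mulrA (_ : expR (- z) * _ = Num.sqrt (phi a y) * Num.sqrt (phi b y)); last first.
    by rewrite sqrt_normal_pdfM /z mulNr.
  rewrite -{3}[phi a y]sqr_sqrtr ?normal_pdf_ge0// -{3}[phi b y]sqr_sqrtr ?normal_pdf_ge0//.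
  ring.
move: key; case: (hellinger2 _ _ _) => [h| |]//; rewrite -EFinD => -[hE].
rewrite lee_fin; have := expR_ge1Dx (- z).
have -> : (4 * sigma ^+ 2)^-1 * (a - b) ^+ 2 = 2 * z by rewrite /z; field; rewrite s0.
lra.
Qed.

(** The left side is the probability that [a + Z] falls in [A] for a noise [Z], so this is the
    density of an observation. *)
Lemma normal_prob_shift a (A : set R) : measurable A ->
  normal_prob 0 sigma [set z | A (a + z)] = (\int[mu]_(y in A) (phi a y)%:E)%E.
Proof.
move=> mA; rewrite (integral_lebesgue_shift a (f := fun y => (phi a y)%:E) mA); last 2 first.
- by apply/measurable_EFinP; exact: measurable_normal_pdf.
- by move=> y; rewrite lee_fin normal_pdf_ge0.
rewrite /normal_prob; apply: eq_integral => z _; congr (_%:E).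
by rewrite !phiE subr0 [a + z]addrC addrK.
Qed.

End normal_densities.

Section regression.
Context {R : realType} {E : lmodType R} {D : set E} (s : design D)
  (S : set (set (D -> R))).
Context dO {Omega : measurableType dO} (P : probability Omega R)
  (G : nat -> E -> {RV P >-> R}) (g : nat -> R -> R).
Context dW {W : measurableType dW} (P0 : probability W R).
Local Notation F := (functions_on S).
Variables (f0 : F) (eps : R^nat)
  (B : forall n, 'I_(machines s n) -> set F) (c C : R).
Hypotheses (sb : balanced s)
  (scG : forall k, scalable_process S (G k))
  (sdg : forall n, (0 < n)%N -> scale_density (g n))
  (eps0 : forall n, 0 < eps n)
  (adS : adequate_sigma_algebra S s f0 eps)
  (prc : prior_conditions (machine_prior S s G g) B f0 eps c C).

Let x n := local_size R s n * eps n ^+ 2.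

(** Chernoff's bound for the power [- lam] of the likelihood ratio: the moments contribute at most
    [lam * (1 + lam) * kap * x n] to the exponent, the threshold takes away [lam * t * x n], and
    [- alpha * x n] remains. *)
Lemma contracts_regression (sigma : R) (Z : forall n, 'I_n -> W -> R) :
  0 < sigma -> 1 < 6 * sigma ^+ 2 ->
  (forall n, independent_family P0 (Z n)) ->
  (forall n (i : 'I_n) (A : set R), measurable A ->
     P0 (Z n i @^-1` A) = normal_prob 0 sigma A) ->
  strong_rate s eps \/ weak_rate s eps ->
  contracts (machine_prior S s G g) (regression_density s sigma)
    (fun n (i : 'I_n) => lebesgue_measure)
    P0 (fun n i w => f0 (point s n i) + Z n i w) f0 eps.
Proof.
move=> sg0 sg6 indepZ lawZ rate.
have sn0 : sigma != 0 by rewrite gt_eqF.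
case: adS => mev _ _.
have [nu nuE nuI] := lebesgue_measure_default_display R; rewrite -nuE.
(* The Kullback-Leibler divergence of two normal densities is [kap] times the squared difference of
   the means, and [1 < 6 * sigma ^+ 2] says that [kap < 3]. *)
pose kap := (2 * sigma ^+ 2)^-1.
have s20 : 0 < sigma ^+ 2 by rewrite exprn_gt0.
have kap0 : 0 < kap by rewrite invr_gt0 mulr_gt0.
have kap3 : kap < 3.
  rewrite -[ltRHS]invrK ltf_pV2 ?posrE ?invr_gt0 ?mulr_gt0//; lra.
(* The maximizer of [lam * t - lam * (1 + lam) * kap], where [t] is the midpoint of [kap] and 3;
   [alpha] is the maximum. *)
pose lam := (3 - kap) / (4 * kap).
have lam0 : 0 < lam by rewrite divr_gt0 ?subr_gt0 ?mulr_gt0.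
pose t := (3 + kap) / 2.
pose alpha := lam * (3 - kap) / 4.
have alpha0 : 0 < alpha by rewrite divr_gt0// mulr_gt0// subr_gt0.
have alphaE : alpha = lam * t - lam * (1 + lam) * kap.
  by rewrite /alpha /t /lam; field; rewrite gt_eqF.
have mZ n (i : 'I_n) : measurable_fun setT (Z n i) by case: (indepZ n).
have msh a (A : set R) : measurable A -> measurable [set z | A (a + z)].
  move=> mA; rewrite -[X in measurable X]setTI.
  by apply: (_ : measurable_fun setT (fun z => a + z)) => //; exact: measurable_funD.
have mp n (i : 'I_n) : measurable_fun setT
    (fun z : F * R => regression_density s sigma i z.1 z.2).
  rewrite /regression_density.
  rewrite (_ : (fun _ => _) = fun z : F * R => normal_peak sigma *
      expR (- (z.2 - z.1 (point s n i)) ^+ 2 / (sigma ^+ 2 *+ 2))); last first.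
    by apply/funext => z; rewrite normal_pdfE.
  apply: measurable_funM => //; apply: (measurableT_comp (@measurable_expR R)).
  apply: measurable_funM => //; apply: measurableT_comp => //.
  apply: measurable_funX; apply: measurable_funB => //.
  exact: (measurableT_comp (mev (point s n i))).
have p0 n (i : 'I_n) (f : F) y : 0 <= regression_density s sigma i f y.
  exact: normal_pdf_ge0.
have mpf m : measurable_fun setT (normal_pdf m sigma) by exact: measurable_normal_pdf.
have p1 m : (\int[nu]_y (normal_pdf m sigma y)%:E = 1)%E.
  rewrite nuI//; first exact: integral_normal_pdf.
    exact/measurable_EFinP.
  by move=> y; rewrite lee_fin normal_pdf_ge0.
have indepY n : independent_family P0 (fun (i : 'I_n) w => f0 (point s n i) + Z n i w).
  split; first by move=> i; exact: measurable_funD.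
  move=> A mA; have [_ /(_ (fun i => [set z | A i (f0 (point s n i) + z)]))] := indepZ n.
  by apply => i; exact: msh.
have lawY n (i : 'I_n) (A : set R) : measurable A ->
    P0 ((fun w => f0 (point s n i) + Z n i w) @^-1` A) =
    (\int[nu]_(y in A) (regression_density s sigma i f0 y)%:E)%E.
  move=> mA; rewrite /regression_density nuI//; first last.
  - by move=> y; rewrite lee_fin normal_pdf_ge0.
  - exact/measurable_EFinP.
  rewrite -normal_prob_shift//.
  by rewrite -(lawZ n i _ (msh _ _ mA)).
have hell a b : (hellinger2 nu (normal_pdf a sigma) (normal_pdf b sigma) <=
    ((4 * sigma ^+ 2)^-1 * (a - b) ^+ 2)%:E)%E.
  rewrite /hellinger2 nuI//; first exact: hellinger2_normal_le.
    apply/measurable_EFinP; apply: measurable_funX; apply: measurable_funB;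
      exact: (measurableT_comp measurable_sqrt).
  by move=> y; rewrite lee_fin sqr_ge0.
have crit := contracts_of_tail sb scG sdg eps0 adS prc
  (mu := fun n (i : 'I_n) => nu) (p := regression_density s sigma)
  (Y := fun n i w => f0 (point s n i) + Z n i w) mp p0 (fun n i f => p1 _) indepY lawY.
have {}crit := crit (4 * sigma ^+ 2)^-1 _ _ t (fun n => expR (- (alpha * x n))).
apply: crit.
- by rewrite invr_gt0 mulr_gt0.
- move=> f h bf bh n k i ik; apply: (le_trans (hell _ _)).
  apply: (le_mule_supnorm_sqr (f \- h)%R _ ik).
  by rewrite invr_ge0 mulr_ge0// ltW.
- move=> n k f n0 bf /supnorm_leP fU.
  pose q (i : 'I_n) y : R := ((y - f0 (point s n i)) ^+ 2 - (y - f (point s n i)) ^+ 2)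
    / (2 * sigma ^+ 2).
  pose phi (i : 'I_n) y : R := expR (- lam * q i y).
  have -> : expR (- (alpha * x n)) =
      expR (lam * (1 + lam) * kap * eps n ^+ 2) ^+ size (local_index k)
        / expR (lam * t * x n).
    rewrite -expRM_natl size_local_index// -expRN -expRD; congr expR.
    by rewrite alphaE /x; ring.
  have mpn (i : 'I_n) (f' : F) : measurable_fun setT (regression_density s sigma i f').
    exact: mpf.
  apply: (chernoff_tail (indepY n) mpn (p0 n) (lawY n) (phi := phi)).
  + exact: local_index_uniq.
  + exact: expR_gt0.
  + exact: expR_ge0.
  + move=> i; apply: (measurableT_comp (@measurable_expR R)).
    apply: measurable_funM => //; apply: measurable_funM => //.
    by apply: measurable_funB; apply: measurable_funX; exact: measurable_funB.
  + by move=> i y; exact: expR_ge0.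
  + move=> w; rewrite /lik_ratio /phi.
    rewrite (eq_bigr (fun i => expR (q i (f0 (point s n i) + Z n i w)))); last first.
      by move=> i _; rewrite /ratio /regression_density normal_pdf_ratio.
    rewrite -!expR_sum ltr_expR ler_expR -mulr_sumr -/(x n) => h.
    by rewrite mulNr -mulrA -mulrN ler_pM2l// lerNr ltW.
  + move=> i /mem_local_index ik; rewrite /phi /q /regression_density.
    under eq_integral do rewrite (normal_pdf_tilt sg0) EFinM.
    rewrite ge0_integralZl_EFin ?expR_ge0//; last 2 first.
    * by move=> y _; rewrite lee_fin normal_pdf_ge0.
    * by apply/measurable_EFinP; exact: measurable_normal_pdf.
    rewrite p1 mule1 lee_fin ler_expR -mulrA -/kap -[leRHS]mulrA.
    have l1 : 0 < lam * (1 + lam) by rewrite mulr_gt0// addr_gt0.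
    rewrite ler_pM2l// mulrC ler_pM2l//.
    rewrite -[leLHS]real_normK ?num_real// ler_sqr ?nnegrE ?(ltW (eps0 n))// distrC.
    exact: fU.
- by rewrite /t; lra.
- exact: rate_cvg_expR.
- by move=> a a0; exact: rate_cvg_expR.
Qed.

End regression.

(** * Logistic regression *)

Section logistic_function.
Context {R : realType}.
Implicit Types a b x : R.

Lemma logistic_gt0 x : 0 < logistic x.
Proof. by rewrite invr_gt0 addr_gt0 ?expR_gt0. Qed.

Lemma logistic_le1 x : logistic x <= 1.
Proof. by rewrite invf_le1 ?addr_gt0 ?expR_gt0// lerDl expR_ge0. Qed.

Lemma logisticN x : logistic (- x) = 1 - logistic x.
Proof.
rewrite /logistic opprK expRN; have := expR_gt0 x; set u := expR x => u0.
by field; rewrite !gt_eqF//= addr_gt0.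
Qed.

(** For [b <= a], the logistic function loses at most a factor [expR (- (a - b))] from [a] to [b].
    Its root loses at most the root of this factor, which is at least [1 - (a - b) / 2], and the
    root at [a] is at most 1. *)
Lemma sqrt_logistic_lip a b :
  `|Num.sqrt (logistic a) - Num.sqrt (logistic b)| <= `|a - b| / 2.
Proof.
wlog ba : a b / b <= a => [h|].
  have [/h//|/ltW/h] := leP b a; by rewrite distrC [in leRHS]distrC.
have ba0 : 0 <= a - b by rewrite subr_ge0.
have la : 0 <= Num.sqrt (logistic a) <= 1.
  by rewrite sqrtr_ge0 -[leRHS]sqrtr1 ler_wsqrtr ?logistic_le1.
have le_ab : logistic b <= logistic a.
  rewrite lef_pV2 ?posrE ?addr_gt0 ?expR_gt0// lerD2l ler_expR; lra.
have lb : expR (- ((a - b) / 2)) * Num.sqrt (logistic a) <= Num.sqrt (logistic b).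
  rewrite -[expR _]ger0_norm ?expR_ge0// -sqrtr_sqr -sqrtrM ?sqr_ge0//.
  rewrite ler_wsqrtr// -expRM_natl ler_pdivrMr ?addr_gt0 ?expR_gt0//.
  rewrite [leRHS]mulrC ler_pdivlMr ?addr_gt0 ?expR_gt0// mulrDr mulr1 -expRD.
  apply: lerD.
    by rewrite -[leRHS]expR0 ler_expR; lra.
  by rewrite ler_expR; lra.
have e1 := expR_ge1Dx (- ((a - b) / 2)).
rewrite (ger0_norm ba0) ger0_norm ?subr_ge0 ?ler_wsqrtr//.
move: lb la; set sa := Num.sqrt (logistic a); set sb := Num.sqrt (logistic b).
by move=> lb /andP[sa0 sa1]; nra.
Qed.

(** For nonnegative [x], with [u = expR (x / 2)] and [v = 1 / u]: [1 - v <= x / 2], so [u <= 2] and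
    [u - 1 = u * (1 - v) <= x]; hence [u - v <= 2 * x]. *)
Lemma expR_half_sub_sqr_le x : `|x| <= 1 ->
  (expR (x / 2) - expR (- (x / 2))) ^+ 2 <= 4 * x ^+ 2.
Proof.
wlog x0 : x / 0 <= x => [h|].
  have [/h//|x0] := leP 0 x; rewrite -normrN => /h; rewrite oppr_ge0 (ltW x0) => /(_ isT).
  by rewrite mulNr opprK [in leRHS]sqrrN -[in X in _ -> X]sqrrN opprB.
rewrite ger0_norm// => x1.
have e1 := expR_ge1Dx (- (x / 2)); have eM := expRxMexpNx_1 (x / 2).
have e0 := expR_gt0 (x / 2).
move: e1 eM e0; set u := expR (x / 2); set v := expR _ => e1 eM e0.
have uv : 0 <= u - v by rewrite subr_ge0 ler_expR; lra.
have u2 : u <= 2 by nra.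
have hx : u - v <= 2 * x by nra.
rewrite (_ : 4 * x ^+ 2 = (2 * x) ^+ 2); last by ring.
by rewrite ler_sqr// nnegrE; lra.
Qed.

(** The left side is the mean, under the parameter [a], of the density ratio of [a] to [b]: one plus
    a chi-square divergence. The excess is [(u - v) ^+ 2 / (v * (1 + u) ^+ 2)], and
    [(1 + u) ^+ 2 >= 4 * u] bounds it by a quarter of [(u - v) ^+ 2 / (u * v)], the square estimated
    just before. *)
Lemma chi_square_logistic_le a b : `|a - b| <= 1 ->
  logistic a ^+ 2 / logistic b + (1 - logistic a) ^+ 2 / (1 - logistic b)
  <= 1 + (a - b) ^+ 2.
Proof.
move=> ab1; have h := expR_half_sub_sqr_le ab1.
rewrite -!logisticN /logistic !opprK !invrK.
set u := expR (- a); set v := expR (- b).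
have u0 : 0 < u by exact: expR_gt0.
have v0 : 0 < v by exact: expR_gt0.
rewrite -[expR a]invrK -expRN -/u -[expR b]invrK -expRN -/v.
have -> : (1 + u)^-1 ^+ 2 * (1 + v) + (1 + u^-1)^-1 ^+ 2 * (1 + v^-1) =
    1 + (u - v) ^+ 2 / (v * (1 + u) ^+ 2).
  by field; rewrite !gt_eqF//= addr_gt0.
rewrite lerD2l.
have hE : (expR ((a - b) / 2) - expR (- ((a - b) / 2))) ^+ 2 = (u - v) ^+ 2 / (u * v).
  have -> : (expR ((a - b) / 2) - expR (- ((a - b) / 2))) ^+ 2 =
     expR (a - b) + expR (b - a) - 2.
    have := expRxMexpNx_1 ((a - b) / 2).
    rewrite {5}(_ : a - b = (a - b) / 2 + (a - b) / 2); last by field.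
    rewrite (_ : b - a = - ((a - b) / 2) + - ((a - b) / 2)); last by field.
    rewrite !expRD; set p := expR ((a - b) / 2); set q := expR _ => pq.
    by transitivity (p * p + q * q - 2 * (p * q)); [ring|rewrite pq mulr1].
  rewrite (_ : a - b = - b - - a); last by ring.
  rewrite (_ : b - a = - a - - b); last by ring.
  rewrite !expRB -/u -/v.
  by field; rewrite !gt_eqF.
rewrite hE in h.
apply: (@le_trans _ _ ((u - v) ^+ 2 / (u * v) / 4)); last by rewrite ler_pdivrMr// [leRHS]mulrC.
rewrite -mulrA ler_wpM2l ?sqr_ge0// -invfM lef_pV2 ?posrE ?mulr_gt0 ?exprn_gt0 ?addr_gt0//.
by have := sqr_ge0 (1 - u); nra.
Qed.

End logistic_function.

Section counting_bool.
Context {R : realType}.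
Local Open Scope ereal_scope.

Lemma measurable_bool (A : set bool) : measurable A. Proof. by []. Qed.

Lemma measurable_fun_bool d {T : measurableType d} (f : bool -> T) :
  measurable_fun setT f.
Proof. by move=> _ A mA; exact: measurable_bool. Qed.

Lemma sigma_finite_counting_bool : sigma_finite setT (@counting bool R).
Proof.
exists (fun=> setT); first by rewrite bigcup_const.
by move=> i; split => //; rewrite /counting asboolT ?ltry//; exact: finite_finset.
Qed.

Lemma integral_counting_bool (A : set bool) (f : bool -> R) : (forall y, 0 <= f y)%R ->
  \int[counting]_(y in A) (f y)%:E = (f true * \1_A true + f false * \1_A false)%:E.
Proof.
move=> f0; have mf : measurable_fun setT (EFin \o f) by exact: measurable_fun_bool.
have c1 b : (@counting bool R : {measure set bool -> \bar R}) [set b] = 1.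
  by rewrite /= /counting asboolT// fset_set1 finmap.cardfs1.
rewrite integral_mkcond.
transitivity (\int[@counting bool R]_y
    ((f true * \1_A true)%:E * (\1_[set true] y)%:E +
     (f false * \1_A false)%:E * (\1_[set false] y)%:E)).
  apply: eq_integral => y _; rewrite patchE indicE !EFinM.
  rewrite !indicE; case: y; rewrite !in_set1/= ?mule1 ?mule0 ?adde0 ?add0e;
    by case: ifP => _; rewrite ?mule1 ?mule0.
have m1 b : measurable_fun setT (fun y : bool => (\1_[set b] y)%:E : \bar R).
  exact: measurable_fun_bool.
have p b : (0 <= f b * \1_A b)%R by rewrite mulr_ge0.
rewrite ge0_integralD//;
  try by [move=> y _; rewrite -EFinM lee_fin mulr_ge0|exact: measurable_fun_bool].
rewrite !ge0_integralZl_EFin// !integral_indic// !setIT.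
by rewrite !c1 !mule1.
Qed.

End counting_bool.

Section logistic_regression.
Context {R : realType} {E : lmodType R} {D : set E} (s : design D)
  (S : set (set (D -> R))).
Context dO {Omega : measurableType dO} (P : probability Omega R)
  (G : nat -> E -> {RV P >-> R}) (g : nat -> R -> R).
Context dW {W : measurableType dW} (P0 : probability W R).
Local Notation F := (functions_on S).
Variables (f0 : F) (eps : R^nat)
  (B : forall n, 'I_(machines s n) -> set F) (c C : R).
Hypotheses (sb : balanced s)
  (scG : forall k, scalable_process S (G k))
  (sdg : forall n, (0 < n)%N -> scale_density (g n))
  (eps0 : forall n, 0 < eps n)
  (eps_cvg0 : eps @ \oo --> 0)
  (adS : adequate_sigma_algebra S s f0 eps)
  (prc : prior_conditions (machine_prior S s G g) B f0 eps c C).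

Let x n := local_size R s n * eps n ^+ 2.

Let logistic_density_gt0 n (i : 'I_n) (f : F) y : 0 < logistic_density s i f y.
Proof. by rewrite /logistic_density -logisticN; case: y; exact: logistic_gt0. Qed.

Let logistic_density_ge0 n (i : 'I_n) (f : F) y : 0 <= logistic_density s i f y.
Proof. exact: ltW. Qed.

(** One Lipschitz bound per label, since [1 - logistic a] is [logistic (- a)]. *)
Let hellinger2_logistic_le n (i : 'I_n) (f h : F) :
  (hellinger2 counting (logistic_density s i f) (logistic_density s i h)
   <= (2^-1 * (f (point s n i) - h (point s n i)) ^+ 2)%:E)%E.
Proof.
rewrite /hellinger2 integral_counting_bool; last by move=> y; rewrite sqr_ge0.
rewrite !indicT !mulr1 lee_fin /logistic_density -!logisticN.
set a := f _; set b := h _.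
have sq (u v : R) : (Num.sqrt (logistic u) - Num.sqrt (logistic v)) ^+ 2 <= (u - v) ^+ 2 / 4.
  rewrite -[leLHS]real_normK ?num_real// -[(u - v) ^+ 2]real_normK ?num_real//.
  rewrite (_ : `|u - v| ^+ 2 / 4 = (`|u - v| / 2) ^+ 2); last by field.
  by rewrite ler_sqr ?nnegrE ?divr_ge0// sqrt_logistic_lip.
have := lerD (sq a b) (sq (- a) (- b)).
rewrite (_ : (a - b) ^+ 2 / 4 + (- a - - b) ^+ 2 / 4 = 2^-1 * (a - b) ^+ 2)//.
by field.
Qed.

(** Chernoff's bound for the inverse likelihood ratio: its mean is at most [expR (eps n ^+ 2)] per
    observation when [eps n <= 1], so with [t = 2] the tail is [expR (x n - 2 * x n)]. *)
Lemma contracts_logistic (Y : forall n, 'I_n -> W -> bool) :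
  (forall n, independent_family P0 (Y n)) ->
  (forall n (i : 'I_n),
     P0 (Y n i @^-1` [set true]) = (logistic (f0 (point s n i)))%:E) ->
  strong_rate s eps \/ weak_rate s eps ->
  contracts (machine_prior S s G g) (logistic_density s)
    (fun n (i : 'I_n) => counting) P0 Y f0 eps.
Proof.
move=> indepY lawYt rate; case: adS => mev _ _.
have [nu nuE] := sigma_finite_measureP (@sigma_finite_counting_bool R).
have nuI (A : set bool) (f : bool -> R) : (forall y, 0 <= f y) ->
    (\int[nu]_(y in A) (f y)%:E = (f true * \1_A true + f false * \1_A false)%:E)%E.
  by move=> f_ge0; rewrite nuE; exact: integral_counting_bool.
have mp n (i : 'I_n) : measurable_fun setT
    (fun z : F * bool => logistic_density s i z.1 z.2).
  have ml : measurable_fun setT (fun z : F * bool => logistic (z.1 (point s n i))).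
    rewrite (_ : (fun _ => _) = fun z : F * bool => 1 / (1 + expR (- z.1 (point s n i)))).
      apply: measurable_fun_div_ge0 => //.
      apply: measurable_funD => //; apply: (measurableT_comp (@measurable_expR R)).
      apply: measurableT_comp => //.
      exact: (measurableT_comp (mev (point s n i))).
    by apply/funext => z; rewrite div1r.
  rewrite /logistic_density; apply: measurable_fun_ifT => //.
  exact: measurable_funB.
have p1 n (i : 'I_n) (f : F) : (\int[nu]_y (logistic_density s i f y)%:E = 1)%E.
  by rewrite nuI// !indicT !mulr1 /logistic_density addrC subrK.
have lawY n (i : 'I_n) (A : set bool) : measurable A ->
    P0 (Y n i @^-1` A) = (\int[nu]_(y in A) (logistic_density s i f0 y)%:E)%E.
  move=> _; rewrite nuI// /logistic_density.
  have mt : measurable (Y n i @^-1` [set true]).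
    have [mY _] := indepY n.
    by rewrite -[X in measurable X]setTI; exact: mY.
  have lawf : P0 (Y n i @^-1` [set false]) = (1 - logistic (f0 (point s n i)))%:E.
    rewrite (_ : _ @^-1` _ = ~` (Y n i @^-1` [set true])); last first.
      by apply/seteqP; split => w /=; case: (Y n i w).
    by rewrite probability_setC// lawYt EFinB.
  rewrite !indicE; case: (boolP (true \in A)) => [/set_mem At|/negP At];
    case: (boolP (false \in A)) => [/set_mem Af|/negP Af].
  - rewrite (_ : _ @^-1` _ = setT) ?probability_setT ?mulr1 ?subrKC ?addrC ?subrK//.
    by apply/seteqP; split => w //= _; case: (Y n i w).
  - rewrite mulr1 mulr0 addr0 -lawYt; congr (P0 _).
    apply/seteqP; split => w /=; case: (Y n i w) => // h.
    by exfalso; apply: Af; exact/mem_set.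
  - rewrite mulr1 mulr0 add0r -lawf; congr (P0 _).
    apply/seteqP; split => w /=; case: (Y n i w) => // h.
    by exfalso; apply: At; exact/mem_set.
  - rewrite !mulr0 addr0 (_ : _ @^-1` _ = set0) ?measure0//.
    apply/seteqP; split => w //=; case: (Y n i w) => h; exfalso.
      by apply: At; exact/mem_set.
    by apply: Af; exact/mem_set.
rewrite -nuE.
have crit := contracts_of_tail sb scG sdg eps0 adS prc
  (mu := fun n (i : 'I_n) => nu) (p := logistic_density s) (Y := Y) mp
  logistic_density_ge0 p1 indepY lawY.
(* The chi-square bound needs |f - f0| <= 1, hence eps n <= 1. *)
have {}crit := crit 2^-1 _ _ 2 (fun n => if eps n <= 1 then expR (- x n) else 1).
apply: crit.
- by rewrite invr_gt0.
- move=> f h bf bh n k i ik; rewrite nuE.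
  apply: (le_trans (hellinger2_logistic_le _ _ _)).
  by apply: (le_mule_supnorm_sqr (f \- h)%R _ ik); rewrite invr_ge0.
- move=> n k f n0 bf /supnorm_leP fU.
  have mpn (i : 'I_n) (f' : F) : measurable_fun setT (logistic_density s i f').
    exact: measurable_fun_bool.
  case: ifPn => [eps1|_]; last first.
    by apply: probability_le1; apply: measurable_lik_ratio_lt => // i; case: (indepY n).
  pose phi (i : 'I_n) y : R := logistic_density s i f0 y / logistic_density s i f y.
  have -> : expR (- x n) =
      expR (eps n ^+ 2) ^+ size (local_index k) / expR (2 * x n).
    by rewrite -expRM_natl size_local_index// -expRN -expRD; congr expR; rewrite /x; ring.
  apply: (chernoff_tail (indepY n) mpn (@logistic_density_ge0 n) (lawY n) (phi := phi)).
  + exact: local_index_uniq.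
  + exact: expR_gt0.
  + exact: expR_ge0.
  + by move=> i; exact: measurable_fun_bool.
  + by move=> i y; rewrite divr_ge0.
  + move=> w lw; rewrite (_ : \prod_(_ <- _) _ =
        (lik_ratio (Y n) (fun i (f : F) => logistic_density s i f) f0
          (local_index k) f w)^-1); last first.
      by rewrite -prodfV; apply: eq_bigr => i _; rewrite invf_div.
    rewrite -[leLHS]invrK -expRN lef_pV2 ?posrE ?expR_gt0 ?(ltW lw)//.
    by apply: prodr_gt0 => i _; rewrite divr_gt0.
  + move=> i /mem_local_index ik; rewrite nuI; last by move=> y; rewrite mulr_ge0// divr_ge0.
    rewrite !indicT !mulr1 lee_fin; apply: le_trans (expR_ge1Dx _).
    have fe : `|f0 (point s n i) - f (point s n i)| <= eps n.
      by rewrite distrC; exact: fU.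
    apply: (@le_trans _ _ (1 + (f0 (point s n i) - f (point s n i)) ^+ 2)).
      apply: le_trans (chi_square_logistic_le (le_trans fe eps1)).
      have phiM (q r : R) : q / r * q = q ^+ 2 / r by rewrite expr2 mulrAC.
      by rewrite /phi !phiM.
    rewrite lerD2l -[leLHS]real_normK ?num_real// ler_sqr ?nnegrE//.
    exact: ltW.
- lra.
(* As [eps n] tends to 0, the trivial bound 1 on the tail serves for finitely many [n] only. *)
- apply: cvg_trans (rate_cvg_expR sb eps0 ltr01 rate); apply: near_eq_cvg.
  have /cvgr0Pnorm_le /(_ 1 ltr01) := eps_cvg0; apply: filterS => n.
  by rewrite gtr0_norm// => ->; rewrite mul1r.
- by move=> a a0; exact: rate_cvg_expR.
Qed.

End logistic_regression.

Theorem theorem4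
  (R : realType) (E : lmodType R) (D : set E) (s : design D)
  (S : set (set (D -> R)))
  (dO : measure_display) (Omega : measurableType dO) (P : probability Omega R)
  (G : nat -> E -> {RV P >-> R}) (g : nat -> R -> R)
  (dW : measure_display) (W : measurableType dW) (P0 : probability W R)
  (f0 : functions_on S) (eps : R^nat)
  (B : forall n, 'I_(machines s n) -> set (functions_on S)) (c C : R) :
  balanced s ->
  iid_centered_gaussian (dilates (D := D)) G ->
  (forall k, scalable_process S (G k)) ->
  (forall n, (0 < n)%N -> scale_density (g n)) ->
  bounded_fun f0 ->
  (forall n, 0 < eps n) ->
  eps @ \oo --> 0 ->
  adequate_sigma_algebra S s f0 eps ->
  0 < c -> 0 < C ->
  prior_conditions (machine_prior S s G g) B f0 eps c C ->
  [/\ (forall (d : measure_display) (T : measurableType d)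
         (mu : forall n, 'I_n -> {measure set T -> \bar R})
         (p : forall n, 'I_n -> functions_on S -> T -> R)
         (Y : forall n, 'I_n -> W -> T),
       dominated_model p mu ->
       smooth_model s p mu ->
       kl_calibrated s p mu f0 ->
       (forall n, independent_family P0 (Y n)) ->
       (forall n (i : 'I_n) (A : set T), measurable A ->
          P0 (Y n i @^-1` A) = (\int[mu n i]_(y in A) (p n i f0 y)%:E)%E) ->
       strong_rate s eps ->
       contracts (machine_prior S s G g) p mu P0 Y f0 eps),
      (forall (sigma : R) (Z : forall n, 'I_n -> W -> R),
       0 < sigma ->
       1 < 6 * sigma ^+ 2 ->
       (forall n, independent_family P0 (Z n)) ->
       (forall n (i : 'I_n) (A : set R), measurable A ->
          P0 (Z n i @^-1` A) = normal_prob 0 sigma A) ->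
       strong_rate s eps \/ weak_rate s eps ->
       contracts (machine_prior S s G g) (regression_density s sigma)
         (fun n (i : 'I_n) => lebesgue_measure)
         P0 (fun n i w => f0 (point s n i) + Z n i w) f0 eps)
    & (forall (Y : forall n, 'I_n -> W -> bool),
       (forall n, independent_family P0 (Y n)) ->
       (forall n (i : 'I_n),
          P0 (Y n i @^-1` [set true]) = (logistic (f0 (point s n i)))%:E) ->
       strong_rate s eps \/ weak_rate s eps ->
       contracts (machine_prior S s G g) (logistic_density s)
         (fun n (i : 'I_n) => counting)
         P0 Y f0 eps) ].
Proof.
move=> sb _ scG sdg f0b eps0 eps_cvg0 adS _ _ prc; split.
- move=> d T mu p Y dm sm cal indepY lawY sr.
  exact: (contracts_general_model sb scG sdg f0b eps0 adS prc).
- move=> sigma Z sg0 sg6 indepZ lawZ rate.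
  exact: (contracts_regression sb scG sdg eps0 adS prc).
- move=> Y indepY lawY rate.
  exact: (contracts_logistic sb scG sdg eps0 eps_cvg0 adS prc).
Qed.
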